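(* Let $k_1,k_2\ge 0$ be integers. In the chart $\mu_1\neq 0$ (with the sign $\varepsilon_1=\operatorname{sgn}(\mu_1)$ fixed), the regular doubly spiral locus in the $(C_1,C_2)$-plane has the two chambers $C_1>0$ and $C_1<0$, i.e. it is the disjoint union of $\mathcal U_{k_1,k_2}\cap\{C_1>0\}$ and $\mathcal U_{k_1,k_2}\cap\{C_1<0\}$. If $k_1+k_2>0$, then on each chamber the phase map $\Pi$ is real analytic and its full-rank locus $\{(C_1,C_2):\operatorname{rank}D\Pi(C_1,C_2)=2\}$ is open and dense. Moreover (still for $k_1+k_2>0$), for every $M\in\mathbb N$, the parameters $(C_1,C_2)$ determining ordinarily closed profiles $\gamma$ with primitive ordinary closing order $m_\gamma>M$ are dense in each chamber.
   Context: On $\mathbb S^3\subset\mathbb C^2$ write, where $z_1z_2\ne0$, $z_1=\cos s\,e^{i\theta_1}$, $z_2=\sin s\,e^{i\theta_2}$, $0<s<\frac\pi2$, with real phase lifts $\theta_i$. Let $\rho(s)=(\cos s)^{k_1}(\sin s)^{k_2}$ and $\bar g=\rho^2g_{\mathbb S^3}$, $g_{\mathbb S^3}$ the round metric. A profile is a geodesic $\gamma$ of $\bar g$, affinely parametrized. Along it $$\mathcal H=\tfrac12|\dot\gamma|_{\bar g}^2,\qquad \mu_1=\rho^2\cos^2s\,\dot\theta_1,\qquad \mu_2=\rho^2\sin^2s\,\dot\theta_2$$ are constant. On $\mu_1\ne0$ set $C_1=\mu_2/\mu_1$, $C_2=2\mathcal H/\mu_1^2$. A profile is regular oscillatory if its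 magnitude $s$ oscillates between two values $s_-<s_+$ with $0<s_-<s_+<\frac\pi2$; a complete cell is one excursion $s_-\to s_+\to s_-$. It is doubly spiral if $\mu_1\mu_2\neq0$. The regular doubly spiral locus is the set of $(C_1,C_2)$ of regular oscillatory doubly spiral profiles. Put $$P_{C_1}(s)=\frac{\sin^2s+C_1^2\cos^2s}{\rho(s)^2\cos^2s\sin^2s},\qquad R_{k_1,k_2}(C_1)=\inf_{0<s<\pi/2}P_{C_1}(s),\qquad \mathcal U_{k_1,k_2}=\{(C_1,C_2)\in\mathbb R^2:C_2>R_{k_1,k_2}(C_1)\}.$$ Let $\Delta_i(C_1,C_2)$ be the increment of $\theta_i$ over one complete cell (it depends only on $(C_1,C_2)$ once $\operatorname{sgn}\mu_1$ is fixed), and $\Pi(C_1,C_2)=\left(\frac{\Delta_1}{2\pi},\frac{\Delta_2}{2\pi}\right)$. The profile is ordinarily closed if $m\,\Pi(C_1,C_2)\in\mathbb Z^2$ for some positive integer $m$ (i.e. it closes up after $m$ cells); the least such $m$ is the primitive ordinary closing order $m_\gamma$. *)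

(* Defs.v *)
From mathcomp Require Import all_boot all_order all_algebra.
From mathcomp Require Import all_classical all_reals all_analysis.

Set Implicit Arguments.
Unset Strict Implicit.
Unset Printing Implicit Defensive.

Import Order.TTheory GRing.Theory Num.Theory.
Import numFieldNormedType.Exports.

Local Open Scope classical_set_scope.
Local Open Scope ring_scope.

Section RiemannianCoordinates.
Context {R : realType} {n : nat}.
Implicit Types (g : 'rV[R]_n -> 'M[R]_n) (x : 'rV[R]_n) (gamma : R -> 'rV[R]_n).

Definition partial (i : 'I_n) (f : 'rV[R]_n -> R) x : R := 'D_(delta_mx 0 i) f x.

(* christoffel g k i j x is the Christoffel symbol of the second kind,
   with upper index k, of the metric with Gram matrix g *)
Definition christoffel g (k i j : 'I_n) x : R :=
  2^-1 * \sum_(l < n) invmx (g x) k l *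
    (partial i (fun y => g y j l) x + partial j (fun y => g y i l) x
     - partial l (fun y => g y i j) x).

Definition coord gamma (i : 'I_n) : R -> R := fun t => gamma t 0 i.

Definition velocity gamma (i : 'I_n) : R -> R := (coord gamma i)^`()%classic.

Definition norm2 g gamma (t : R) : R :=
  \sum_(i < n) \sum_(j < n)
    g (gamma t) i j * velocity gamma i t * velocity gamma j t.

Definition geodesic g gamma : Prop :=
  forall (t : R) (k : 'I_n),
    [/\ derivable (coord gamma k) t 1,
        derivable (velocity gamma k) t 1 &
        (velocity gamma k)^`()%classic t
        + \sum_(i < n) \sum_(j < n)
            christoffel g k i j (gamma t) * velocity gamma i t * velocity gamma j t
        = 0].

End RiemannianCoordinates.

Section RealAnalytic.
Context {R : realType}.

(* the double series sum_(i,j) c i j x^i y^j converges absolutely, with sum v *)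
Definition double_series_sum (c : nat -> nat -> R) (x y v : R) : Prop :=
  summable [set: nat * nat] (fun ij => (c ij.1 ij.2 * x ^+ ij.1 * y ^+ ij.2)%:E)
  /\ (\sum_(i < N) \sum_(j < N) c i j * x ^+ i * y ^+ j @[N --> \oo] --> v).

Definition real_analytic_at (f : 'rV[R]_2 -> R) (p : 'rV[R]_2) : Prop :=
  exists c : nat -> nat -> R,
    nbhs p [set q : 'rV[R]_2 |
      double_series_sum c (q 0 0 - p 0 0) (q 0 1 - p 0 1) (f q)].

Definition real_analytic_on (A : set 'rV[R]_2) (f : 'rV[R]_2 -> 'rV[R]_2) : Prop :=
  forall p, A p -> forall i : 'I_2, real_analytic_at (fun q => f q 0 i) p.

End RealAnalytic.

Section Profiles.
Context {R : realType}.
Variables k1 k2 : nat.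
Implicit Types (x : 'rV[R]_3) (gamma : R -> 'rV[R]_3) (C : 'rV[R]_2).

(* A point x : 'rV_3 is (s, theta_1, theta_2), with real (unreduced) phases;
   C^2 is identified with R^4. *)
Definition sphere_param x : 'rV[R]_4 :=
  \row_(i < 4) [:: cos (x 0 0) * cos (x 0 1); cos (x 0 0) * sin (x 0 1);
                   sin (x 0 0) * cos (x 0 2); sin (x 0 0) * sin (x 0 2)]`_i.

(* the metric induced on the sphere by the Euclidean metric of R^4; the i-th
   row of the Jacobian is the i-th partial derivative of sphere_param *)
Definition round_metric x : 'M[R]_3 := 'J sphere_param x *m ('J sphere_param x)^T.

Definition rho (s : R) : R := cos s ^+ k1 * sin s ^+ k2.

Definition gbar x : 'M[R]_3 := rho (x 0 0) ^+ 2 *: round_metric x.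

Definition mag gamma : R -> R := coord gamma 0.

(* Only the part of the sphere where z_1 z_2 != 0 is covered, so this is the
   notion of profile for geodesics that avoid both circles z_i = 0; regular
   oscillatory geodesics do.  The equation makes the time parameter affine. *)
Definition profile gamma : Prop :=
  (forall t, 0 < mag gamma t < pi / 2) /\ geodesic gbar gamma.

Definition energy gamma (t : R) : R := 2^-1 * norm2 gbar gamma t.

Definition mu1 gamma (t : R) : R :=
  rho (mag gamma t) ^+ 2 * cos (mag gamma t) ^+ 2 * velocity gamma 1 t.

Definition mu2 gamma (t : R) : R :=
  rho (mag gamma t) ^+ 2 * sin (mag gamma t) ^+ 2 * velocity gamma 2 t.

(* one excursion sm -> sp -> sm of the magnitude, from time t0 to time t2 *)
Definition complete_cell gamma (sm sp t0 t2 : R) : Prop :=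
  exists t1 : R,
    [/\ t0 < t1 < t2,
        [/\ mag gamma t0 = sm, mag gamma t1 = sp & mag gamma t2 = sm],
        {in `[t0, t1] &, {homo mag gamma : t u / t < u}} &
        {in `[t1, t2] &, {homo mag gamma : t u / t < u >-> t > u}}].

(* oscillation between sm and sp: complete cells cover the whole time line *)
Definition oscillates gamma (sm sp : R) : Prop :=
  [/\ 0 < sm, sm < sp, sp < pi / 2 &
      forall t, exists t0 t2, t0 <= t <= t2 /\ complete_cell gamma sm sp t0 t2].

Definition regular_oscillatory gamma : Prop :=
  profile gamma /\ exists sm sp, oscillates gamma sm sp.

Definition doubly_spiral gamma : Prop :=
  forall t, mu1 gamma t * mu2 gamma t != 0.

(* The sign of mu_1 is eps, C 0 0 = C_1 and C 0 1 = C_2; as mu_1, mu_2 and the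
   energy are first integrals, quantifying over t is not a restriction. *)
Definition has_parameters (eps : R) gamma C : Prop :=
  forall t,
    [/\ Num.sg (mu1 gamma t) = eps,
        C 0 0 = mu2 gamma t / mu1 gamma t &
        C 0 1 = 2 * energy gamma t / mu1 gamma t ^+ 2].

Definition doubly_spiral_locus (eps : R) : set 'rV[R]_2 :=
  [set C | exists gamma,
     [/\ regular_oscillatory gamma, doubly_spiral gamma & has_parameters eps gamma C]].

Definition Ppot (C1 s : R) : R :=
  (sin s ^+ 2 + C1 ^+ 2 * cos s ^+ 2) / (rho s ^+ 2 * cos s ^+ 2 * sin s ^+ 2).

Definition Rmin (C1 : R) : R := inf [set Ppot C1 s | s in `]0, pi / 2[].

Definition Uset : set 'rV[R]_2 := [set C | C 0 1 > Rmin (C 0 0)].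

Definition chamber_pos : set 'rV[R]_2 := Uset `&` [set C | 0 < C 0 0].
Definition chamber_neg : set 'rV[R]_2 := Uset `&` [set C | C 0 0 < 0].

(* cell_phase eps C d: d is (Delta theta_1, Delta theta_2) / (2 pi) over some
   complete cell of some profile with parameters C and sign eps *)
Definition cell_phase (eps : R) C (d : 'rV[R]_2) : Prop :=
  exists gamma sm sp t0 t2,
    [/\ profile gamma /\ oscillates gamma sm sp,
        doubly_spiral gamma,
        has_parameters eps gamma C,
        complete_cell gamma sm sp t0 t2 &
        d = \row_(i < 2) [:: (gamma t2 0 1 - gamma t0 0 1) / (2 * pi);
                             (gamma t2 0 2 - gamma t0 0 2) / (2 * pi)]`_i].

(* On the locus exactly one d satisfies cell_phase eps C d; off the locus there
   is none and the value is the dummy 0. *)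
Definition phase_map (eps : R) C : 'rV[R]_2 := xget 0 (cell_phase eps C).

Definition closes_after (eps : R) C (m : nat) : Prop :=
  (0 < m)%N /\ forall i : 'I_2, m%:R * phase_map eps C 0 i \is a Num.int.

Definition primitive_closing_order (eps : R) C (m : nat) : Prop :=
  closes_after eps C m /\ forall m', closes_after eps C m' -> (m <= m')%N.

Definition closed_parameters (eps : R) (M : nat) : set 'rV[R]_2 :=
  [set C | doubly_spiral_locus eps C /\
           exists m, primitive_closing_order eps C m /\ (M < m)%N].

Definition full_rank_locus (eps : R) : set 'rV[R]_2 :=
  [set C | \rank ('J (phase_map eps) C) = 2%N].

End Profiles.

(* Main.v *)
From HB Require Import structures.
Require Import Defs.
From mathcomp Require Import all_boot all_order all_algebra.
From mathcomp Require Import all_classical all_reals all_analysis.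
From mathcomp Require Import ring lra zify.
Import Order.TTheory GRing.Theory Num.Theory.
Import numFieldNormedType.Exports.

(** Let u = sin^2 s, a = k_1 + 1, b = k_2 + 1, x = C_1^2 and y = C_2.  By the
    constancy of the energy and of the momenta, the square of the velocity of u
    along a profile is a positive multiple of
    Q(u) = y (1 - u)^a u^b - u - x (1 - u).
    The magnitude oscillates exactly when Q is positive somewhere in ]0, 1[, which
    is the condition C_2 > R(C_1); since (1 - u)^a u^b / (u + x (1 - u)) is
    unimodal, Q then has two simple roots al < be and is positive between them
    ([root_pair_sign]).  Write Q = (u - al) (be - u) G with G > 0, and
    u = (al + be) / 2 - (be - al) / 2 cos phi.  Time is a smooth function of phi,
    which gives a profile for all parameters of the chambers ([profile_exists]),
    and every profile has the increments
    Delta_1 = eps \int_0^pi dphi / ((1 - u) sqrt G) and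
    Delta_2 = eps C_1 \int_0^pi dphi / (u sqrt G) ([cell_phase_increment]).

    Analyticity.  The roots are simple, so they, G and the integrals depend
    analytically on (C_1, C_2) ([analytic_phase]).  The proof works in the Banach
    algebra of sums of normally convergent series of monomials
    c(phi) h^i k^j ([pser]), which is stable under contractions
    ([pser_fixpoint]), derivatives and integration over phi.

    Full rank.  The Jacobian determinant is analytic, also at C_1 = 0 if b > 1.
    Were it zero on an open set, it would be zero on the axis C_1 = 0 by the
    identity theorem.  By parity it is there, up to sign, the product of
    the derivative of the first integral with respect to C_2 and of the second
    integral, which is positive.  So the first integral would not depend on C_2
    on the axis; but it tends to pi sqrt (2 / a) when C_2 tends to the bottom
    of the well, and to pi / a when C_2 tends to infinity
    ([phase1_shallow_well], [phase1_tall_well]).  If b = 1 then a > 1, and the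
    exchange of the two circles, which sends (C_1, C_2) to
    (1 / C_1, C_2 / C_1^2), leads back to the first case
    ([increment_jacobian_swap]).

    Closed profiles.  At a point of full rank the phase map is locally onto
    ([plane_map_open]), and the points (i / p, j / p) with p a large prime that
    does not divide i are as close as desired to any point of the plane; a
    profile with these phases has closing order p ([fraction_closing_order]). *)

Set Implicit Arguments.
Unset Strict Implicit.
Unset Printing Implicit Defensive.
Local Open Scope classical_set_scope.
Local Open Scope ring_scope.

(** * Normed power series with coefficients depending on a parameter *)

Section Monomials.
Context {R : realType}.

(** The triple (c, i, j) stands for the monomial c(phi) h^i k^j. *)
Definition mono : Type := ((R -> R) * nat * nat)%type.
Implicit Types (m : mono) (F G : R -> R -> R -> R).

Definition meval m (phi h k : R) : R := m.1.1 phi * h ^+ m.1.2 * k ^+ m.2.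
Definition mnorm (r : R) m (phi : R) : R := `|m.1.1 phi| * r ^+ (m.1.2 + m.2).
Definition mmul m m' : mono :=
  (fun phi => m.1.1 phi * m'.1.1 phi, (m.1.2 + m'.1.2)%N, (m.2 + m'.2)%N).

Definition leval L (phi h k : R) : R := \sum_(m <- L) meval m phi h k.
Definition lnorm (r : R) L (phi : R) : R := \sum_(m <- L) mnorm r m phi.
Definition lmul (L K : seq mono) : seq mono := [seq mmul m m' | m <- L, m' <- K].

Fixpoint lcont (L : seq mono) : Prop :=
  if L is m :: L' then continuous m.1.1 /\ lcont L' else True.

Lemma lcont_cat L K : lcont L -> lcont K -> lcont (L ++ K).
Proof. by elim: L => //= m L IH [cm cL] cK; split; [|exact: IH]. Qed.

Lemma lcont_map (f : mono -> mono) L :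
  (forall m, continuous m.1.1 -> continuous (f m).1.1) ->
  lcont L -> lcont (map f L).
Proof. by move=> cf; elim: L => //= m L IH [cm cL]; split; [exact: cf|exact: IH]. Qed.

Lemma lcont_filter (p : pred mono) L : lcont L -> lcont (seq.filter p L).
Proof. by elim: L => //= m L IH [cm cL]; case: ifP => _ /=; [split|]; auto. Qed.

Lemma lcont_flatten (s : nat -> seq mono) n :
  (forall i, lcont (s i)) -> lcont (flatten [seq s i | i <- iota 0 n]).
Proof.
move=> cs; elim: (iota 0 n) => //= i t IH.
by apply: lcont_cat.
Qed.

Lemma lcont_mul L K : lcont L -> lcont K -> lcont (lmul L K).
Proof.
move=> + cK; elim: L => //= m L IH [cm cL].
rewrite /lmul allpairs_cons; apply: lcont_cat; last exact: IH.
elim: K cK {IH} => //= m' K IH [cm' cK]; split; last exact: IH.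
by move=> x; apply: cvgM; [exact: cm|exact: cm'].
Qed.

Lemma leval_cat L K phi h k : leval (L ++ K) phi h k = leval L phi h k + leval K phi h k.
Proof. by rewrite /leval big_cat. Qed.

Lemma lnorm_cat r L K phi : lnorm r (L ++ K) phi = lnorm r L phi + lnorm r K phi.
Proof. by rewrite /lnorm big_cat. Qed.

Lemma leval_mul L K phi h k : leval (lmul L K) phi h k = leval L phi h k * leval K phi h k.
Proof.
rewrite /leval /lmul big_allpairs_dep mulr_suml; apply: eq_bigr => m _.
rewrite mulr_sumr; apply: eq_bigr => m' _.
by rewrite /meval /mmul /= !exprD; ring.
Qed.

Lemma lnorm_mul r L K phi : lnorm r (lmul L K) phi = lnorm r L phi * lnorm r K phi.
Proof.
rewrite /lnorm /lmul big_allpairs_dep mulr_suml; apply: eq_bigr => m _.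
rewrite mulr_sumr; apply: eq_bigr => m' _.
by rewrite /mnorm /mmul /= normrM !exprD; ring.
Qed.

Lemma leval_flatten (s : nat -> seq mono) n phi h k :
  leval (flatten [seq s i | i <- iota 0 n]) phi h k = \sum_(i < n) leval (s i) phi h k.
Proof.
rewrite /leval big_flatten big_map.
by rewrite -(big_mkord xpredT (fun i => \sum_(m <- s i) meval m phi h k)) /index_iota subn0.
Qed.

Lemma lnorm_flatten r (s : nat -> seq mono) n phi :
  lnorm r (flatten [seq s i | i <- iota 0 n]) phi = \sum_(i < n) lnorm r (s i) phi.
Proof.
rewrite /lnorm big_flatten big_map.
by rewrite -(big_mkord xpredT (fun i => \sum_(m <- s i) mnorm r m phi)) /index_iota subn0.
Qed.

Lemma mnorm_ge0 r m phi : 0 <= r -> 0 <= mnorm r m phi.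
Proof. by move=> r0; rewrite mulr_ge0 // exprn_ge0. Qed.

Lemma lnorm_ge0 r L phi : 0 <= r -> 0 <= lnorm r L phi.
Proof. by move=> r0; rewrite sumr_ge0 // => m _; exact: mnorm_ge0. Qed.

Lemma meval_le r m phi h k : `|h| <= r -> `|k| <= r -> `|meval m phi h k| <= mnorm r m phi.
Proof.
move=> hr kr; have r0 : 0 <= r := le_trans (normr_ge0 _) hr.
rewrite /meval /mnorm !normrM -mulrA ler_wpM2l // exprD !normrX.
by apply: ler_pM; rewrite ?exprn_ge0 //; apply: lerXn2r; rewrite ?nnegrE.
Qed.

Lemma leval_le r L phi h k : `|h| <= r -> `|k| <= r -> `|leval L phi h k| <= lnorm r L phi.
Proof.
move=> hr kr; apply: (le_trans (ler_norm_sum _ _ _)); apply: ler_sum => m _.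
exact: meval_le.
Qed.

Lemma lnorm_mono r r' L phi : 0 <= r -> r <= r' -> lnorm r L phi <= lnorm r' L phi.
Proof.
move=> r0 rr'; apply: ler_sum => m _; rewrite /mnorm ler_wpM2l //.
by apply: lerXn2r; rewrite ?nnegrE // (le_trans r0).
Qed.

Lemma continuous_leval L h k : lcont L -> continuous (fun phi => leval L phi h k).
Proof.
rewrite /leval; elim: L => [_|m L IH /= [cm cL]] x.
  by under eq_fun do rewrite big_nil; exact: cvg_cst.
under eq_fun do rewrite big_cons; apply: cvgD; last exact: IH.
by apply: cvgM; [apply: cvgM; [exact: cm|exact: cvg_cst]|exact: cvg_cst].
Qed.

(** A series of finite lists of monomials; s n bounds the norm of the first n
    lists, uniformly in phi.  Grouping the monomials in lists leaves room to
    regroup the terms of products and of series of series. *)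
Definition pseries (r : R) (L : nat -> seq mono) (s : nat -> R) (M : R) : Prop :=
  [/\ forall n, lcont (L n), s 0%N = 0,
      forall n phi, lnorm r (L n) phi <= s n.+1 - s n & forall n, s n <= M].

Definition psum (L : nat -> seq mono) (N : nat) (phi h k : R) : R :=
  \sum_(n < N) leval (L n) phi h k.

(** F is, on the box |h|, |k| <= r, the sum of a series of norm at most M.
    These functions form a Banach algebra stable under all constructions that
    lead to the phase integrals, and phi is kept as a parameter in order to
    integrate over it. *)
Definition pser (r : R) F (M : R) : Prop :=
  exists L s, pseries r L s M /\
    forall phi h k, `|h| <= r -> `|k| <= r -> psum L N phi h k @[N --> \oo] --> F phi h k.

Lemma psumS L N phi h k : psum L N.+1 phi h k = psum L N phi h k + leval (L N) phi h k.
Proof. by rewrite /psum big_ord_recr. Qed.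

Lemma bounded_nd_cauchy (s : nat -> R) (M eps : R) :
  nondecreasing_seq s -> (forall n, s n <= M) -> 0 < eps ->
  exists N0, forall N N', (N0 <= N)%N -> (N <= N')%N -> s N' - s N <= eps.
Proof.
move=> nd sM e0.
have cs : cvgn s by apply: nondecreasing_is_cvgn => //; exists M => _ [n _ <-].
have /cvgrPdist_le /(_ _ e0) [N0 _ H] := cs.
exists N0 => N N' NN NN'.
have := H N NN; have := nondecreasing_cvgn_le nd cs N'.
by move=> + /ler_normlW; lra.
Qed.

Lemma pseries_nd r L s M : 0 <= r -> pseries r L s M -> nondecreasing_seq s.
Proof.
move=> r0 [_ _ Ls _]; apply/nondecreasing_seqP => n.
by rewrite -subr_ge0 (le_trans _ (Ls n 0)) // lnorm_ge0.
Qed.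

Lemma psum_dist r L s M N N' phi h k : 0 <= r -> pseries r L s M ->
  `|h| <= r -> `|k| <= r -> (N <= N')%N ->
  `|psum L N' phi h k - psum L N phi h k| <= s N' - s N.
Proof.
move=> r0 [cL s0 Ls sM] hr kr /subnK <-; elim: (N' - N)%N => [|d IH].
  by rewrite !add0n !subrr normr0.
rewrite addSn psumS addrAC (le_trans (ler_normD _ _)) //.
have := leval_le (L (d + N)%N) phi hr kr; have := Ls (d + N)%N phi.
by move: IH; lra.
Qed.

Lemma pseries_cauchy r L s M (eps : R) : 0 <= r -> pseries r L s M -> 0 < eps ->
  exists N0, forall N N', (N0 <= N)%N -> (N <= N')%N -> s N' - s N <= eps.
Proof. by move=> r0 ps; apply: bounded_nd_cauchy (pseries_nd r0 ps) _; case: ps. Qed.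

Lemma psum_unif r L s M F (eps : R) : 0 <= r -> pseries r L s M ->
  (forall phi h k, `|h| <= r -> `|k| <= r -> psum L N phi h k @[N --> \oo] --> F phi h k) ->
  0 < eps ->
  exists N0, forall N phi h k, (N0 <= N)%N -> `|h| <= r -> `|k| <= r ->
    `|F phi h k - psum L N phi h k| <= eps.
Proof.
move=> r0 ps FL e0; have [N0 HN] := pseries_cauchy r0 ps e0.
exists N0 => N phi h k NN hr kr.
have c1 : psum L N' phi h k - psum L N phi h k @[N' --> \oo] --> F phi h k - psum L N phi h k.
  by apply: cvgB; [exact: FL|exact: cvg_cst].
apply: (cvgr_to_le (cvg_norm c1)).
exists N => // N' /= NN'.
exact: le_trans (psum_dist phi r0 ps hr kr NN') (HN _ _ NN NN').
Qed.

Lemma pseries_psum_le r L s M N phi h k : 0 <= r -> pseries r L s M ->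
  `|h| <= r -> `|k| <= r -> `|psum L N phi h k| <= M.
Proof.
move=> r0 ps hr kr; have := psum_dist phi r0 ps hr kr (leq0n N).
have [_ s0 _ sM] := ps; rewrite /psum big_ord0 subr0 s0 subr0 => /le_trans; apply.
exact: sM.
Qed.

Lemma pser_le r F M phi h k : 0 <= r -> pser r F M ->
  `|h| <= r -> `|k| <= r -> `|F phi h k| <= M.
Proof.
move=> r0 [L [s [ps FL]]] hr kr; apply: (cvgr_to_le (cvg_norm (FL phi h k hr kr))).
by apply: nearW => N; exact: pseries_psum_le ps _ _.
Qed.

Lemma pser_ge0 r F M : pser r F M -> 0 <= M.
Proof. by move=> [L [s [[_ s0 _ sM] _]]]; rewrite -s0. Qed.

Lemma pser_lim r L s M : 0 <= r -> pseries r L s M -> exists F, pser r F M /\ forall phi h k, `|h| <= r -> `|k| <= r -> psum L N phi h k @[N --> \oo] --> F phi h k.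
Proof.
move=> r0 ps; exists (fun phi h k => lim (psum L N phi h k @[N --> \oo])).
suff H : forall phi h k, `|h| <= r -> `|k| <= r ->
    psum L N phi h k @[N --> \oo] --> lim (psum L N phi h k @[N --> \oo]).
  by split => //; exists L, s.
move=> phi h k hr kr; have [_ s0 Ls sM] := ps.
have -> : (fun N => psum L N phi h k) = series (fun n => leval (L n) phi h k).
  by apply/funext => N; rewrite /series /= big_mkord.
apply: normed_cvg; apply: nondecreasing_is_cvgn.
  apply/nondecreasing_seqP => n.
  by rewrite /normed_series_of seriesSr lerDl; exact: normr_ge0.
exists M => _ [N _ <-]; apply: le_trans (sM N).
rewrite /normed_series_of; elim: N => [|N IH]; first by rewrite /series /= big_nil s0.
rewrite seriesSr; have h1 := le_trans (leval_le (L N) phi hr kr) (Ls N phi).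
by apply: le_trans (lerD IH h1) _; rewrite addrC subrK.
Qed.

Lemma pser_eq r F G M : (forall phi h k, `|h| <= r -> `|k| <= r -> F phi h k = G phi h k) ->
  pser r F M -> pser r G M.
Proof.
move=> FG [L [s [ps FL]]]; exists L, s; split => // phi h k hr kr.
by rewrite -FG //; exact: FL.
Qed.

Lemma pser_weak r F M M' : M <= M' -> pser r F M -> pser r F M'.
Proof.
move=> MM [L [s [[cL s0 Ls sM] FL]]]; exists L, s; split => //; split => // n.
exact: le_trans MM.
Qed.

Lemma pser_shrink r r' F M : 0 <= r -> r <= r' -> pser r' F M -> pser r F M.
Proof.
move=> r0 rr [L [s [[cL s0 Ls sM] FL]]]; exists L, s; split; first split => //.
  by move=> n phi; apply: le_trans (Ls n phi); exact: lnorm_mono.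
by move=> phi h k hr kr; apply: FL; exact: le_trans rr.
Qed.

Lemma pser_list r L M : lcont L -> 0 <= M -> (forall phi, lnorm r L phi <= M) ->
  pser r (leval L) M.
Proof.
move=> cL M0 LM; exists (fun n => if n is 0%N then L else [::]).
exists (fun n => if n is 0%N then 0 else M); split; first split => //.
- by case.
- case=> [|n] phi; first by rewrite subr0.
  by rewrite subrr /lnorm big_nil.
- by case.
move=> phi h k hr kr; apply: cvg_near_cst; exists 1%N => // -[//|n] _ /=.
rewrite /psum big_ord_recl /= big1 ?addr0 // => i _.
by rewrite /leval big_nil.
Qed.

Lemma pser_coef r (c : R -> R) M : 0 <= M -> continuous c -> (forall phi, `|c phi| <= M) ->
  pser r (fun phi _ _ => c phi) M.
Proof.
move=> M0 cc cM; apply: (@pser_eq _ (leval [:: (c, 0%N, 0%N)])).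
  by move=> phi h k _ _; rewrite /leval big_seq1 /meval /= !expr0 !mulr1.
apply: pser_list => //= phi.
by rewrite /lnorm big_seq1 /mnorm /= expr0 mulr1.
Qed.

Lemma pser_cst r (c : R) : pser r (fun _ _ _ => c) `|c|.
Proof. by apply: (@pser_coef r (fun=> c)) => // x; exact: cvg_cst. Qed.

Lemma pser_h r : 0 <= r -> pser r (fun _ h _ => h) r.
Proof.
move=> r0; apply: (@pser_eq _ (leval [:: (fun=> 1, 1%N, 0%N)])).
  by move=> phi h k _ _; rewrite /leval big_seq1 /meval /= expr0 mul1r mulr1 expr1.
apply: pser_list => //=; first by split=> // x; exact: cvg_cst.
by move=> phi; rewrite /lnorm big_seq1 /mnorm /= normr1 mul1r expr1.
Qed.

Lemma pser_k r : 0 <= r -> pser r (fun _ _ k => k) r.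
Proof.
move=> r0; apply: (@pser_eq _ (leval [:: (fun=> 1, 0%N, 1%N)])).
  by move=> phi h k _ _; rewrite /leval big_seq1 /meval /= expr0 mul1r expr1 mul1r.
apply: pser_list => //=; first by split=> // x; exact: cvg_cst.
by move=> phi; rewrite /lnorm big_seq1 /mnorm /= normr1 mul1r expr1.
Qed.

Lemma pser_add r F G M N : pser r F M -> pser r G N ->
  pser r (fun phi h k => F phi h k + G phi h k) (M + N).
Proof.
move=> [L [s [[cL s0 Ls sM] FL]]] [K [t [[cK t0 Kt tN] GK]]].
exists (fun n => L n ++ K n), (fun n => s n + t n); split; first split.
- by move=> n; exact: lcont_cat.
- by rewrite s0 t0 addr0.
- by move=> n phi; rewrite lnorm_cat; have := Ls n phi; have := Kt n phi; lra.
- by move=> n; rewrite lerD.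
move=> phi h k hr kr; rewrite (_ : (fun N => _) = fun N => psum L N phi h k + psum K N phi h k).
  by apply: cvgD; [exact: FL|exact: GK].
by apply/funext => n; rewrite /psum -big_split /=; apply: eq_bigr => i _; rewrite leval_cat.
Qed.

(** The n-th list of the product collects the terms of the Cauchy product whose
    larger index is n, so that the bounds of its norm telescope:
    (s' - s) t' + s (t' - t) = s' t' - s t. *)
Lemma pser_mul r F G M N : 0 <= r -> pser r F M -> pser r G N ->
  pser r (fun phi h k => F phi h k * G phi h k) (M * N).
Proof.
move=> r0 [L [s [ps FL]]] [K [t [pt GK]]].
have sn := pseries_nd r0 ps; have tn := pseries_nd r0 pt.
have [cL s0 Ls sM] := ps; have [cK t0 Kt tN] := pt.
have s_ge0 n : 0 <= s n by rewrite -s0; exact: sn.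
have t_ge0 n : 0 <= t n by rewrite -t0; exact: tn.
pose cum (L : nat -> seq mono) n := flatten [seq L i | i <- iota 0 n].
have cumL n phi : lnorm r (cum L n) phi <= s n.
  rewrite lnorm_flatten; elim: n => [|n IH]; first by rewrite big_ord0 s0.
  by rewrite big_ord_recr /=; have := Ls n phi; lra.
have cumK n phi : lnorm r (cum K n) phi <= t n.
  rewrite lnorm_flatten; elim: n => [|n IH]; first by rewrite big_ord0 t0.
  by rewrite big_ord_recr /=; have := Kt n phi; lra.
exists (fun n => lmul (L n) (cum K n.+1) ++ lmul (cum L n) (K n)).
exists (fun n => s n * t n); split; first split.
- by move=> n; apply: lcont_cat; apply: lcont_mul => //; exact: lcont_flatten.
- by rewrite s0 mul0r.
- move=> n phi; rewrite lnorm_cat !lnorm_mul.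
  have h1 : lnorm r (L n) phi * lnorm r (cum K n.+1) phi <= (s n.+1 - s n) * t n.+1.
    by apply: ler_pM; rewrite ?lnorm_ge0.
  have h2 : lnorm r (cum L n) phi * lnorm r (K n) phi <= s n * (t n.+1 - t n).
    by apply: ler_pM; rewrite ?lnorm_ge0.
  by move: h1 h2; lra.
- by move=> n; apply: ler_pM.
move=> phi h k hr kr; rewrite (_ : (fun N => _) = fun N => psum L N phi h k * psum K N phi h k).
  by apply: cvgM; [exact: FL|exact: GK].
apply/funext => n; elim: n => [|n IH]; first by rewrite /psum !big_ord0 mul0r.
rewrite psumS IH leval_cat !leval_mul !leval_flatten -!/(psum _ _ _ _ _) !psumS.
by ring.
Qed.

Lemma pser_scale r F M (c : R) : 0 <= r -> pser r F M ->
  pser r (fun phi h k => c * F phi h k) (`|c| * M).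
Proof. by move=> r0 pF; apply: pser_mul => //; exact: pser_cst. Qed.

Lemma pser_sub r F G M N : 0 <= r -> pser r F M -> pser r G N ->
  pser r (fun phi h k => F phi h k - G phi h k) (M + N).
Proof.
move=> r0 pF pG; have := pser_add pF (pser_scale (-1) r0 pG).
rewrite normrN1 mul1r; apply: pser_eq => phi h k _ _; by rewrite mulN1r.
Qed.

End Monomials.

(** * Sums of series and the contraction principle *)

Section Limits.
Context {R : realType}.
Implicit Types (F G : R -> R -> R -> R).

Lemma cvgn_ext (f g : nat -> R) (l : R) : f =1 g -> f n @[n --> \oo] --> l -> g n @[n --> \oo] --> l.
Proof. by move=> /funext ->. Qed.

(** The N-th list of the sum collects the N-th lists of the first N series and
    the first N + 1 lists of the N-th one: the squares of side N exhaust the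
    terms. *)
Lemma pser_series r (Fs : nat -> R -> R -> R -> R) (Ms : nat -> R) M : 0 <= r ->
  (forall n, pser r (Fs n) (Ms n)) -> (forall N, \sum_(n < N) Ms n <= M) ->
  exists F : R -> R -> R -> R, pser r F M /\ forall phi h k, `|h| <= r -> `|k| <= r ->
    \sum_(n < N) Fs n phi h k @[N --> \oo] --> F phi h k.
Proof.
move=> r0 pF MM.
have : forall n, exists p : (nat -> seq (@mono R)) * (nat -> R), pseries r p.1 p.2 (Ms n) /\
    forall phi h k, `|h| <= r -> `|k| <= r -> psum p.1 N phi h k @[N --> \oo] --> Fs n phi h k.
  by move=> n; have [L [s H]] := pF n; exists (L, s).
move=> /choice [Q HQ].
pose L n := (Q n).1; pose s n := (Q n).2.
have ps n : pseries r (L n) (s n) (Ms n) by exact: (HQ n).1.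
have sL n : forall phi h k, `|h| <= r -> `|k| <= r ->
  psum (L n) N phi h k @[N --> \oo] --> Fs n phi h k by exact: (HQ n).2.
have M0 n : 0 <= Ms n by exact: pser_ge0 (pF n).
pose D N := flatten [seq L N n | n <- iota 0 N.+1] ++ flatten [seq L k N | k <- iota 0 N].
pose S N := \sum_(k < N) s k N.
have psD : pseries r D S M.
  split.
  - by move=> n; apply: lcont_cat; apply: lcont_flatten => i; case: (ps n) (ps i) => [? _ _ _] [? _ _ _].
  - by rewrite /S big_ord0.
  - move=> N phi; rewrite lnorm_cat !lnorm_flatten /S [X in _ <= X - _]big_ord_recr /=.
    have h1 : \sum_(i < N.+1) lnorm r (L N i) phi <= s N N.+1.
      elim: N.+1 => [|n IH]; first by rewrite big_ord0; case: (ps N) => _ ->.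
      by rewrite big_ord_recr /=; have [_ _ /(_ n phi)] := ps N; move: IH; lra.
    have h2 : \sum_(i < N) lnorm r (L i N) phi <= \sum_(i < N) (s i N.+1 - s i N).
      by apply: ler_sum => i _; case: (ps i) => _ _ + _; exact.
    by move: h2; rewrite sumrB; lra.
  - move=> N; apply: le_trans (MM N); apply: ler_sum => i _.
    by case: (ps i) => _ _ _; exact.
have [F [pFF FD]] := pser_lim r0 psD.
exists F; split => // phi h k hr kr.
have DE N : psum D N phi h k = \sum_(n < N) psum (L n) N phi h k.
  elim: N => [|N IH]; first by rewrite /psum !big_ord0.
  rewrite psumS IH leval_cat !leval_flatten -/(psum (L N) N.+1 phi h k).
  rewrite [RHS]big_ord_recr /= addrCA addrC; congr (_ + _).
  by rewrite -big_split /=; apply: eq_bigr => i _; rewrite psumS.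
suff H : (\sum_(n < N) Fs n phi h k - psum D N phi h k) @[N --> \oo] --> (0 : R).
  have H' := cvgD (FF := eventually_filter) H (FD phi h k hr kr); rewrite add0r in H'; apply: (cvgn_ext _ H').
  by move=> N; exact: subrK.
apply/cvgrPdist_le => e e0.
have e3 : 0 < e / 3 by lra.
have [|K HK] := @bounded_nd_cauchy R (fun N => \sum_(n < N) Ms n) M _ _ MM e3.
  by apply/nondecreasing_seqP => n; rewrite big_ord_recr lerDl.
have cK : \sum_(n < K) (Fs n phi h k - psum (L n) N phi h k) @[N --> \oo] --> (0 : R).
  elim: {HK} K => [|n IH].
    by under eq_fun do rewrite big_ord0; exact: cvg_cst.
  have cF : Fs n phi h k - psum (L n) N phi h k @[N --> \oo] --> (0 : R).
    rewrite -(subrr (Fs n phi h k)).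
    by apply: cvgB; [exact: cvg_cst|exact: sL].
  have H' := cvgD (FF := eventually_filter) IH cF; rewrite addr0 in H'.
  by apply: (cvgn_ext _ H') => N; rewrite big_ord_recr.
move/cvgrPdist_le : cK => /(_ _ e3) [K' _ HK'].
exists (maxn K K') => // N /=; rewrite geq_max => /andP[KN K'N].
rewrite DE -sumrB sub0r normrN.
have -> : \sum_(i < N) (Fs i phi h k - psum (L i) N phi h k) =
  \sum_(i < K) (Fs i phi h k - psum (L i) N phi h k) +
  \sum_(K <= i < N) (Fs i phi h k - psum (L i) N phi h k).
  by rewrite -!(big_mkord xpredT (fun i => Fs i phi h k - psum (L i) N phi h k)) -big_cat_nat.
apply: (le_trans (ler_normD _ _)).
have := HK' N K'N; rewrite sub0r normrN => h1.
have h2 : `|\sum_(K <= i < N) (Fs i phi h k - psum (L i) N phi h k)| <= \sum_(K <= i < N) (Ms i + Ms i).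
  apply: (le_trans (ler_norm_sum _ _ _)); apply: ler_sum => i _.
  apply: (le_trans (ler_normB _ _)); apply: lerD.
    exact: pser_le (pF i) _ _.
  exact: pseries_psum_le (ps i) _ _.
have h3 : \sum_(K <= i < N) Ms i <= e / 3.
  have := HK K N (leqnn _) KN.
  by rewrite -!(big_mkord xpredT Ms) (big_cat_nat (n := K) (leq0n K) KN) /=; lra.
rewrite [X in _ <= X]big_split /= in h2.
by apply: (le_trans (lerD h1 (le_trans h2 (lerD h3 h3)))); lra.
Qed.

(** Banach's fixed point principle in the algebra of convergent series: the
    n-th increment of the iteration from 0 has norm at most d / 2^(n+1). *)
Lemma pser_fixpoint r (d : R) (T : (R -> R -> R -> R) -> (R -> R -> R -> R)) :
  0 <= r -> 0 <= d -> pser r (T (fun _ _ _ => 0)) (d / 2) ->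
  (forall v w m, pser r v d -> pser r w d ->
    pser r (fun phi h k => v phi h k - w phi h k) m ->
    pser r (fun phi h k => T v phi h k - T w phi h k) (m / 2)) ->
  exists v, pser r v d /\ forall phi h k, `|h| <= r -> `|k| <= r -> T v phi h k = v phi h k.
Proof.
move=> r0 d0 T0 TL.
pose x n := iter n T (fun _ _ _ => 0).
pose e n phi h k := x n.+1 phi h k - x n phi h k.
have xe n phi h k : \sum_(i < n) e i phi h k = x n phi h k.
  elim: n => [|n IH]; first by rewrite big_ord0.
  by rewrite big_ord_recr /= IH /e addrC subrK.
have geo n N : \sum_(i < N) d / 2 ^+ (n + i).+1 = d / 2 ^+ n - d / 2 ^+ (n + N).
  elim: N => [|N IH]; first by rewrite big_ord0 addn0 subrr.
  rewrite big_ord_recr /= IH addnS exprS.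
  have : (2 : R) ^+ (n + N) != 0 by rewrite expf_neq0.
  by move=> h; rewrite invfM; lra.
have dp n : 0 <= d / 2 ^+ n by rewrite divr_ge0 // exprn_ge0.
have pe : forall n, pser r (x n) (d - d / 2 ^+ n) /\ pser r (e n) (d / 2 ^+ n.+1).
  elim=> [|n [pxn pen]].
    split; first by rewrite expr0 divr1 subrr -(@normr0 _ R); exact: pser_cst.
    by rewrite /e /= expr1; apply: pser_eq T0 => phi h k _ _; rewrite subr0.
  have pxn1 : pser r (x n.+1) (d - d / 2 ^+ n.+1).
    have -> : d - d / 2 ^+ n.+1 = (d - d / 2 ^+ n) + d / 2 ^+ n.+1.
      by rewrite exprS invfM; lra.
    by apply: pser_eq (pser_add pxn pen) => phi h k _ _; rewrite /e addrC subrK.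
  split => //.
  have -> : d / 2 ^+ n.+2 = (d / 2 ^+ n.+1) / 2 by rewrite exprS invfM; lra.
  apply: TL => //; [apply: pser_weak pxn1|apply: pser_weak pxn].
    by have := dp n.+1; lra.
  by have := dp n; lra.
have [|v [pv xv]] := @pser_series r e (fun n => d / 2 ^+ n.+1) d r0 (fun n => (pe n).2).
  by move=> N; have := geo 0%N N; rewrite expr0 => ->; have := dp N; rewrite add0n; lra.
exists v; split => // phi h k hr kr.
have vn n : pser r (fun phi h k => v phi h k - x n phi h k) (d / 2 ^+ n).
  have [|w [pw xw]] := @pser_series r (fun i => e (n + i)%N) (fun i => d / 2 ^+ (n + i).+1)
     (d / 2 ^+ n) r0 (fun i => (pe (n + i)%N).2).
    by move=> N; rewrite geo; have := dp (n + N)%N; lra.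
  apply: pser_eq pw => phi' h' k' hr' kr'.
  have c1 := xw phi' h' k' hr' kr'.
  have c2 : \sum_(i < N) e (n + i)%N phi' h' k' @[N --> \oo] --> v phi' h' k' - x n phi' h' k'.
    have -> : (fun N => \sum_(i < N) e (n + i)%N phi' h' k') =
              (fun N => \sum_(i < N + n) e i phi' h' k' - x n phi' h' k').
      apply/funext => N; rewrite xe.
      elim: N => [|N IH]; first by rewrite big_ord0 add0n subrr.
      by rewrite big_ord_recr /= IH /e (addnC n) -[T _]/(x (N + n).+1); ring.
    apply: (cvgB (FF := eventually_filter)); last exact: cvg_cst.
    have H := xv phi' h' k' hr' kr'.
    by rewrite -(cvg_shiftn n) in H.
  exact: (cvg_unique _ c1 c2).
have x0 : d / 2 ^+ n @[n --> \oo] --> (0 : R).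
  have := @cvg_geometric R d 2^-1; rewrite ger0_norm ?invr_ge0 // invf_lt1 ?ltr1n //.
  move=> /(_ isT) H; apply: (cvgn_ext _ H) => n.
  by rewrite /geometric /= exprVn.
apply/eqP; rewrite -subr_eq0 -normr_le0; apply/ler_addgt0Pl => eps e0; rewrite addr0.
move/cvgrPdist_le : x0 => /(_ _ e0) [n _ /(_ n (leqnn n))].
rewrite sub0r normrN ger0_norm // => hn.
have h1 := pser_le phi r0 (vn n.+1) hr kr.
have h2 : pser r (fun phi h k => T v phi h k - T (x n) phi h k) (d / 2 ^+ n / 2).
  apply: TL pv _ (vn n); apply: pser_weak (pe n).1; have := dp n; lra.
have h3 := pser_le phi r0 h2 hr kr.
have -> : T v phi h k - v phi h k = (T v phi h k - T (x n) phi h k) - (v phi h k - x n.+1 phi h k).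
  by rewrite /x /=; ring.
apply: (le_trans (ler_normB _ _)).
move: h1; rewrite exprS invfM; move: h3 hn; lra.
Qed.
End Limits.

(** * Differentiation and division of series *)

Section Transformations.
Context {R : realType}.
Implicit Types (F G : R -> R -> R -> R).

Lemma lnorm_map_le r r' (f : @mono R -> @mono R) (c : R) L phi :
  (forall m, mnorm r' (f m) phi <= c * mnorm r m phi) ->
  lnorm r' (map f L) phi <= c * lnorm r L phi.
Proof.
move=> H; rewrite /lnorm big_map mulr_sumr; apply: ler_sum => m _; exact: H.
Qed.

(** On the box scaled by th every monomial of positive degree loses a factor th
    in norm, and the constant terms cancel. *)
Lemma pser_small r F M (th : R) : 0 <= r -> 0 <= th <= 1 -> pser r F M ->
  pser (th * r) (fun phi h k => F phi h k - F phi 0 0) (th * M).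
Proof.
move=> r0 /andP[t0 t1] [L [s [[cL s0 Ls sM] FL]]].
pose p (m : @mono R) := (0 < m.1.2 + m.2)%N.
exists (fun n => seq.filter p (L n)), (fun n => th * s n); split; first split.
- by move=> n; exact: lcont_filter.
- by rewrite s0 mulr0.
- move=> n phi; rewrite -mulrBr; apply: le_trans (ler_wpM2l t0 (Ls n phi)).
  rewrite /lnorm; elim: (L n) => [|m l IH] /=; first by rewrite !big_nil mulr0.
  rewrite [X in _ <= _ * X]big_cons mulrDr; case: ifP => [pm|_].
    rewrite big_cons lerD // /mnorm exprMn mulrCA ler_wpM2r ?mulr_ge0 ?exprn_ge0 //.
    by rewrite -{2}(expr1 th); apply: ler_wiXn2l.
  by rewrite -[X in X <= _]add0r lerD // mulr_ge0 // mnorm_ge0.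
- by move=> n; rewrite ler_wpM2l.
move=> phi h k hr kr.
have hr' : `|h| <= r by apply: le_trans hr _; rewrite -{2}(mul1r r) ler_wpM2r.
have kr' : `|k| <= r by apply: le_trans kr _; rewrite -{2}(mul1r r) ler_wpM2r.
have r00 : `|0 : R| <= r by rewrite normr0.
have H := cvgB (FF := eventually_filter) (FL phi h k hr' kr') (FL phi 0 0 r00 r00).
apply: (cvgn_ext _ H) => N; rewrite /psum -[LHS]sumrB; apply: eq_bigr => i _.
rewrite /leval; elim: (L i) => [|m l IH] /=; first by rewrite !big_nil subrr.
rewrite !(big_cons _ _ m); case: ifPn => [pm|].
  rewrite big_cons -IH.
  have -> : meval m phi 0 0 = 0.
    by rewrite /meval -mulrA -exprD expr0n eqn0Ngt [(0 < _)%N]pm mulr0.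
  by ring.
rewrite -leqNgt leqn0 addn_eq0 => /andP[/eqP i0 /eqP j0].
by rewrite -IH /meval i0 j0 !expr0; ring.
Qed.

Lemma pser_swap r F M : pser r F M -> pser r (fun phi h k => F phi k h) M.
Proof.
move=> [L [s [[cL s0 Ls sM] FL]]].
pose f (m : @mono R) : @mono R := (m.1.1, m.2, m.1.2).
exists (fun n => map f (L n)), s; split; first split => //.
- by move=> n; apply: lcont_map.
- move=> n phi; apply: le_trans (Ls n phi); rewrite -[X in _ <= X]mul1r.
  by apply: lnorm_map_le => m; rewrite mul1r /mnorm /= addnC.
move=> phi h k hr kr; apply: (cvgn_ext _ (FL phi k h kr hr)) => N.
rewrite /psum; apply: eq_bigr => i _; rewrite /leval big_map; apply: eq_bigr => m _.
by rewrite /meval /=; ring.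
Qed.

(** Halving the radius gains a factor 2^i, which pays for the factor i. *)
Lemma expr_deriv_bound (x q : R) (i : nat) : 0 < q -> 0 <= x -> x <= q ->
  i%:R * x ^+ i.-1 <= (2 * q) ^+ i / q.
Proof.
move=> q0 x0 xq; elim: i => [|[|i] IH].
- by rewrite mul0r expr0 divr_ge0 // ltW.
- by rewrite /= expr1 expr0 mulr1 mulfK ?gt_eqF // ler1n.
have h1 : x ^+ i.+1 <= (2 * q) ^+ i.+1.
  by apply: lerXn2r; rewrite ?nnegrE //; nra.
have e : (2 * q) ^+ i.+2 / q = 2 * (2 * q) ^+ i.+1.
  by rewrite exprS; field; rewrite gt_eqF.
rewrite e /= -addn1 natrD mulrDl mul1r.
have h2 : i.+1%:R * x ^+ i.+1 <= (2 * q) ^+ i.+1.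
  rewrite exprS mulrCA; apply: le_trans (ler_wpM2l x0 IH) _.
  rewrite mulrCA; apply: (@le_trans _ _ ((2 * q) ^+ i.+1 * 1)); last by rewrite mulr1.
  apply: ler_wpM2l; first by rewrite exprn_ge0 // mulr_ge0 // ltW.
  by rewrite ler_pdivrMr // mul1r.
by lra.
Qed.

Lemma expr_taylor_bound (h t q : R) (i : nat) : 0 < q -> `|h| <= q -> `|h + t| <= q ->
  `|(h + t) ^+ i - h ^+ i - t * (i%:R * h ^+ i.-1)| <= t ^+ 2 * ((2 * q) ^+ i / q ^+ 2).
Proof.
move=> q0 hq tq; have qn0 : q != 0 by rewrite gt_eqF.
have q2 : 0 < q ^+ 2 by rewrite exprn_gt0.
elim: i => [|i IH].
  rewrite !expr0 subrr mul0r mulr0 subr0 normr0 mulr_ge0 ?sqr_ge0 //.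
  by rewrite divr_ge0 // ltW.
have -> : (h + t) ^+ i.+1 - h ^+ i.+1 - t * (i.+1%:R * h ^+ i.+1.-1) =
  (h + t) * ((h + t) ^+ i - h ^+ i - t * (i%:R * h ^+ i.-1)) + t ^+ 2 * (i%:R * h ^+ i.-1).
  case: i {IH} => [|i]; first by rewrite !expr0 !expr1 /=; ring.
  by rewrite /= -(natr1 i.+1) !exprS; ring.
apply: le_trans (ler_normD _ _) _.
have e1 : t ^+ 2 * ((2 * q) ^+ i.+1 / q ^+ 2) = q * (t ^+ 2 * ((2 * q) ^+ i / q ^+ 2)) + t ^+ 2 * ((2 * q) ^+ i / q).
  by rewrite (exprS (2 * q)); move: ((2 * q) ^+ i) => z; field.
rewrite e1; apply: lerD; first by rewrite normrM; apply: ler_pM.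
rewrite normrM ger0_norm ?sqr_ge0 // ler_wpM2l ?sqr_ge0 // normrM normr_nat normrX.
exact: expr_deriv_bound.
Qed.

(** Termwise differentiation, at the cost of half of the radius; the quadratic
    remainder identifies the sum as the partial derivative. *)
Lemma pser_dh r F M : 0 < r -> pser (2 * r) F M ->
  exists F' : R -> R -> R -> R, pser r F' (M / r) /\ forall phi h t k,
    `|h| <= r -> `|h + t| <= r -> `|k| <= r ->
    `|F phi (h + t) k - F phi h k - t * F' phi h k| <= M / r ^+ 2 * t ^+ 2.
Proof.
move=> r0 [L [s [ps FL]]]; have [cL s0 Ls sM] := ps.
have r2 : 0 <= 2 * r by rewrite mulr_ge0 // ltW.
pose f (m : @mono R) : @mono R := (fun phi => m.1.2%:R * m.1.1 phi, m.1.2.-1, m.2).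
have ps' : pseries r (fun n => map f (L n)) (fun n => s n / r) (M / r).
  split.
  - move=> n; apply: lcont_map => // m cm /= x; apply: cvgM; [exact: cvg_cst|exact: cm].
  - by rewrite s0 mul0r.
  - move=> n phi; rewrite -mulrBl mulrC.
    apply: le_trans (ler_wpM2l _ (Ls n phi)); last by rewrite invr_ge0 ltW.
    apply: lnorm_map_le => m; rewrite /mnorm /= normrM normr_nat.
    rewrite [X in X <= _]mulrAC mulrC [X in _ <= X]mulrCA ler_wpM2l //.
    rewrite !exprD mulrA [X in _ <= X]mulrA (mulrC r^-1); apply: ler_pM; rewrite ?mulr_ge0 ?exprn_ge0 ?(ltW r0) //.
      by apply: expr_deriv_bound => //; exact: ltW.
    by apply: lerXn2r; rewrite ?nnegrE ?(ltW r0) //; lra.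
  - by move=> n; rewrite ler_wpM2r // invr_ge0 ltW.
have [F' [pF' F'L]] := pser_lim (ltW r0) ps'.
exists F'; split => // phi h t k hr tr kr.
have rr x : `|x| <= r -> `|x| <= 2 * r by move=> /le_trans; apply; lra.
have cc : psum L N phi (h + t) k - psum L N phi h k - t * psum (fun n => map f (L n)) N phi h k @[N --> \oo]
   --> F phi (h + t) k - F phi h k - t * F' phi h k.
  apply: (cvgB (FF := eventually_filter)).
    by apply: (cvgB (FF := eventually_filter)); apply: FL; exact: rr.
  by apply: (cvgM (FF := eventually_filter)); [exact: cvg_cst|exact: F'L].
apply: (cvgr_to_le (cvg_norm cc)); apply: nearW => N /=.
have H : `|psum L N phi (h + t) k - psum L N phi h k - t * psum (fun n => map f (L n)) N phi h k|
   <= s N / r ^+ 2 * t ^+ 2.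
  elim: N => [|N IH].
    by rewrite /psum !big_ord0 subrr mulr0 subr0 normr0 s0 mul0r mul0r.
  have h1 : `|leval (L N) phi (h + t) k - leval (L N) phi h k - t * leval (map f (L N)) phi h k|
     <= (s N.+1 - s N) / r ^+ 2 * t ^+ 2.
    apply: (@le_trans _ _ (lnorm (2 * r) (L N) phi / r ^+ 2 * t ^+ 2)); last first.
      rewrite ler_wpM2r ?sqr_ge0 // ler_wpM2r // invr_ge0 sqr_ge0 //.
    rewrite /leval big_map mulr_sumr -!sumrB /lnorm mulr_suml mulr_suml.
    apply: le_trans (ler_norm_sum _ _ _) _; apply: ler_sum => m _.
    rewrite /meval /mnorm /=.
    have -> : m.1.1 phi * (h + t) ^+ m.1.2 * k ^+ m.2 - m.1.1 phi * h ^+ m.1.2 * k ^+ m.2 -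
      t * (m.1.2%:R * m.1.1 phi * h ^+ m.1.2.-1 * k ^+ m.2) = m.1.1 phi *
      ((((h + t) ^+ m.1.2 - h ^+ m.1.2 - t * (m.1.2%:R * h ^+ m.1.2.-1))) * k ^+ m.2) by ring.
    have tb := expr_taylor_bound m.1.2 r0 hr tr.
    have kb : `|k ^+ m.2| <= (2 * r) ^+ m.2.
      by rewrite normrX; apply: lerXn2r; rewrite ?nnegrE //; exact: rr.
    rewrite normrM -!mulrA ler_wpM2l // normrM.
    apply: (le_trans (ler_pM (normr_ge0 _) (normr_ge0 _) tb kb)).
    rewrite exprD le_eqVlt; apply/orP; left; apply/eqP.
    by move: ((2 * r) ^+ m.1.2) ((2 * r) ^+ m.2) ((r ^+ 2)^-1) => z1 z2 z3; ring.
  rewrite !psumS.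
  have -> : forall a b c d e g : R, a + b - (c + d) - t * (e + g) = (a - c - t * e) + (b - d - t * g).
    by move=> *; ring.
  apply: le_trans (ler_normD _ _) _; apply: le_trans (lerD IH h1) _.
  by rewrite -mulrDl -mulrDl addrC subrK.
apply: le_trans H _; rewrite ler_wpM2r ?sqr_ge0 // ler_wpM2r // invr_ge0 sqr_ge0 //.
Qed.

(** Dividing a monomial by k divides its norm by r exactly.  Iterating this is
    what forces a function with accumulating zeros to vanish. *)
Lemma pser_factor r F M : 0 < r -> pser r F M -> (forall phi, F phi 0 0 = 0) ->
  exists F1 : R -> R -> R -> R, pser r F1 (M / r) /\ forall phi k, `|k| <= r -> F phi 0 k = k * F1 phi 0 k.
Proof.
move=> r0 [L [s [ps FL]]] F0; have [cL s0 Ls sM] := ps.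
pose f (m : @mono R) : @mono R := (m.1.1, m.1.2, m.2.-1).
pose p (m : @mono R) := (m.1.2 == 0%N) && (0 < m.2)%N.
have ps' : pseries r (fun n => map f (seq.filter p (L n))) (fun n => s n / r) (M / r).
  split.
  - by move=> n; apply: lcont_map => //; exact: lcont_filter.
  - by rewrite s0 mul0r.
  - move=> n phi; rewrite -mulrBl mulrC.
    apply: le_trans (ler_wpM2l _ (Ls n phi)); last by rewrite invr_ge0 ltW.
    rewrite /lnorm; elim: (L n) => [|m l IH] /=; first by rewrite !big_nil mulr0.
    rewrite [X in _ <= _ * X]big_cons mulrDr; case: ifP => [/andP[/eqP m0 mp]|_].
      rewrite /= big_cons lerD // /mnorm m0 /= !add0n mulrCA ler_wpM2l //.
      by rewrite m0 add0n; case: m.2 mp => // j _ /=; rewrite exprS mulKf ?gt_eqF.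
    by rewrite -[X in X <= _]add0r lerD // mulr_ge0 ?invr_ge0 ?mnorm_ge0 // ltW.
  - by move=> n; rewrite ler_wpM2r // invr_ge0 ltW.
have [F1 [pF1 F1L]] := pser_lim (ltW r0) ps'.
exists F1; split => // phi k kr.
have r00 : `|0 : R| <= r by rewrite normr0 ltW.
have c1 : psum L N phi 0 k - psum L N phi 0 0 @[N --> \oo] --> F phi 0 k - F phi 0 0.
  by apply: (cvgB (FF := eventually_filter)); exact: FL.
rewrite F0 subr0 in c1.
have c2 : k * psum (fun n => map f (seq.filter p (L n))) N phi 0 k @[N --> \oo] --> k * F1 phi 0 k.
  by apply: (cvgM (FF := eventually_filter)); [exact: cvg_cst|exact: F1L].
suff c3 : psum L N phi 0 k - psum L N phi 0 0 @[N --> \oo] --> k * F1 phi 0 k.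
  exact: (cvg_unique _ c1 c3).
apply: (cvgn_ext _ c2) => N; symmetry.
rewrite /psum -sumrB mulr_sumr; apply: eq_bigr => i _.
rewrite /leval big_map; elim: (L i) => [|m l IH] /=; first by rewrite !big_nil subrr mulr0.
rewrite !(big_cons _ _ m) -[RHS]/(k * _); case: ifPn => [/andP[/eqP m0 mp]|].
  rewrite big_cons mulrDr -IH /meval /= m0 expr0.
  case: m.2 mp => // j _ /=; rewrite [0 ^+ j.+1]expr0n /= exprS; ring.
rewrite negb_and -leqNgt leqn0 => mp; rewrite -IH.
suff -> : meval m phi 0 k = meval m phi 0 0 by ring.
rewrite /meval; case/orP: mp => [m0|/eqP ->]; last by rewrite !expr0.
by rewrite expr0n (negbTE m0) mulr0 !mul0r.
Qed.

End Transformations.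

(** * Derivatives and primitives in one variable *)

Section Calculus.
Context {R : realType}.
Implicit Types (f g H : R -> R).

Definition dv f (x l : R) : Prop := is_derive x (1 : R) f l.

Lemma dv_eq f (x l l' : R) : dv f x l -> l = l' -> dv f x l'.
Proof. by move=> ? <-. Qed.

Lemma dv_unique f (x l l' : R) : dv f x l -> dv f x l' -> l = l'.
Proof. by move=> [_ <-] [_ <-]. Qed.

Lemma dv_cst (c x : R) : dv (fun=> c) x 0.
Proof. exact: is_derive_cst. Qed.

Lemma dv_id (x : R) : dv (fun y => y) x 1.
Proof. exact: is_derive_id. Qed.

Lemma dvD f g (x a b : R) : dv f x a -> dv g x b -> dv (fun y => f y + g y) x (a + b).
Proof. exact: is_deriveD. Qed.

Lemma dvN f (x a : R) : dv f x a -> dv (fun y => - f y) x (- a).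
Proof. exact: is_deriveN. Qed.

Lemma dvB f g (x a b : R) : dv f x a -> dv g x b -> dv (fun y => f y - g y) x (a - b).
Proof. exact: is_deriveB. Qed.

Lemma dvM f g (x a b : R) : dv f x a -> dv g x b -> dv (fun y => f y * g y) x (a * g x + f x * b).
Proof.
move=> df dg; apply: dv_eq (is_deriveM df dg) _.
by rewrite /GRing.scale /= addrC mulrC.
Qed.

Lemma dvZ (c : R) f (x a : R) : dv f x a -> dv (fun y => c * f y) x (c * a).
Proof. by move=> df; apply: dv_eq (dvM (dv_cst c x) df) _; rewrite mul0r add0r. Qed.

Lemma dvX f n (x a : R) : dv f x a -> dv (fun y => f y ^+ n) x (n%:R * f x ^+ n.-1 * a).
Proof. by move=> df; have := is_deriveX n df; rewrite exprfctE. Qed.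

Lemma dvV f (x a : R) : f x != 0 -> dv f x a -> dv (fun y => (f y)^-1) x (- a / f x ^+ 2).
Proof.
move=> f0 df; apply: dv_eq (is_deriveV f0 df) _.
by rewrite /GRing.scale /= !mulNr mulrC.
Qed.

Lemma dv_comp f g (x a b : R) : dv f (g x) a -> dv g x b -> dv (fun y => f (g y)) x (a * b).
Proof. exact: is_derive1_comp. Qed.

Lemma dv_sin (x : R) : dv (@sin R) x (cos x).
Proof. exact: is_derive_sin. Qed.

Lemma dv_cos (x : R) : dv (@cos R) x (- sin x).
Proof. exact: is_derive_cos. Qed.

Lemma dv_sqrt (x : R) : 0 < x -> dv (@Num.sqrt R) x (2 * Num.sqrt x)^-1.
Proof. exact: is_derive1_sqrt. Qed.

Lemma dv_continuous f (x l : R) : dv f x l -> {for x, continuous f}.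
Proof. by move=> [df _]; apply: differentiable_continuous; apply/derivable1_diffP. Qed.

Lemma dv_near f g (x l : R) : (\near x, f x = g x) -> dv f x l -> dv g x l.
Proof. exact: near_eq_is_derive. Qed.

Lemma cst_of_derive0 f (a b x y : R) : (forall z, a < z < b -> dv f z 0) ->
  a < x < b -> a < y < b -> f x = f y.
Proof.
move=> df; wlog xy : x y / x <= y.
  by move=> W hx hy; case: (leP x y) => [/W|/ltW /W h]; [exact|rewrite h].
move=> /andP[ax xb] /andP[ay yb].
have [||c _] := @MVT_segment _ f (fun=> 0) x y xy.
- by move=> z; rewrite in_itv /= => /andP[xz zy]; apply: df; lra.
- apply: derivable_within_continuous => z; rewrite in_itv /= => /andP[xz zy].
  by have [] : dv f z 0 by apply: df; lra.
by rewrite mul0r => /eqP; rewrite subr_eq0 => /eqP ->.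
Qed.

(** By the fundamental theorem of calculus the integral from - n is a primitive
    on ]- n, n[; normalized to vanish at 0 these primitives agree with one
    another. *)
Lemma primitive_exists f : continuous f ->
  exists H : R -> R, H 0 = 0 /\ forall x, dv H x (f x).
Proof.
move=> cf.
pose F (n : nat) (x : R) : R := (\int[lebesgue_measure]_(t in `[- n.+1%:R : R, x]) (f t))%R.
have dF n x : - n.+1%:R < x < n.+1%:R -> dv (F n) x (f x).
  move=> /andP[nx xn].
  have [||||d1 d2] := @continuous_FTC1_closed R f (- n.+1%:R) x n.+1%:R.
  - exact: xn.
  - apply: continuous_compact_integrable; first exact: segment_compact.
    exact: continuous_subspaceT.
  - exact: nx.
  - exact: cf.
  by split; [exact: d1|rewrite -derive1E; exact: d2].
pose tr (x : R) := Num.truncn `|x|.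
exists (fun x => F (tr x) x - F (tr x) 0); split; first by rewrite subrr.
move=> x; set n := (tr x).+1.
have xn : - n%:R < x < n%:R by rewrite -ltr_norml; exact: truncnS_gt.
have E y : - n%:R < y < n%:R -> F (tr y) y - F (tr y) 0 = F n y - F n 0.
  move=> yn; have yt : - (tr y).+1%:R < y < (tr y).+1%:R by rewrite -ltr_norml; exact: truncnS_gt.
  have tn : (tr y).+1%:R <= n%:R :> R.
    rewrite ler_nat /tr -ltnS; move: yn; rewrite -ltr_norml => yn.
    by rewrite ltnS; apply: contraTT yn; rewrite -ltnNge -leNgt => h; apply: (@le_trans _ _ (tr y)%:R);
      [rewrite ler_nat|rewrite truncn_le].
  have t0 : 0 < (tr y).+1%:R :> R by [].
  have nS : n%:R < n.+1%:R :> R by rewrite ltr_nat.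
  have := @cst_of_derive0 (fun z => F (tr y) z - F n z) (- (tr y).+1%:R) (tr y).+1%:R y 0 _ yt.
  have h0 : - (tr y).+1%:R < (0 : R) < (tr y).+1%:R by lra.
  move=> H; have {}H := fun h => H h h0; suff : F (tr y) y - F n y = F (tr y) 0 - F n 0 by lra.
  apply: H => z hz; rewrite -(subrr (f z)); apply: dvB; apply: dF => //.
  by lra.
have nS : n%:R < n.+1%:R :> R by rewrite ltr_nat.
apply: (@dv_near (fun y => F n y - F n 0)).
  have nb : \forall y \near x, y \in `](- n%:R), n%:R[ by apply: near_in_itvoo; rewrite in_itv.
  by apply: filterS nb => y; rewrite in_itv => /E ->.
rewrite -(subr0 (f x)); apply: dvB; last exact: dv_cst.
by apply: dF; lra.
Qed.

Definition prim f : R -> R :=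
  xget (fun=> 0) [set H | H 0 = 0 /\ forall x, dv H x (f x)].

Lemma prim_spec f : continuous f -> prim f 0 = 0 /\ forall x, dv (prim f) x (f x).
Proof. by move=> /primitive_exists [H HP]; rewrite /prim; case: xgetP => [? _ //|/(_ H)]. Qed.

Lemma prim0 f : continuous f -> prim f 0 = 0.
Proof. by move=> /prim_spec []. Qed.

Lemma dv_prim f x : continuous f -> dv (prim f) x (f x).
Proof. by move=> /prim_spec []. Qed.

Lemma primE f H x : continuous f -> (forall x, dv H x (f x)) ->
  prim f x = H x - H 0.
Proof.
move=> cf dH; have [p0 dp] := prim_spec cf.
have := @is_derive_0_is_cst R (fun y => prim f y - H y) x 0; rewrite p0 sub0r.
suff h : forall z, dv (fun y => prim f y - H y) z 0 by move=> /(_ h); lra.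
by move=> z; rewrite -(subrr (f z)); apply: dvB.
Qed.

Lemma primD f g x : continuous f -> continuous g ->
  prim (fun y => f y + g y) x = prim f x + prim g x.
Proof.
move=> cf cg; rewrite (@primE _ (fun y => prim f y + prim g y)).
- by rewrite !prim0 // addr0 subr0.
- by move=> y; apply: cvgD; [exact: cf|exact: cg].
- by move=> y; apply: dvD; exact: dv_prim.
Qed.

Lemma primZ (c : R) f x : continuous f -> prim (fun y => c * f y) x = c * prim f x.
Proof.
move=> cf; rewrite (@primE _ (fun y => c * prim f y)).
- by rewrite prim0 // mulr0 subr0.
- by move=> y; apply: cvgM; [exact: cvg_cst|exact: cf].
- by move=> y; apply: dvZ; exact: dv_prim.
Qed.

Lemma prim_le f g x : continuous f -> continuous g -> 0 <= x ->
  (forall y, 0 < y < x -> f y <= g y) -> prim f x <= prim g x.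
Proof.
move=> cf cg x0 fg.
have d z : dv (fun y => prim g y - prim f y) z (g z - f z).
  by apply: dvB; exact: dv_prim.
move: x0; rewrite le_eqVlt => /predU1P[<-|x0]; first by rewrite !prim0.
have [||c] := @MVT _ (fun y => prim g y - prim f y) (fun y => g y - f y) 0 x x0.
- by move=> z _; exact: d.
- by apply: derivable_within_continuous => z _; have [] := d z.
rewrite in_itv /= !prim0 // => hc E.
by have := fg c hc; have /andP[_ _] := hc; nra.
Qed.

Lemma prim_bound f x (B : R) : continuous f -> 0 <= x -> (forall y, `|f y| <= B) -> `|prim f x| <= x * B.
Proof.
move=> cf x0 fB; have cB (b : R) : continuous (fun _ : R => b) by move=> y; exact: cvg_cst.
have pc (b : R) : prim (fun=> b) x = x * b.
  rewrite (@primE _ (fun y => y * b)) ?mul0r ?subr0 // => y.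
  by apply: dv_eq (dvM (dv_id y) (dv_cst b y)) _; rewrite mul1r mulr0 addr0.
rewrite ler_norml; apply/andP; split.
  rewrite -mulrN -pc; apply: prim_le => // y _; have := fB y; rewrite ler_norml => /andP[] //.
by rewrite -pc; apply: prim_le => // y _; have := fB y; rewrite ler_norml => /andP[].
Qed.

End Calculus.

(** * Integration of series and expansion into double series *)

Section Integration.
Context {R : realType}.
Implicit Types (F G : R -> R -> R -> R).

Lemma continuous_psum r L s M N h k : pseries r L s M -> continuous (fun phi : R => psum L N phi h k).
Proof.
case=> cL _ _ _; elim: N => [|N IH] x.
  by under eq_fun do rewrite /psum big_ord0; exact: cvg_cst.
under eq_fun do rewrite psumS.
by apply: cvgD; [exact: IH|exact: continuous_leval].
Qed.

Lemma pser_continuous r F M h k : 0 <= r -> pser r F M -> `|h| <= r -> `|k| <= r ->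
  continuous (fun phi => F phi h k).
Proof.
move=> r0 [L [s [ps FL]]] hr kr p; apply/cvgrPdist_le => e e0.
have e3 : 0 < e / 3 by lra.
have [N0 H] := psum_unif r0 ps FL e3.
have cN := continuous_psum (N := N0) (h := h) (k := k) ps.
have /cvgrPdist_le /(_ _ e3) := cN p.
apply: filterS => t ht; have h1 := H N0 p h k (leqnn _) hr kr.
have h2 := H N0 t h k (leqnn _) hr kr.
have -> : F p h k - F t h k = (F p h k - psum L N0 p h k) + (psum L N0 p h k - psum L N0 t h k)
  - (F t h k - psum L N0 t h k) by ring.
apply: le_trans (ler_normB _ _) _; apply: le_trans (lerD (ler_normD _ _) (lexx _)) _.
by apply: le_trans (lerD (lerD h1 ht) h2) _; lra.
Qed.

Lemma continuous_scale (c : R -> R) (b : R) : continuous c -> continuous (fun p => b * c p).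
Proof. by move=> cc x; apply: cvgM; [exact: cvg_cst|exact: cc]. Qed.

(** Integration over phi acts on the coefficients.  The norm of the integrated
    list is again an integral, of the coefficients combined with constant signs,
    and is therefore dominated by x times the norm of the list. *)
Lemma pser_prim r F M (x : R) : 0 <= r -> 0 <= x -> pser r F M ->
  pser r (fun _ h k => prim (fun phi => F phi h k) x) (x * M).
Proof.
move=> r0 x0 pF; have [L [s [ps FL]]] := pF; have [cL s0 Ls sM] := ps.
pose f (m : @mono R) : @mono R := (fun=> prim m.1.1 x, m.1.2, m.2).
have evf l h k p : lcont l -> leval (map f l) p h k = prim (fun phi => leval l phi h k) x.
  elim: l => [_|m l IH /= [cm cl]].
    rewrite /leval !big_nil; under eq_fun do rewrite big_nil.
    by rewrite (@primE _ _ (fun=> 0)) ?subrr // => y; [exact: cvg_cst|exact: dv_cst].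
  rewrite /leval big_cons -/(leval _ _ _ _) IH //.
  under [in RHS]eq_fun do rewrite big_cons.
  rewrite primD; last exact: continuous_leval.
    congr (_ + _); rewrite /meval /=.
    have -> : (fun y => m.1.1 y * h ^+ m.1.2 * k ^+ m.2) = (fun y => (h ^+ m.1.2 * k ^+ m.2) * m.1.1 y).
      by apply/funext => y; ring.
    by rewrite primZ //; ring.
  have -> : (fun y => meval m y h k) = (fun y => (h ^+ m.1.2 * k ^+ m.2) * m.1.1 y).
    by apply/funext => y; rewrite /meval; ring.
  exact: continuous_scale.
have nf l : lcont l -> exists g : R -> R, [/\ continuous g, forall p, `|g p| <= lnorm r l p &
    forall p, lnorm r (map f l) p = prim g x].
  elim: l => [_|m l IH /= [cm cl]].
    exists (fun=> 0); split => [y|p|p]; first exact: cvg_cst.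
      by rewrite normr0 /lnorm big_nil.
    by rewrite /lnorm big_nil (@primE _ _ (fun=> 0)) ?subrr // => y; [exact: cvg_cst|exact: dv_cst].
  have [g [cg gl gE]] := IH cl.
  pose c := Num.sg (prim m.1.1 x) * r ^+ (m.1.2 + m.2).
  have cc := @continuous_scale _ c cm.
  exists (fun y => c * m.1.1 y + g y); split.
  - by move=> y; apply: cvgD; [exact: cc|exact: cg].
  - move=> p; rewrite /lnorm big_cons; apply: le_trans (ler_normD _ _) _.
    apply: lerD; last exact: gl.
    rewrite /mnorm /c !normrM [X in _ <= X]mulrC (ger0_norm (exprn_ge0 _ r0)) ler_wpM2r //.
    rewrite -[X in _ <= X]mul1r ler_wpM2r ?exprn_ge0 // normr_sg.
    by case: (_ != 0).
  - move=> p; rewrite primD // primZ // -(gE p) /lnorm /= big_cons; congr (_ + _).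
    by rewrite /mnorm /= /c mulrAC -normrEsg.
exists (fun n => map f (L n)), (fun n => x * s n); split; first split.
- by move=> n; elim: (L n) => //= m l IH; split => // y; exact: cvg_cst.
- by rewrite s0 mulr0.
- move=> n p; have [g [cg gl ->]] := nf _ (cL n).
  rewrite -mulrBr; apply: le_trans (ler_norm _) _; apply: prim_bound => // y.
  exact: le_trans (gl y) (Ls n y).
- by move=> n; rewrite ler_wpM2l.
move=> p h k hr kr.
have cF := pser_continuous r0 pF hr kr.
have E N : psum (fun n => map f (L n)) N p h k = prim (fun phi => psum L N phi h k) x.
  elim: N => [|N IH].
    rewrite /psum big_ord0; under eq_fun do rewrite big_ord0.
    by rewrite (@primE _ _ (fun=> 0)) ?subrr // => y; [exact: cvg_cst|exact: dv_cst].
  rewrite psumS IH evf //; under [in RHS]eq_fun do rewrite psumS.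
  rewrite primD //; [exact: continuous_psum ps|exact: continuous_leval].
apply/cvgrPdist_le => e e0.
have e1 : 0 < e / (x + 1) by rewrite divr_gt0 //; lra.
have [N0 H] := psum_unif r0 ps FL e1.
exists N0 => // N /= NN; rewrite E.
have -> : prim (F^~ h ^~ k) x - prim (fun phi => psum L N phi h k) x =
   prim (fun phi => F phi h k + -1 * psum L N phi h k) x.
  have cp := continuous_psum (N := N) (h := h) (k := k) ps.
  by rewrite (primD _ cF (continuous_scale (b := -1) cp)) (primZ _ _ cp) mulN1r.
apply: le_trans (prim_bound (B := e / (x + 1)) _ x0 _) _.
- move=> y; apply: cvgD; first exact: cF.
  by have cp := continuous_scale (b := -1) (continuous_psum (N := N) (h := h) (k := k) ps); exact: cp.
- by move=> y; rewrite mulN1r; exact: H.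
rewrite mulrCA -[X in _ <= X]mulr1 ler_wpM2l ?(ltW e0) // ler_pdivrMr; lra.
Qed.

End Integration.

Section AnalyticAt.
Context {R : realType}.
Implicit Types (F : R -> R -> R -> R).

Definition lcoef (L : seq (@mono R)) (i j : nat) : R :=
  \sum_(m <- L | (m.1.2 == i) && (m.2 == j)) m.1.1 0.

Lemma box_leval (L : seq (@mono R)) N h k : 
  \sum_(i < N) \sum_(j < N) lcoef L i j * h ^+ i * k ^+ j =
  \sum_(m <- L | (m.1.2 < N)%N && (m.2 < N)%N) meval m 0 h k.
Proof.
elim: L => [|m L IH].
  rewrite big_nil big1 // => i _; rewrite big1 // => j _.
  by rewrite /lcoef big_nil !mul0r.
rewrite big_cons -IH.
have E i j : lcoef (m :: L) i j = (if (m.1.2 == i) && (m.2 == j) then m.1.1 0 else 0) + lcoef L i j.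
  by rewrite /lcoef big_cons; case: ifP => // _; rewrite add0r.
under eq_bigr do under eq_bigr do rewrite E mulrDl mulrDl.
under eq_bigr do rewrite big_split /=.
rewrite big_split /=.
case: ifPn => [/andP[iN jN]|]; last first.
  rewrite negb_and => H; rewrite big1 ?add0r // => i _; rewrite big1 // => j _.
  case: ifP => [/andP[/eqP mi /eqP mj]|_]; last by rewrite !mul0r.
  by move: H; rewrite mi mj !ltn_ord.
congr (_ + _); rewrite (bigD1 (Ordinal iN)) //= (bigD1 (Ordinal jN)) //= !eqxx /=.
rewrite big1 ?addr0; last first.
  move=> j; rewrite -val_eqE /= eq_sym => /negbTE ->; by rewrite ?andbF !mul0r.
rewrite big1 ?addr0 // => i; rewrite -val_eqE /= eq_sym => /negbTE ->.
by rewrite big1 // => j _; rewrite !mul0r.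
Qed.

Lemma box_lnorm r (L : seq (@mono R)) N : 0 <= r ->
  \sum_(i < N) \sum_(j < N) `|lcoef L i j| * r ^+ (i + j) <= lnorm r L 0.
Proof.
move=> r0.
elim: L => [|m L IH].
  rewrite /lnorm big_nil big1 // => i _; rewrite big1 // => j _.
  by rewrite /lcoef big_nil normr0 !mul0r.
have E i j : lcoef (m :: L) i j = (if (m.1.2 == i) && (m.2 == j) then m.1.1 0 else 0) + lcoef L i j.
  by rewrite /lcoef big_cons; case: ifP => // _; rewrite add0r.
rewrite /lnorm big_cons -/(lnorm r L 0).
apply: (@le_trans _ _ (\sum_(i < N) \sum_(j < N)
   ((if (m.1.2 == i :> nat) && (m.2 == j :> nat) then mnorm r m 0 else 0) + `|lcoef L i j| * r ^+ (i + j)))).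
  apply: ler_sum => i _; apply: ler_sum => j _; rewrite E.
  apply: (@le_trans _ _ ((`|if (m.1.2 == i :> nat) && (m.2 == j :> nat) then m.1.1 0 else 0| + `|lcoef L i j|) * r ^+ (i + j))).
    by rewrite ler_wpM2r ?exprn_ge0 // ler_normD.
  rewrite mulrDl lerD2r; case: ifP => [/andP[/eqP <- /eqP <-]//|_].
  by rewrite normr0 mul0r.
under eq_bigr do rewrite big_split /=.
rewrite big_split /=; apply: lerD => //.
have [/andP[iN jN]|] := boolP ((m.1.2 < N)%N && (m.2 < N)%N); last first.
  rewrite negb_and => H; rewrite big1 ?mnorm_ge0 // => i _; rewrite big1 // => j _.
  case: ifP => [/andP[/eqP mi /eqP mj]|//].
  by move: H; rewrite mi mj !ltn_ord.
rewrite (bigD1 (Ordinal iN)) //= (bigD1 (Ordinal jN)) //= !eqxx /=.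
rewrite big1 ?addr0; last first.
  by move=> j; rewrite -val_eqE /= eq_sym => /negbTE ->; rewrite ?andbF.
rewrite big1 ?addr0 // => i; rewrite -val_eqE /= eq_sym => /negbTE ->.
by rewrite big1.
Qed.

Lemma cvgn_sum (I : Type) (l : seq I) (u : nat -> I -> R) (v : I -> R) :
  (forall i, u n i @[n --> \oo] --> v i) ->
  \sum_(i <- l) u n i @[n --> \oo] --> \sum_(i <- l) v i.
Proof.
move=> uv; elim: l => [|i l IH].
  by rewrite big_nil; under eq_fun do rewrite big_nil; exact: cvg_cst.
rewrite big_cons; under eq_fun do rewrite big_cons.
by apply: (cvgD (FF := eventually_filter)); [exact: uv|exact: IH].
Qed.

Lemma ler_sum_uniq_subset (T : eqType) (f : T -> R) (s t : seq T) :
  (forall x, 0 <= f x) -> uniq s -> {subset s <= t} -> \sum_(x <- s) f x <= \sum_(x <- t) f x.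
Proof.
move=> f0; elim: s t => [|x s IH] t; first by rewrite big_nil sumr_ge0.
move=> /= /andP[xs us] st; have xt : x \in t by apply: st; rewrite inE eqxx.
rewrite big_cons (big_rem x xt) lerD2l; apply: IH => // y ys.
have yx : y != x by apply: contra xs => /eqP <-.
have yt : y \in t by apply: st; rewrite inE ys orbT.
by have := perm_mem (perm_to_rem xt) y; rewrite yt inE (negbTE yx) /= => <-.
Qed.

(** At phi = 0 the monomials with equal exponents are collected: this does not
    increase norms, so the collected coefficients converge, and their box sums
    differ little from a partial sum of the original series. *)
Lemma pser_double_series r F M : 0 < r -> pser r F M ->
  exists c : nat -> nat -> R, forall h k, `|h| <= r -> `|k| <= r ->
    double_series_sum c h k (F 0 h k).
Proof.
move=> r0 [L [s [ps FL]]]; have rge := ltW r0; have [cL s0 Ls sM] := ps.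
pose A N i j := \sum_(n < N) lcoef (L n) i j.
have AS N i j : A N.+1 i j = A N i j + lcoef (L N) i j by rewrite /A big_ord_recr.
(* the partial sums of the coefficients are Cauchy, uniformly over boxes *)
have boxA K N N' : (N <= N')%N ->
    \sum_(i < K) \sum_(j < K) `|A N' i j - A N i j| * r ^+ (i + j) <= s N' - s N.
  move=> /subnK <-; elim: (N' - N)%N => [|d IH].
    rewrite add0n subrr big1 // => i _; rewrite big1 // => j _; by rewrite subrr normr0 mul0r.
  rewrite addSn; have h1 := le_trans (box_lnorm (L (d + N)%N) K rge) (Ls (d + N)%N 0).
  have -> : s (d + N).+1 - s N = (s (d + N)%N - s N) + (s (d + N).+1 - s (d + N)%N) by ring.
  apply: le_trans (lerD IH h1).
  rewrite -big_split /=; apply: ler_sum => i _; rewrite -big_split /=; apply: ler_sum => j _.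
  by rewrite -mulrDl ler_wpM2r ?exprn_ge0 // AS addrAC ler_normD.
have cA i j : cvgn (fun N => A N i j).
  have E : (fun N => A N i j) = series (fun n => lcoef (L n) i j).
    by apply/funext => N; rewrite /A /series /= big_mkord.
  rewrite E; apply: normed_cvg; apply: nondecreasing_is_cvgn.
    apply/nondecreasing_seqP => n.
    by rewrite /normed_series_of seriesSr lerDl; exact: normr_ge0.
  have rn : 0 < r ^+ (i + j) by rewrite exprn_gt0.
  exists (M / r ^+ (i + j)) => _ [N _ <-]; rewrite ler_pdivlMr //.
  apply: le_trans (sM N); rewrite /normed_series_of.
  elim: N => [|N IH]; first by rewrite /series /= big_nil mul0r s0.
  rewrite seriesSr mulrDl.
  have h1 := le_trans (box_lnorm (L N) (maxn i j).+1 rge) (Ls N 0).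
  have h2 : `|lcoef (L N) i j| * r ^+ (i + j) <= s N.+1 - s N.
    apply: le_trans h1.
    have iK : (i < (maxn i j).+1)%N by rewrite ltnS leq_maxl.
    have jK : (j < (maxn i j).+1)%N by rewrite ltnS leq_maxr.
    rewrite (bigD1 (Ordinal iK)) //= (bigD1 (Ordinal jK)) //= -addrA lerDl.
    apply: addr_ge0; first by apply: sumr_ge0 => k _; rewrite mulr_ge0 ?exprn_ge0.
    by apply: sumr_ge0 => k _; apply: sumr_ge0 => l _; rewrite mulr_ge0 ?exprn_ge0.
  by apply: le_trans (lerD IH h2) _; rewrite addrC subrK.
pose c i j := lim ((fun N => A N i j) @ \oo).
have boxc K N : forall e, (forall N', (N <= N')%N -> s N' - s N <= e) ->
    \sum_(i < K) \sum_(j < K) `|c i j - A N i j| * r ^+ (i + j) <= e.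
  move=> e He.
  have cc : \sum_(i < K) \sum_(j < K) `|A N' i j - A N i j| * r ^+ (i + j) @[N' --> \oo] -->
     \sum_(i < K) \sum_(j < K) `|c i j - A N i j| * r ^+ (i + j).
    apply: cvgn_sum => i; apply: cvgn_sum => j.
    apply: (cvgM (FF := eventually_filter)); last exact: cvg_cst.
    apply: cvg_norm; apply: (cvgB (FF := eventually_filter)); last exact: cvg_cst.
    exact: cA.
  apply: (cvgr_to_le cc); exists N => // N' /= NN'.
  exact: le_trans (boxA K N N' NN') (He N' NN').
exists c => h k hr kr.
have term_le (x : R) (i j : nat) : `|x * h ^+ i * k ^+ j| <= `|x| * r ^+ (i + j).
  rewrite !normrM -mulrA ler_wpM2l // !normrX exprD.
  by apply: ler_pM; rewrite ?exprn_ge0 //; apply: lerXn2r; rewrite ?nnegrE.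
split.
  have boxM K : \sum_(i < K) \sum_(j < K) `|c i j| * r ^+ (i + j) <= M.
    have := @boxc K 0%N M; rewrite s0.
    have -> : \sum_(i < K) \sum_(j < K) `|c i j - A 0%N i j| * r ^+ (i + j) =
      \sum_(i < K) \sum_(j < K) `|c i j| * r ^+ (i + j).
      by apply: eq_bigr => i _; apply: eq_bigr => j _; rewrite /A big_ord0 subr0.
    by apply => N' _; rewrite subr0.
  rewrite /summable; apply: (@le_lt_trans _ _ (M%:E)%E); last exact: ltry.
  apply: ub_ereal_sup => _ [X [finX _] <-].
  rewrite fsbig_finite //= sumEFin lee_fin.
  set l : seq (nat * nat) := (X in \sum_(x <- X) _).
  pose K : nat := (\max_(x <- l) (maxn x.1 x.2).+1)%N.
  pose t := [seq (i, j) | i <- iota 0 K, j <- iota 0 K].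
  apply: le_trans (boxM K).
  have -> : \sum_(i < K) \sum_(j < K) `|c i j| * r ^+ (i + j) = \sum_(x <- t) `|c x.1 x.2| * r ^+ (x.1 + x.2).
    rewrite /t big_allpairs; have -> : iota 0 K = index_iota 0 K by rewrite /index_iota subn0.
    by rewrite big_mkord; apply: eq_bigr => i _; rewrite big_mkord.
  apply: (@le_trans _ _ (\sum_(x <- l) `|c x.1 x.2| * r ^+ (x.1 + x.2))).
    by apply: ler_sum => x _; exact: term_le.
  apply: ler_sum_uniq_subset; first by move=> x; rewrite mulr_ge0 ?exprn_ge0.
    by rewrite /l finmap.fset_uniq.
  move=> [i j] xl; apply/allpairsP; exists (i, j); rewrite !mem_iota /= !add0n.
  have := @leq_bigmax_seq _ l xpredT (fun x : nat * nat => (maxn x.1 x.2).+1) (i, j) xl isT.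
  rewrite -/K /=.
  by move=> H; split => //; apply: leq_trans H; rewrite ltnS ?leq_maxl ?leq_maxr.
apply/cvgrPdist_le => e e0.
have e2 : 0 < e / 2 by lra.
have [N1 H1] := psum_unif rge ps FL e2.
have [N2 H2] := pseries_cauchy rge ps e2.
pose N := maxn N1 N2.
pose dg (l : seq (@mono R)) := (\max_(m <- l) (maxn m.1.2 m.2).+1)%N.
pose K0 := (\max_(n < N) dg (L n))%N.
exists K0 => // K /= K0K.
have EA : psum L N 0 h k = \sum_(i < K) \sum_(j < K) A N i j * h ^+ i * k ^+ j.
  have -> : \sum_(i < K) \sum_(j < K) A N i j * h ^+ i * k ^+ j =
     \sum_(n < N) \sum_(i < K) \sum_(j < K) lcoef (L n) i j * h ^+ i * k ^+ j.
    rewrite [RHS]exchange_big /=; apply: eq_bigr => i _.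
    rewrite exchange_big /=; apply: eq_bigr => j _.
    by rewrite /A !mulr_suml.
  apply: eq_bigr => n _; rewrite box_leval /leval.
  have : (dg (L n) <= K)%N by apply: leq_trans K0K; exact: (leq_bigmax_cond (F := fun n : 'I_N => dg (L n))).
  rewrite /dg; elim: (L n) => [|m l IH]; first by rewrite !big_nil.
  by rewrite !big_cons geq_max gtn_max => /andP[/andP[-> ->] /IH ->].
have -> : F 0 h k - \sum_(i < K) \sum_(j < K) c i j * h ^+ i * k ^+ j =
   (F 0 h k - psum L N 0 h k) - \sum_(i < K) \sum_(j < K) (c i j - A N i j) * h ^+ i * k ^+ j.
  rewrite EA.
  have -> : \sum_(i < K) \sum_(j < K) (c i j - A N i j) * h ^+ i * k ^+ j =
    \sum_(i < K) \sum_(j < K) c i j * h ^+ i * k ^+ j - \sum_(i < K) \sum_(j < K) A N i j * h ^+ i * k ^+ j.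
    rewrite -sumrB; apply: eq_bigr => i _; rewrite -sumrB; apply: eq_bigr => j _; ring.
  by ring.
apply: le_trans (ler_normB _ _) _.
have h1 := H1 N 0 h k (leq_maxl _ _) hr kr.
have h2 := @boxc K N (e / 2) (fun N' => H2 N N' (leq_maxr _ _)).
have h3 : `|\sum_(i < K) \sum_(j < K) (c i j - A N i j) * h ^+ i * k ^+ j| <= e / 2.
  apply: le_trans h2; apply: le_trans (ler_norm_sum _ _ _) _; apply: ler_sum => i _.
  by apply: le_trans (ler_norm_sum _ _ _) _; apply: ler_sum => j _; exact: term_le.
by apply: le_trans (lerD h1 h3) _; lra.
Qed.

End AnalyticAt.

(** * The polynomial of the turning points *)

Section DividedDifferences.
Context {R : realType}.
Implicit Types (s : seq R).

(** Divided differences of the polynomial with the given coefficients, as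
    polynomials in their arguments: they make sense on the diagonal as well. *)
Fixpoint dd1 s (u v : R) : R :=
  if s is _ :: s' then horner_rec s' u + v * dd1 s' u v else 0.

Fixpoint dd2 s (u v w : R) : R :=
  if s is _ :: s' then dd1 s' u v + w * dd2 s' u v w else 0.

Lemma dd1E s (u v : R) : (u - v) * dd1 s u v = horner_rec s u - horner_rec s v.
Proof.
elim: s => [|c s IH] /=; first by rewrite mulr0 subrr.
rewrite mulrDr mulrCA IH; ring.
Qed.

Lemma dd2E s (u v w : R) : (v - w) * dd2 s u v w = dd1 s u v - dd1 s u w.
Proof.
elim: s => [|c s IH] /=; first by rewrite mulr0 subrr.
rewrite mulrDr mulrCA IH; ring.
Qed.

Lemma dv_horner_rec s (u : R) : dv (horner_rec s) u (dd1 s u u).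
Proof.
elim: s => [|c s IH]; first exact: dv_cst.
by apply: dv_eq (dvD (dvM IH (dv_id u)) (dv_cst c u)) _ => /=; ring.
Qed.

Lemma dv_dd1 s (u v : R) : exists l, dv (dd1 s u) v l.
Proof.
elim: s => [|c s [l IH]]; first by exists 0; exact: dv_cst.
by eexists; apply: dvD (dv_cst _ v) (dvM (dv_id v) IH).
Qed.

Lemma dv_dd2 s (u v w : R) : exists l, dv (fun v => dd2 s u v w) v l.
Proof.
elim: s => [|c s [l IH]]; first by exists 0; exact: dv_cst.
have [l' d'] := dv_dd1 s u v.
by eexists; apply: dvD d' (dvZ w IH).
Qed.

End DividedDifferences.

Section Roots.
Context {R : realType}.
Variables (a b : nat).
Implicit Types (x y u : R).

Definition wseq : seq R := (1 - 'X) ^+ a * 'X ^+ b.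
Definition wgt u : R := (1 - u) ^+ a * u ^+ b.
Definition ell x u : R := u + x * (1 - u).
(** With x = C_1^2, y = C_2 and u = sin^2 s, the square of the velocity of u
    along a profile is a positive multiple of Q. *)
Definition Qpol x y u : R := y * wgt u - ell x u.

Lemma wseqE u : horner_rec wseq u = wgt u.
Proof. by rewrite -[LHS]/(_.[u]) !hornerE. Qed.

Definition dwgt u : R := (1 - u) ^+ a.-1 * u ^+ b.-1 * (b%:R - (a + b)%:R * u).

Hypotheses (a0 : (0 < a)%N) (b0 : (0 < b)%N).

Lemma dv_wgt u : dv wgt u (dwgt u).
Proof.
apply: dv_eq (dvM (dvX a (dvB (dv_cst 1 u) (dv_id u))) (dvX b (dv_id u))) _.
by rewrite /dwgt; case: a a0 => // a' _; case: b b0 => // b' _ /=; rewrite natrD !exprS; ring.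
Qed.

Lemma dv_ell x u : dv (ell x) u (1 - x).
Proof.
by apply: dv_eq (dvD (dv_id u) (dvZ x (dvB (dv_cst 1 u) (dv_id u)))) _; ring.
Qed.

Lemma dv_Qpol x y u : dv (Qpol x y) u (y * dwgt u - (1 - x)).
Proof. by apply: dvB; [apply: dvZ; exact: dv_wgt|exact: dv_ell]. Qed.

Lemma wgt_gt0 u : 0 < u < 1 -> 0 < wgt u.
Proof. by move=> /andP[u0 u1]; rewrite mulr_gt0 ?exprn_gt0 // subr_gt0. Qed.

Lemma ell_gt0 x u : 0 <= x -> 0 < u < 1 -> 0 < ell x u.
Proof. by move=> x0 /andP[u0 u1]; rewrite ltr_wpDr // mulr_ge0 //; lra. Qed.

(** The condition under which wgt / ell vanishes at u = 0, so that the well is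
    closed on the left. *)
Definition admissible x : Prop := 0 < x \/ x = 0 /\ (1 < b)%N.

Lemma admissible_ge0 x : admissible x -> 0 <= x.
Proof. by case=> [/ltW//|[-> _]]. Qed.

(** The derivative of wgt / ell is a positive multiple of this polynomial. *)
Definition Npol x u : R := (b%:R - (a + b)%:R * u) * ell x u - (1 - x) * u * (1 - u).

Lemma dv_ratio x u : 0 <= x -> 0 < u < 1 ->
  dv (fun u => wgt u / ell x u) u ((1 - u) ^+ a.-1 * u ^+ b.-1 / ell x u ^+ 2 * Npol x u).
Proof.
move=> x0 hu; have l0 := ell_gt0 x0 hu; have ln : ell x u != 0 by rewrite gt_eqF.
apply: dv_eq (dvM (dv_wgt u) (dvV ln (dv_ell x u))) _.
rewrite /Npol /dwgt /wgt; case: a a0 => // a' _; case: b b0 => // b' _ /=.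
rewrite (exprS (1 - u)) (exprS u); field; exact: ln.
Qed.

(** For x > 0 this is a quadratic polynomial, positive at 0 and negative at 1;
    for x = 0 it factors. *)
Lemma Npol_sign x : admissible x -> exists us, 0 < us < 1 /\ forall u, 0 < u < 1 ->
  (u < us -> 0 < Npol x u) /\ (us < u -> Npol x u < 0).
Proof.
have aR : 1 <= a%:R :> R by rewrite ler1n.
have bR : 1 <= b%:R :> R by rewrite ler1n.
case=> [x0|[-> b1]].
  have N1 : Npol x 1 = - a%:R by rewrite /Npol /ell natrD; ring.
  have N0 : Npol x 0 = b%:R * x by rewrite /Npol /ell; ring.
  have cN : {within `[0, 1], continuous (Npol x)}.
    apply: derivable_within_continuous => u _.
    suff [l [dl _]] : exists l, dv (Npol x) u l by [].
    eexists; apply: dvB (dvM (dvB (dv_cst _ u) (dvZ _ (dv_id u))) (dv_ell x u)) _.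
    exact: dvM (dvZ _ (dv_id u)) (dvB (dv_cst 1 u) (dv_id u)).
  have [|us] := @IVT R (Npol x) 0 1 0 ler01 cN.
    rewrite N0 N1 ge_min le_max; apply/andP; split; apply/orP.
      by right; lra.
    by left; rewrite mulr_ge0 // ltW.
  rewrite in_itv /= => /andP[us0 us1] Nus.
  have us0' : 0 < us.
    rewrite lt_neqAle us0 andbT; apply/eqP => E; move: Nus; rewrite -E N0; nra.
  have us1' : us < 1.
    rewrite lt_neqAle us1 andbT; apply/eqP => E; move: Nus; rewrite E N1; lra.
  exists us; split; first by rewrite us0' us1'.
  pose A : R := - (a + b)%:R * (1 - x) + (1 - x).
  pose B : R := b%:R * (1 - x) - (a + b)%:R * x - (1 - x).
  have NE u : Npol x u = (u - us) * (A * (u + us) + B).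
    rewrite -[LHS]subr0 -Nus /Npol /ell /A /B; ring.
  have L0 : A * us + B < 0.
    have : 0 < Npol x 0 by rewrite N0; nra.
    by rewrite NE; nra.
  have L1 : A * (1 + us) + B < 0.
    have : Npol x 1 < 0 by rewrite N1; lra.
    by rewrite NE; nra.
  move=> u /andP[u0 u1]; rewrite NE.
  have L : A * (u + us) + B < 0.
    have -> : A * (u + us) + B = (1 - u) * (A * us + B) + u * (A * (1 + us) + B) by ring.
    by nra.
  by split => h; nra.
have NE u : Npol 0 u = u * ((b%:R - 1) - (a%:R + b%:R - 1) * u).
  by rewrite /Npol /ell natrD; ring.
have b2 : 2 <= b%:R :> R by rewrite (ler_nat R 2).
have d0 : 0 < a%:R + b%:R - 1 :> R by lra.
exists ((b%:R - 1) / (a%:R + b%:R - 1)); split.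
  by rewrite divr_gt0 ?ltr_pdivrMr //; lra.
move=> u /andP[u0 u1]; rewrite NE; split.
  by rewrite ltr_pdivlMr // => h; apply: mulr_gt0 => //; lra.
by rewrite ltr_pdivrMr // => h; rewrite pmulr_rlt0 //; lra.
Qed.

Definition root_pair x y (al be : R) : Prop :=
  [/\ 0 < al, al < be, be < 1, Qpol x y al = 0 & Qpol x y be = 0].

Lemma Qpol_ratio x y u : 0 <= x -> 0 < u < 1 -> Qpol x y u = ell x u * (y * (wgt u / ell x u) - 1).
Proof.
move=> x0 hu; have ln : ell x u != 0 by rewrite gt_eqF // ell_gt0.
by rewrite /Qpol; field.
Qed.

Lemma ratio_mono x : admissible x -> exists us, [/\ 0 < us < 1,
  forall u, 0 < u < us -> 0 < Npol x u, forall u, us < u < 1 -> Npol x u < 0,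
  forall u v, 0 < u -> u < v -> v <= us -> wgt u / ell x u < wgt v / ell x v &
  forall u v, us <= u -> u < v -> v < 1 -> wgt v / ell x v < wgt u / ell x u].
Proof.
move=> ax; have x0 := admissible_ge0 ax; have [us [hus Ns]] := Npol_sign ax.
have /andP[us0 us1] := hus.
have K0 u : 0 < u < 1 -> 0 < (1 - u) ^+ a.-1 * u ^+ b.-1 / ell x u ^+ 2.
  move=> hu; have := ell_gt0 x0 hu; have /andP[u0 u1] := hu => l0.
  by rewrite divr_gt0 ?mulr_gt0 ?exprn_gt0 // subr_gt0.
have cr (c d : R) : 0 < c -> d < 1 -> {within `[c, d], continuous (fun u => wgt u / ell x u)}.
  move=> c0 d1; apply: derivable_within_continuous => z; rewrite in_itv /= => /andP[cz zd].
  have hz : 0 < z < 1 by lra.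
  by have [] := dv_ratio x0 hz.
exists us; split => //.
- by move=> u hu; apply: (Ns u _).1; lra.
- by move=> u hu; apply: (Ns u _).2; lra.
- move=> u v u0 uv vus.
  have [||c] := @MVT _ _ (fun u => (1 - u) ^+ a.-1 * u ^+ b.-1 / ell x u ^+ 2 * Npol x u) u v uv _ (cr u v u0 _).
  + by move=> z; rewrite in_itv /= => hz; apply: dv_ratio => //; lra.
  + by lra.
  rewrite in_itv /= => hc E; rewrite -subr_gt0 E mulr_gt0 ?subr_gt0 //.
  by apply: mulr_gt0; [apply: K0|apply: (Ns c _).1]; lra.
- move=> u v uus uv v1.
  have [||c] := @MVT _ _ (fun u => (1 - u) ^+ a.-1 * u ^+ b.-1 / ell x u ^+ 2 * Npol x u) u v uv _ (cr u v _ v1).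
  + by move=> z; rewrite in_itv /= => hz; apply: dv_ratio => //; lra.
  + by lra.
  rewrite in_itv /= => hc E; rewrite -subr_lt0 E pmulr_llt0 ?subr_gt0 //.
  by rewrite pmulr_rlt0; [apply: (Ns c _).2|apply: K0]; lra.
Qed.

End Roots.

(** * Its two roots *)

Section RootStructure.
Context {R : realType}.
Variables (a b : nat).
Hypotheses (a0 : (0 < a)%N) (b0 : (0 < b)%N).
Implicit Types (x y u al be : R).

Local Notation Q := (Qpol a b).
Local Notation w := (wgt a b).

Definition potential_well x y : Prop := exists2 u, 0 < u < 1 & 0 < Q x y u.

Lemma Qpol_continuous x y (c d : R) : {within `[c, d], continuous (Q x y)}.
Proof.
apply: derivable_within_continuous => z _.
by have [] := dv_Qpol a0 b0 x y z.
Qed.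

Lemma Qpol_sign x y u : 0 <= x -> 0 < u < 1 -> 0 < y ->
  ((0 < Q x y u) = (y^-1 < w u / ell x u)) * ((Q x y u < 0) = (w u / ell x u < y^-1)).
Proof.
move=> x0 hu y0; rewrite Qpol_ratio // pmulr_rgt0 ?ell_gt0 // pmulr_rlt0 ?ell_gt0 //.
by rewrite subr_gt0 subr_lt0 -(ltr_pdivrMl _ _ y0) -(ltr_pdivlMl _ _ y0) !mulr1.
Qed.

Lemma root_ratio x y u : 0 <= x -> 0 < u < 1 -> 0 < y -> Q x y u = 0 -> w u / ell x u = y^-1.
Proof.
move=> x0 hu y0 E; have [h1 h2] := Qpol_sign x0 hu y0.
move: h1 h2; rewrite E ltxx => h1 h2.
by apply/eqP; rewrite eq_le !leNgt -h1 -h2.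
Qed.

Lemma well_y_gt0 x y u : 0 <= x -> 0 < u < 1 -> 0 < Q x y u -> 0 < y.
Proof.
move=> x0 hu; have := ell_gt0 x0 hu; have := wgt_gt0 a b hu; rewrite /Qpol; nra.
Qed.

(** For x > 0 one has Q(0) = - x < 0; for x = 0 and b > 1 the term - u dominates
    near 0. *)
Lemma Qpol_neg_left x y u : admissible b x -> 0 < u < 1 -> 0 < y ->
  exists2 v, 0 <= v < u & Q x y v < 0.
Proof.
move=> [x0|[-> b1]] /andP[u0 u1] y0.
  exists 0; first by rewrite lexx.
  by rewrite /Qpol /ell /wgt expr0n eqn0Ngt b0 /=; nra.
pose v := Num.min (u / 2) (2 * y)^-1.
have v0 : 0 < v by rewrite lt_min divr_gt0 //= invr_gt0 mulr_gt0.
have vu : v < u by apply: le_lt_trans (_ : u / 2 < u); [rewrite ge_min lexx|lra].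
have yv : y * v <= 2^-1.
  have : v <= (2 * y)^-1 by rewrite ge_min lexx orbT.
  move=> h; apply: le_trans (ler_wpM2l (ltW y0) h) _.
  by rewrite invfM mulrCA divff ?gt_eqF // mulr1.
exists v; first by rewrite ltW.
rewrite /Qpol /ell mul0r addr0 subr_lt0 /wgt.
have w1 : (1 - v) ^+ a <= 1 by apply: exprn_ile1; lra.
have vb : v ^+ b <= v ^+ 2 by apply: ler_wiXn2l => //; lra.
have vb0 : 0 <= v ^+ b by rewrite exprn_ge0 // ltW.
have wv : (1 - v) ^+ a * v ^+ b <= v ^+ 2.
  by apply: le_trans vb; rewrite ler_piMl.
apply: le_lt_trans (ler_wpM2l (ltW y0) wv) _.
by rewrite expr2 mulrA; nra.
Qed.

Lemma root_pair_exists x y : admissible b x -> potential_well x y ->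
  exists al be, root_pair a b x y al be.
Proof.
move=> ax [u hu Qu]; have x0 := admissible_ge0 ax; have y0 := well_y_gt0 x0 hu Qu.
have [v /andP[v0 vu] Qv] := Qpol_neg_left ax hu y0.
have /andP[u0 u1] := hu.
have Q1 : Q x y 1 < 0.
  by rewrite /Qpol /ell /wgt subrr expr0n eqn0Ngt a0 /=; lra.
have [|al] := @IVT R (Q x y) v u 0 (ltW vu) (@Qpol_continuous _ _ _ _).
  by rewrite ge_min le_max (ltW Qv) (ltW Qu) orbT.
rewrite in_itv /= => /andP[val alu] Qal.
have [|be] := @IVT R (Q x y) u 1 0 (ltW u1) (@Qpol_continuous _ _ _ _).
  by rewrite ge_min le_max (ltW Q1) (ltW Qu) orbT.
rewrite in_itv /= => /andP[ube be1] Qbe.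
have alv : v < al by rewrite lt_neqAle val andbT; apply/eqP => E; move: Qv; rewrite E Qal ltxx.
have alu' : al < u by rewrite lt_neqAle alu andbT; apply/eqP => E; move: Qu; rewrite -E Qal ltxx.
have be1' : be < 1 by rewrite lt_neqAle be1 andbT; apply/eqP => E; move: Q1; rewrite -E Qbe ltxx.
exists al, be; split => //.
  exact: le_lt_trans alv.
exact: lt_le_trans ube.
Qed.

Lemma root_pair_y_gt0 x y al be : 0 <= x -> root_pair a b x y al be -> 0 < y.
Proof.
move=> x0 [al0 ab be1 Qal _]; have hal : 0 < al < 1 by lra.
have := ell_gt0 x0 hal; have := wgt_gt0 a b hal; move: Qal; rewrite /Qpol; nra.
Qed.

(** Q is positive where wgt / ell exceeds 1 / y, and this ratio is unimodal. *)
Lemma root_pair_sign x y al be : admissible b x -> root_pair a b x y al be ->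
  exists us, [/\ al < us < be, 0 < Npol a b x al, Npol a b x be < 0 & forall u, 0 < u < 1 ->
    [/\ al < u < be -> 0 < Q x y u, u < al -> Q x y u < 0 & be < u -> Q x y u < 0]].
Proof.
move=> ax rp; have x0 := admissible_ge0 ax; have y0 := root_pair_y_gt0 x0 rp.
have [al0 ab be1 Qal Qbe] := rp.
have hal : 0 < al < 1 by lra. have hbe : 0 < be < 1 by lra.
have ral := root_ratio x0 hal y0 Qal; have rbe := root_ratio x0 hbe y0 Qbe.
have [us [hus Np Nn mi md]] := ratio_mono a0 b0 ax.
have al_us : al < us.
  rewrite ltNge; apply/negP => h; have := md al be h ab be1; rewrite ral rbe ltxx //.
have us_be : us < be.
  rewrite ltNge; apply/negP => h; have := mi al be al0 ab h; rewrite ral rbe ltxx //.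
exists us; split; [by rewrite al_us|by apply: Np; lra|by apply: Nn; lra|].
move=> u hu; have /andP[u0 u1] := hu; rewrite !(Qpol_sign x0 hu y0); split.
- move=> /andP[alu ube]; case: (leP u us) => h.
    by rewrite -ral; apply: mi.
  by rewrite -rbe; apply: md => //; exact: ltW.
- by move=> h; rewrite -ral; apply: mi => //; exact: ltW.
- by move=> h; rewrite -rbe; apply: md => //; exact: ltW.
Qed.

Lemma root_pair_inside x y al be v : admissible b x -> root_pair a b x y al be ->
  0 < v < 1 -> 0 < Q x y v -> al < v < be.
Proof.
move=> ax rp hv Qv; have [_ [_ _ _ /(_ v hv) [_ h2 h3]]] := root_pair_sign ax rp.
have [_ _ _ Qal Qbe] := rp; case: (ltgtP al v) => [h|/h2 h|E].
- case: (ltgtP v be) => [//|/h3 h'|E]; first by move: (lt_trans h' Qv); rewrite ltxx.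
  by move: Qv; rewrite E Qbe ltxx.
- by move: (lt_trans h Qv); rewrite ltxx.
- by move: Qv; rewrite -E Qal ltxx.
Qed.

Lemma root_pair_unique x y al be c : admissible b x -> root_pair a b x y al be ->
  0 < c < 1 -> Q x y c = 0 -> c = al \/ c = be.
Proof.
move=> ax rp hc Qc; have [us [_ _ _ /(_ c hc) [h1 h2 h3]]] := root_pair_sign ax rp.
case: (ltgtP c al) => [/h2|h|]; [by rewrite Qc ltxx| |by left].
case: (ltgtP c be) => [h'|/h3|]; [|by rewrite Qc ltxx|by right].
by have := h1 _; rewrite Qc ltxx h h' => /(_ isT).
Qed.

Lemma root_pair_inj x y al be al' be' : admissible b x ->
  root_pair a b x y al be -> root_pair a b x y al' be' -> al' = al /\ be' = be.
Proof.
move=> ax rp [al0' ab' be1' Qal' Qbe'].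
have hal' : 0 < al' < 1 by lra. have hbe' : 0 < be' < 1 by lra.
have [_ ab _ _ _] := rp.
have h1 := root_pair_unique ax rp hal' Qal'; have h2 := root_pair_unique ax rp hbe' Qbe'.
by case: h1 ab' => ->; case: h2 => ->; lra.
Qed.

(** The quotient of Q by (u - al)(be - u), written as a divided difference to be
    defined at the roots too. *)
Definition Gpol y al be u : R := - (y * dd2 (wseq a b) al u be).

Lemma Gpol_factor x y al be u : root_pair a b x y al be ->
  Q x y u = (u - al) * (be - u) * Gpol y al be u.
Proof.
move=> [al0 ab be1 Qal Qbe].
have E v v' : (v - v') * (y * dd1 (wseq a b) v v' - (1 - x)) = Q x y v - Q x y v'.
  rewrite mulrBr mulrCA dd1E !wseqE /Qpol /ell; ring.
have Eab : y * dd1 (wseq a b) al be - (1 - x) = 0.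
  have := E al be; rewrite Qal Qbe subrr => /eqP; rewrite mulf_eq0 subr_eq0 lt_eqF //=.
  by move/eqP.
have := E al u; rewrite Qal sub0r => Eu.
have D := dd2E (wseq a b) al u be.
have H : y * dd1 (wseq a b) al u - (1 - x) = y * ((u - be) * dd2 (wseq a b) al u be).
  by rewrite D mulrBr; lra.
by rewrite H in Eu; rewrite -[LHS]opprK -Eu /Gpol; ring.
Qed.

Lemma dv_Gpol y al be u : exists l, dv (Gpol y al be) u l.
Proof. by have [l dl] := dv_dd2 (wseq a b) al u be; eexists; exact: dvN (dvZ y dl). Qed.

Lemma Qpol_deriv x y al be c l : root_pair a b x y al be -> dv (Gpol y al be) c l ->
  (be - c) * Gpol y al be c - (c - al) * Gpol y al be c + (c - al) * (be - c) * l
  = y * dwgt a b c - (1 - x).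
Proof.
move=> rp dl; apply: dv_unique (dv_Qpol a0 b0 x y c).
have -> : Q x y = (fun u => (u - al) * (be - u) * Gpol y al be u).
  by apply/funext => v; exact: Gpol_factor.
apply: dv_eq (dvM (dvM (dvB (dv_id c) (dv_cst al c)) (dvB (dv_cst be c) (dv_id c))) dl) _.
by ring.
Qed.

(** Away from the roots this is the sign of Q.  At a root the quotient is, up to
    sign, the derivative of Q over be - al; eliminating wgt by Q = 0 turns this
    derivative into a positive multiple of Npol. *)
Lemma Gpol_gt0 x y al be u : admissible b x -> root_pair a b x y al be -> 0 < u < 1 ->
  0 < Gpol y al be u.
Proof.
move=> ax rp hu; have x0 := admissible_ge0 ax; have y0 := root_pair_y_gt0 x0 rp.
have [us [hus Nal Nbe /(_ u hu) [h1 h2 h3]]] := root_pair_sign ax rp.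
have [al0 ab be1 Qal Qbe] := rp; have F := Gpol_factor u rp.
have dQ c l (hc : 0 < c < 1) (dl : dv (Gpol y al be) c l) := Qpol_deriv rp dl.
have dN c : 0 < c < 1 -> Q x y c = 0 -> exists2 k, 0 < k & y * dwgt a b c - (1 - x) = k * Npol a b x c.
  move=> hc Qc; have l0 := ell_gt0 x0 hc; have ln : ell x c != 0 by rewrite gt_eqF.
  have /andP[c0 c1] := hc.
  exists (y * ((1 - c) ^+ a.-1 * c ^+ b.-1 / ell x c)).
    by rewrite mulr_gt0 // divr_gt0 // mulr_gt0 ?exprn_gt0 // subr_gt0.
  have yw : y * wgt a b c = ell x c by move: Qc; rewrite /Qpol; lra.
  have wE : wgt a b c = (1 - c) ^+ a.-1 * c ^+ b.-1 * (c * (1 - c)).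
    by rewrite /wgt; case: a a0 => // a' _; case: b b0 => // b' _; rewrite !exprS /=; ring.
  have yK : y * ((1 - c) ^+ a.-1 * c ^+ b.-1) * (c * (1 - c)) = ell x c by rewrite -yw wE; ring.
  rewrite /Npol /dwgt; set K := (1 - c) ^+ a.-1 * c ^+ b.-1 in yK *.
  have -> : y * (K * (b%:R - (a + b)%:R * c)) - (1 - x) =
    y * (K / ell x c) * ((b%:R - (a + b)%:R * c) * ell x c) - (1 - x) * (y * K * (c * (1 - c))) / ell x c.
    by rewrite yK; field.
  by field.
case: (ltgtP u al) => [h|h|E].
- have hb : u < be by lra.
  have c : (u - al) * (be - u) < 0 by rewrite nmulr_rlt0 ?subr_gt0 ?subr_lt0.
  by move: (h2 h); rewrite F nmulr_rlt0.
- case: (ltgtP u be) => [h'|h'|E].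
  + have c : 0 < (u - al) * (be - u) by rewrite mulr_gt0 ?subr_gt0.
    by move: h1; rewrite h h' F pmulr_rgt0 // => /(_ isT).
  + have c : (u - al) * (be - u) < 0 by rewrite pmulr_rlt0 ?subr_gt0 ?subr_lt0.
    by move: (h3 h'); rewrite F nmulr_rlt0.
  + rewrite E; have hbe : 0 < be < 1 by lra.
    have [l dl] := dv_Gpol y al be be; have := dQ be l hbe dl.
    have [k k0 ->] := dN be hbe Qbe; nra.
- rewrite E; have hal : 0 < al < 1 by lra.
  have [l dl] := dv_Gpol y al be al; have := dQ al l hal dl.
  have [k k0 ->] := dN al hal Qal; nra.
Qed.

Lemma dwgt_dd1 u : dwgt a b u = dd1 (wseq a b) u u.
Proof.
apply: dv_unique (dv_wgt a0 b0 u) _.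
apply: dv_near (dv_horner_rec (wseq a b) u).
by apply: (@nearW _ (nbhs u)) => v; rewrite wseqE.
Qed.

(** At a root the derivative of Q is (be - al) times the quotient, up to sign. *)
Lemma root_pair_simple x y al be : admissible b x -> root_pair a b x y al be ->
  y * dd1 (wseq a b) al al - (1 - x) != 0 /\ y * dd1 (wseq a b) be be - (1 - x) != 0.
Proof.
move=> ax rp; have [al0 ab be1 Qal Qbe] := rp.
have [l dl] := dv_Gpol y al be al; have [m dm] := dv_Gpol y al be be.
rewrite -!dwgt_dd1 -(Qpol_deriv rp dl) -(Qpol_deriv rp dm) !subrr !mul0r !mulr0 !mul0r !addr0 subr0 sub0r.
have gal : 0 < Gpol y al be al by apply: (Gpol_gt0 ax rp); lra.
have gbe : 0 < Gpol y al be be by apply: (Gpol_gt0 ax rp); lra.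
split; first by rewrite mulf_neq0 ?gt_eqF ?subr_gt0.
by rewrite oppr_eq0 mulf_neq0 ?gt_eqF ?subr_gt0.
Qed.

End RootStructure.

(** * Analytic roots and inverse square roots *)

Section SmallPerturbations.
Context {R : realType}.
Notation germ := (R -> R -> R -> R).
Implicit Types (v w F G : germ).

(** The bound c * d is linear in the size d of the arguments, so that shrinking
    the box makes it as small as a contraction requires. *)
Definition small_near (E : germ -> germ -> germ) (e : R) : Prop :=
  exists2 c, 0 <= c & forall r d v w, 0 <= r -> r <= d -> d <= 1 ->
    pser r v d -> pser r w d -> pser r (fun phi h k => E v w phi h k - e) (c * d).

Lemma small_near_cst (e : R) : small_near (fun _ _ _ _ _ => e) e.
Proof.
exists 0 => // r d v w _ _ _ _ _; rewrite mul0r -(@normr0 _ R).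
by apply: pser_eq (pser_cst r 0) => phi h k _ _; rewrite subrr.
Qed.

Lemma small_near_fst (c : R) : small_near (fun v _ phi h k => c + v phi h k) c.
Proof.
by exists 1 => // r d v w _ _ _ pv _; rewrite mul1r; apply: pser_eq pv => phi h k _ _; ring.
Qed.

Lemma small_near_snd (c : R) : small_near (fun _ w phi h k => c + w phi h k) c.
Proof.
by exists 1 => // r d v w _ _ _ _ pw; rewrite mul1r; apply: pser_eq pw => phi h k _ _; ring.
Qed.

Lemma small_near_h (c : R) : small_near (fun _ _ _ h _ => c + h) c.
Proof.
exists 1 => // r d v w r0 rd _ _ _; rewrite mul1r; apply: (pser_weak rd).
by apply: pser_eq (pser_h r0) => phi h k _ _; ring.
Qed.

Lemma small_near_k (c : R) : small_near (fun _ _ _ _ k => c + k) c.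
Proof.
exists 1 => // r d v w r0 rd _ _ _; rewrite mul1r; apply: (pser_weak rd).
by apply: pser_eq (pser_k r0) => phi h k _ _; ring.
Qed.

Lemma small_near_add E E' (e e' : R) : small_near E e -> small_near E' e' ->
  small_near (fun v w phi h k => E v w phi h k + E' v w phi h k) (e + e').
Proof.
move=> [c c0 H] [c' c0' H']; exists (c + c'); first exact: addr_ge0.
move=> r d v w r0 rd d1 pv pw; rewrite mulrDl.
apply: pser_eq (pser_add (H r d v w r0 rd d1 pv pw) (H' r d v w r0 rd d1 pv pw)) => phi h k _ _.
by ring.
Qed.

Lemma small_near_mul E E' (e e' : R) : small_near E e -> small_near E' e' ->
  small_near (fun v w phi h k => E v w phi h k * E' v w phi h k) (e * e').
Proof.
move=> [c c0 H] [c' c0' H'].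
exists (c * c' + `|e| * c' + `|e'| * c); first by rewrite !addr_ge0 ?mulr_ge0.
move=> r d v w r0 rd d1 pv pw; have d0 := le_trans r0 rd.
have h1 := H r d v w r0 rd d1 pv pw; have h2 := H' r d v w r0 rd d1 pv pw.
apply: (@pser_weak _ _ _ ((c * d) * (c' * d) + `|e| * (c' * d) + `|e'| * (c * d))).
  rewrite !mulrDl !mulrA !lerD2r.
  have -> : c * d * c' * d = c * c' * d * d by ring.
  by rewrite ler_piMr // !mulr_ge0.
apply: pser_eq (pser_add (pser_add (pser_mul r0 h1 h2) (pser_scale e r0 h2)) (pser_scale e' r0 h1)).
by move=> phi h k _ _; ring.
Qed.

Lemma small_near_scale E (c e : R) : small_near E e ->
  small_near (fun v w phi h k => c * E v w phi h k) (c * e).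
Proof. exact: small_near_mul (small_near_cst c). Qed.

Lemma small_near_sub E E' (e e' : R) : small_near E e -> small_near E' e' ->
  small_near (fun v w phi h k => E v w phi h k - E' v w phi h k) (e - e').
Proof.
move=> HE HE'; have [c c0 H] := small_near_add HE (small_near_scale (-1) HE').
exists c => // r d v w r0 rd d1 pv pw; rewrite -(mulN1r e').
apply: (pser_eq _ (H r d v w r0 rd d1 pv pw)) => phi h k _ _; ring.
Qed.

Lemma small_near_horner (s : seq R) E e : small_near E e ->
  small_near (fun v w phi h k => horner_rec s (E v w phi h k)) (horner_rec s e).
Proof.
move=> HE; elim: s => [|c s IH] /=; first exact: small_near_cst.
exact: small_near_add (small_near_mul IH HE) (small_near_cst c).
Qed.

Lemma small_near_dd1 (s : seq R) E E' e e' : small_near E e -> small_near E' e' ->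
  small_near (fun v w phi h k => dd1 s (E v w phi h k) (E' v w phi h k)) (dd1 s e e').
Proof.
move=> HE HE'; elim: s => [|c s IH] /=; first exact: small_near_cst.
exact: small_near_add (small_near_horner s HE) (small_near_mul HE' IH).
Qed.

End SmallPerturbations.

Section ImplicitRoot.
Context {R : realType}.
Variables (a b : nat).

(** Newton's iteration with the slope D frozen at the simple root u0 contracts.
    The parameter is C_1 and not its square, in order to cross C_1 = 0. *)
Lemma analytic_root (c1 y0 u0 d0 : R) : 0 < d0 ->
  Qpol a b (c1 ^+ 2) y0 u0 = 0 -> y0 * dd1 (wseq a b) u0 u0 - (1 - c1 ^+ 2) != 0 ->
  exists (r : R) v, [/\ 0 < r, pser r v d0 & forall phi h k, `|h| <= r -> `|k| <= r ->
    Qpol a b ((c1 + h) ^+ 2) (y0 + k) (u0 + v phi h k) = 0].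
Proof.
move=> d00 Q0; set D := _ - _ => D0; set s := wseq a b in D D0.
pose T (v : R -> R -> R -> R) phi h k :=
  v phi h k - D^-1 * Qpol a b ((c1 + h) ^+ 2) (y0 + k) (u0 + v phi h k).
pose B (v w : R -> R -> R -> R) phi h k :=
  1 - D^-1 * ((y0 + k) * dd1 s (u0 + v phi h k) (u0 + w phi h k) - (1 - (c1 + h) * (c1 + h))).
have TB v w phi h k : T v phi h k - T w phi h k = (v phi h k - w phi h k) * B v w phi h k.
  have E := dd1E s (u0 + v phi h k) (u0 + w phi h k); rewrite !wseqE in E.
  rewrite /T /B /Qpol /ell.
  have -> : wgt a b (u0 + v phi h k) = wgt a b (u0 + w phi h k) +
    (u0 + v phi h k - (u0 + w phi h k)) * dd1 s (u0 + v phi h k) (u0 + w phi h k) by rewrite E; ring.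
  by ring.
have [C C0 HB] : small_near B 0.
  have : small_near B (1 - D^-1 * (y0 * dd1 s u0 u0 - (1 - c1 * c1))).
    apply: small_near_sub; first exact: small_near_cst.
    apply: small_near_scale; apply: small_near_sub.
      by apply: small_near_mul (small_near_k y0) _; apply: small_near_dd1;
        [exact: small_near_fst|exact: small_near_snd].
    apply: small_near_sub; first exact: small_near_cst.
    exact: small_near_mul (small_near_h c1) (small_near_h c1).
  by rewrite -expr2 -/D mulVf // subrr.
pose T0 (_ _ : R -> R -> R -> R) (_ h k : R) := - D^-1 * ((y0 + k) * wgt a b u0 - (u0 + (c1 + h) * (c1 + h) * (1 - u0))).
have [C' C0' HT] : small_near T0 0.
  have : small_near T0 (- D^-1 * (y0 * wgt a b u0 - (u0 + c1 * c1 * (1 - u0)))).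
    apply: small_near_scale; apply: small_near_sub.
      exact: small_near_mul (small_near_k y0) (small_near_cst _).
    apply: small_near_add; first exact: small_near_cst.
    apply: small_near_mul; last exact: small_near_cst.
    exact: small_near_mul (small_near_h c1) (small_near_h c1).
  by move: Q0; rewrite /Qpol /ell expr2 => ->; rewrite mulr0.
pose d := Num.min d0 (Num.min 1 (2 * (C + 1))^-1).
have d_gt0 : 0 < d by rewrite !lt_min d00 ltr01 invr_gt0; lra.
have d1 : d <= 1 by rewrite /d ge_min ge_min lexx orbT.
have dd0 : d <= d0 by rewrite ge_min lexx.
have Cd : C * d <= 2^-1.
  have h : d <= (2 * (C + 1))^-1 by rewrite /d !ge_min lexx !orbT.
  apply: le_trans (ler_wpM2l C0 h) _; rewrite ler_pdivrMr; lra.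
pose r := Num.min d (d / (2 * (C' + 1))).
have r_gt0 : 0 < r by rewrite lt_min d_gt0 divr_gt0 //; lra.
have rd : r <= d by rewrite ge_min lexx.
have Cr : C' * r <= d / 2.
  have h : r <= d / (2 * (C' + 1)) by rewrite /r ge_min lexx orbT.
  apply: le_trans (ler_wpM2l C0' h) _; rewrite mulrCA ler_wpM2l ?(ltW d_gt0) //.
  rewrite ler_pdivrMr; lra.
have p0 : pser r (fun _ _ _ => 0) r.
  apply: (@pser_weak _ _ _ `|0|); first by rewrite normr0 ltW.
  exact: pser_cst.
have [||v [pv Tv]] := @pser_fixpoint R r d T (ltW r_gt0) (ltW d_gt0).
- apply: (pser_weak Cr).
  apply: pser_eq (HT r r _ _ (ltW r_gt0) (lexx _) (le_trans rd d1) p0 p0) => phi h k _ _.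
  by rewrite /T /T0 /Qpol /ell !addr0 expr2; ring.
- move=> v w m pv pw pm.
  apply: (@pser_weak _ _ _ (m * (C * d))).
    by rewrite ler_wpM2l // (pser_ge0 pm).
  apply: pser_eq (pser_mul (ltW r_gt0) pm (HB r d v w (ltW r_gt0) rd d1 pv pw)) => phi h k _ _.
  by rewrite subr0 -TB.
exists r, v; split => //; first exact: pser_weak pv.
move=> phi h k hr kr; have := Tv phi h k hr kr; rewrite /T => E.
have : D^-1 * Qpol a b ((c1 + h) ^+ 2) (y0 + k) (u0 + v phi h k) = 0 by lra.
by move/eqP; rewrite mulf_eq0 invr_eq0 (negbTE D0) => /eqP.
Qed.

End ImplicitRoot.

Section InverseSqrt.
Context {R : realType}.
Notation germ := (R -> R -> R -> R).

(** Writing F = F(., 0, 0) (1 + N) with N small, Newton's iteration with frozen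
    slope solves (1 + v)^2 (1 + N) = 1. *)
Lemma pser_invsqrt r (F : germ) M c : 0 < r -> pser r F M -> 0 < c ->
  (forall phi, c <= F phi 0 0) ->
  exists r' M', [/\ 0 < r', r' <= r, pser r' (fun phi h k => (Num.sqrt (F phi h k))^-1) M' &
    forall phi h k, `|h| <= r' -> `|k| <= r' -> 0 < F phi h k].
Proof.
move=> r0 pF c0 cF; have rge := ltW r0.
have M0 := pser_ge0 pF.
pose g phi := F phi 0 0.
have g0 phi : 0 < g phi := lt_le_trans c0 (cF phi).
have r00 : `|0 : R| <= r by rewrite normr0.
have cg : continuous g := pser_continuous rge pF r00 r00.
(* th bounds the norm of N by 1 / 8, for which the iteration contracts the ball
   of radius 1 / 4 *)
pose th := Num.min 1 (c / (8 * (M + 1))).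
have th0 : 0 < th by rewrite lt_min ltr01 divr_gt0 //; lra.
have th1 : th <= 1 by rewrite ge_min lexx.
have thM : th * M <= c / 8.
  have h : th <= c / (8 * (M + 1)) by rewrite ge_min lexx orbT.
  apply: le_trans (ler_wpM2r M0 h) _; rewrite -mulrA ler_wpM2l ?(ltW c0) //.
  by rewrite mulrC ler_pdivrMr; lra.
pose r' := th * r.
have r'0 : 0 < r' by rewrite mulr_gt0.
have r'r : r' <= r by rewrite /r' ler_piMl.
have pd : pser r' (fun phi h k => F phi h k - g phi) (c / 8).
  by apply: (pser_weak thM); apply: pser_small; rewrite // (ltW th0).
have pig : pser r' (fun phi _ _ => (g phi)^-1) c^-1.
  apply: pser_coef; first by rewrite invr_ge0 ltW.
    by move=> phi; apply: cvgV; [exact: lt0r_neq0 (g0 phi)|exact: cg].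
  by move=> phi; rewrite gtr0_norm ?invr_gt0 // lef_pV2 ?posrE //; exact: cF.
pose N : germ := fun phi h k => (F phi h k - g phi) * (g phi)^-1.
have pN : pser r' N (8^-1).
  have -> : 8^-1 = (c / 8) * c^-1 :> R by field; rewrite gt_eqF.
  exact: pser_mul (ltW r'0) pd pig.
have FN phi h k : F phi h k = g phi * (1 + N phi h k).
  by rewrite /N; field; rewrite gt_eqF.
pose T (v : germ) : germ := fun phi h k =>
  v phi h k - 2^-1 * ((1 + v phi h k) ^+ 2 * (1 + N phi h k) - 1).
have p1 : pser r' (fun _ _ _ => 1 : R) 1 by rewrite -{2}(@normr1 R); exact: pser_cst.
have [|||v [pv Tv]] := @pser_fixpoint R r' 4^-1 T (ltW r'0).
- by rewrite invr_ge0.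
- apply: (@pser_weak _ _ _ (`|- 2^-1| * 8^-1)).
    by rewrite normrN ger0_norm; lra.
  by apply: pser_eq (pser_scale (- 2^-1) (ltW r'0) pN) => phi h k _ _; rewrite /T; ring.
- move=> v w m pv pw pm.
  have pB : pser r' (fun phi h k => - 2^-1 * ((2 * N phi h k) + (v phi h k + w phi h k) * (1 + N phi h k)))
     (`|- 2^-1| * ((`|2| * 8^-1) + (4^-1 + 4^-1) * (1 + 8^-1))).
    apply: pser_scale; first exact: ltW.
    apply: pser_add; first exact: pser_scale (ltW r'0) pN.
    by apply: pser_mul; [exact: ltW|exact: pser_add|exact: pser_add].
  apply: (@pser_weak _ _ _ (m * (`|- 2^-1| * ((`|2| * 8^-1) + (4^-1 + 4^-1) * (1 + 8^-1))))).
    rewrite ler_wpM2l ?(pser_ge0 pm) // normrN !ger0_norm //; lra.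
  apply: pser_eq (pser_mul (ltW r'0) pm pB) => phi h k _ _.
  by rewrite /T; field.
have vb phi h k : `|h| <= r' -> `|k| <= r' -> 0 < 1 + v phi h k /\ (1 + v phi h k) ^+ 2 * (1 + N phi h k) = 1.
  move=> hr kr; have := pser_le phi (ltW r'0) pv hr kr; rewrite ler_norml => /andP[v1 v2].
  have := Tv phi h k hr kr; rewrite /T => E; split; lra.
have Npos phi h k : `|h| <= r' -> `|k| <= r' -> 0 < 1 + N phi h k.
  move=> hr kr; have := pser_le phi (ltW r'0) pN hr kr; rewrite ler_norml => /andP[v1 v2]; lra.
exists r', ((Num.sqrt c)^-1 * (1 + 4^-1)); split => //; last first.
  by move=> phi h k hr kr; rewrite FN mulr_gt0 // Npos.
have psg : pser r' (fun phi _ _ => (Num.sqrt (g phi))^-1) (Num.sqrt c)^-1.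
  apply: pser_coef; first by rewrite invr_ge0 sqrtr_ge0.
    move=> phi; apply: cvgV; first by rewrite gt_eqF // sqrtr_gt0.
    by apply: (@continuous_comp _ _ _ g Num.sqrt phi (cg phi)); exact: sqrt_continuous.
  move=> phi; rewrite gtr0_norm ?invr_gt0 ?sqrtr_gt0 // lef_pV2 ?posrE ?sqrtr_gt0 //.
  by rewrite (ler_sqrt _ (ltW (g0 phi))); exact: cF.
apply: pser_eq (pser_mul (ltW r'0) psg (pser_add p1 pv)) => phi h k hr kr.
have [v0 vE] := vb phi h k hr kr; have n0 := Npos phi h k hr kr.
rewrite FN sqrtrM ?(ltW (g0 phi)) // invfM; congr (_ * _).
have s0 : 0 < Num.sqrt (1 + N phi h k) by rewrite sqrtr_gt0.
have E : (1 + v phi h k) * Num.sqrt (1 + N phi h k) = 1.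
  have : ((1 + v phi h k) * Num.sqrt (1 + N phi h k)) ^+ 2 = 1 by rewrite exprMn sqr_sqrtr ?(ltW n0).
  move/eqP; rewrite sqrf_eq1 => /orP[/eqP //|/eqP E].
  by have := mulr_gt0 v0 s0; rewrite E; lra.
by apply: (mulIf (lt0r_neq0 s0)); rewrite E mulVf ?gt_eqF.
Qed.

End InverseSqrt.

(** * The phase integrals and their analyticity *)

Section Convergent.
Context {R : realType}.
Notation germ := (R -> R -> R -> R).

Definition convergent (r : R) (F : germ) : Prop := exists M, pser r F M.

Lemma convergent_cst r (c : R) : convergent r (fun _ _ _ => c).
Proof. by eexists; exact: pser_cst. Qed.

Lemma convergent_h (r : R) : 0 <= r -> convergent r (fun _ h _ => h).
Proof. by move=> r0; eexists; exact: pser_h. Qed.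

Lemma convergent_k (r : R) : 0 <= r -> convergent r (fun _ _ k => k).
Proof. by move=> r0; eexists; exact: pser_k. Qed.

Lemma convergent_add r (F G : germ) : convergent r F -> convergent r G ->
  convergent r (fun phi h k => F phi h k + G phi h k).
Proof. by move=> [M pF] [N pG]; eexists; exact: pser_add pF pG. Qed.

Lemma convergent_mul r (F G : germ) : 0 <= r -> convergent r F -> convergent r G ->
  convergent r (fun phi h k => F phi h k * G phi h k).
Proof. by move=> r0 [M pF] [N pG]; eexists; exact: pser_mul pF pG. Qed.

Lemma convergent_sub r (F G : germ) : 0 <= r -> convergent r F -> convergent r G ->
  convergent r (fun phi h k => F phi h k - G phi h k).
Proof. by move=> r0 [M pF] [N pG]; eexists; exact: pser_sub pF pG. Qed.

Lemma convergent_scale r (c : R) (F : germ) : 0 <= r -> convergent r F ->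
  convergent r (fun phi h k => c * F phi h k).
Proof. by move=> r0 [M pF]; eexists; exact: pser_scale pF. Qed.

Lemma convergent_shrink r r' (F : germ) : 0 <= r -> r <= r' -> convergent r' F -> convergent r F.
Proof. by move=> r0 rr [M pF]; exists M; exact: pser_shrink pF. Qed.

Lemma convergent_eq r (F G : germ) :
  (forall phi h k, `|h| <= r -> `|k| <= r -> F phi h k = G phi h k) ->
  convergent r F -> convergent r G.
Proof. by move=> FG [M pF]; exists M; exact: pser_eq pF. Qed.

Lemma convergent_horner r (s : seq R) (F : germ) : 0 <= r -> convergent r F ->
  convergent r (fun phi h k => horner_rec s (F phi h k)).
Proof.
move=> r0 pF; elim: s => [|c s IH] /=; first exact: convergent_cst.
exact: convergent_add (convergent_mul r0 IH pF) (convergent_cst r c).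
Qed.

Lemma convergent_dd1 r (s : seq R) (F G : germ) : 0 <= r -> convergent r F -> convergent r G ->
  convergent r (fun phi h k => dd1 s (F phi h k) (G phi h k)).
Proof.
move=> r0 pF pG; elim: s => [|c s IH] /=; first exact: convergent_cst.
exact: convergent_add (convergent_horner s r0 pF) (convergent_mul r0 pG IH).
Qed.

Lemma convergent_dd2 r (s : seq R) (F G H : germ) : 0 <= r -> convergent r F -> convergent r G ->
  convergent r H -> convergent r (fun phi h k => dd2 s (F phi h k) (G phi h k) (H phi h k)).
Proof.
move=> r0 pF pG pH; elim: s => [|c s IH] /=; first exact: convergent_cst.
exact: convergent_add (convergent_dd1 s r0 pF pG) (convergent_mul r0 pH IH).
Qed.

Lemma convergent_invsqrt r (F : germ) c : 0 < r -> convergent r F -> 0 < c ->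
  (forall phi, c <= F phi 0 0) ->
  exists r', [/\ 0 < r', r' <= r & convergent r' (fun phi h k => (Num.sqrt (F phi h k))^-1)].
Proof.
move=> r0 [M pF] c0 cF; have [r' [M' [r'0 r'r p _]]] := pser_invsqrt r0 pF c0 cF.
by exists r'; split => //; exists M'.
Qed.

(** The inverse of a positive function is the square of its inverse square root. *)
Lemma convergent_inv r (F : germ) c : 0 < r -> convergent r F -> 0 < c ->
  (forall phi, c <= F phi 0 0) ->
  exists r', [/\ 0 < r', r' <= r & convergent r' (fun phi h k => (F phi h k)^-1)].
Proof.
move=> r0 [M pF] c0 cF; have [r' [M' [r'0 r'r p Fp]]] := pser_invsqrt r0 pF c0 cF.
have cs : convergent r' (fun phi h k => (Num.sqrt (F phi h k))^-1) by exists M'.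
exists r'; split => //; apply: convergent_eq (convergent_mul (ltW r'0) cs cs) => phi h k hr kr.
by rewrite -invfM -expr2 sqr_sqrtr // ltW // Fp.
Qed.

End Convergent.

Section Phase.
Context {R : realType}.
Variables (a b : nat).
Implicit Types (x y al be phi : R).

(** The substitution u = umid phi absorbs the square root singularities of the
    phase integrals at both turning points. *)
Definition umid al be phi : R := (al + be) / 2 - (be - al) / 2 * cos phi.

Definition dens1 y al be phi : R :=
  (1 - umid al be phi)^-1 * (Num.sqrt (Gpol a b y al be (umid al be phi)))^-1.
Definition dens2 y al be phi : R :=
  (umid al be phi)^-1 * (Num.sqrt (Gpol a b y al be (umid al be phi)))^-1.

Definition roots x y : R * R := xget (0, 0) [set p : R * R | root_pair a b x y p.1 p.2].

Definition phase1 x y : R := prim (dens1 y (roots x y).1 (roots x y).2) pi.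
Definition phase2 x y : R := prim (dens2 y (roots x y).1 (roots x y).2) pi.

Hypotheses (a0 : (0 < a)%N) (b0 : (0 < b)%N).

Lemma rootsE x y al be : admissible b x -> root_pair a b x y al be -> roots x y = (al, be).
Proof.
move=> ax rp; rewrite /roots.
have := @xgetPex _ (0, 0) [set p : R * R | root_pair a b x y p.1 p.2] (ex_intro _ (al, be) rp).
case: (xget _ _) => al' be' /= rp'.
by have [-> ->] := root_pair_inj a0 b0 ax rp rp'.
Qed.

Lemma umid_itv al be phi : al <= be -> al <= umid al be phi <= be.
Proof.
by move=> ab; rewrite /umid; have := cos_geN1 phi; have := cos_le1 phi; nra.
Qed.

Lemma umid01 x y al be phi : root_pair a b x y al be -> 0 < umid al be phi < 1.
Proof. by move=> [al0 ab be1 _ _]; have := umid_itv phi (ltW ab); lra. Qed.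

Lemma dv_umid al be phi : dv (umid al be) phi ((be - al) / 2 * sin phi).
Proof.
apply: dv_eq (dvB (dv_cst _ phi) (dvZ _ (dv_cos phi))) _; ring.
Qed.

Lemma dv_Gumid y al be phi : exists l, dv (fun phi => Gpol a b y al be (umid al be phi)) phi l.
Proof.
have [l dl] := dv_Gpol a b y al be (umid al be phi).
by eexists; exact: dv_comp dl (dv_umid al be phi).
Qed.

Lemma Gumid_gt0 x y al be phi : admissible b x -> root_pair a b x y al be ->
  0 < Gpol a b y al be (umid al be phi).
Proof. by move=> ax rp; apply: (Gpol_gt0 a0 b0 ax rp); exact: umid01 rp. Qed.

Lemma dv_invsqrtG x y al be phi : admissible b x -> root_pair a b x y al be ->
  exists l, dv (fun phi => (Num.sqrt (Gpol a b y al be (umid al be phi)))^-1) phi l.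
Proof.
move=> ax rp; have [l dl] := dv_Gumid y al be phi; have g0 := Gumid_gt0 phi ax rp.
eexists; apply: dvV; first by rewrite gt_eqF // sqrtr_gt0.
exact: (@dv_comp _ _ (fun phi => Gpol a b y al be (umid al be phi)) phi _ _ (dv_sqrt g0) dl).
Qed.

Lemma continuous_dens1 x y al be : admissible b x -> root_pair a b x y al be ->
  continuous (dens1 y al be).
Proof.
move=> ax rp phi; have [l dl] := dv_invsqrtG phi ax rp; have /andP[u0 u1] := umid01 phi rp.
suff [m dm] : exists m, dv (dens1 y al be) phi m by exact: dv_continuous dm.
eexists; apply: dvM _ dl; apply: dvV; first by rewrite gt_eqF // subr_gt0.
exact: dvB (dv_cst 1 phi) (dv_umid al be phi).
Qed.

Lemma continuous_dens2 x y al be : admissible b x -> root_pair a b x y al be ->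
  continuous (dens2 y al be).
Proof.
move=> ax rp phi; have [l dl] := dv_invsqrtG phi ax rp; have /andP[u0 u1] := umid01 phi rp.
suff [m dm] : exists m, dv (dens2 y al be) phi m by exact: dv_continuous dm.
eexists; apply: dvM _ dl; apply: dvV; first by rewrite gt_eqF.
exact: dv_umid.
Qed.

Lemma analytic_root_pair (c1 y0 al be : R) : admissible b (c1 ^+ 2) ->
  root_pair a b (c1 ^+ 2) y0 al be ->
  exists r (AL BE : R -> R -> R -> R), [/\ 0 < r, convergent r AL, convergent r BE,
     forall phi h k : R, `|h| <= r -> `|k| <= r -> admissible b ((c1 + h) ^+ 2) &
     forall phi h k : R, `|h| <= r -> `|k| <= r ->
      root_pair a b ((c1 + h) ^+ 2) (y0 + k) (AL phi h k) (BE phi h k)].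
Proof.
move=> ax rp; have [al0 ab be1 Qal Qbe] := rp.
have [sal sbe] := root_pair_simple a0 b0 ax rp.
pose d0 := Num.min ((be - al) / 4) (Num.min (al / 2) ((1 - be) / 2)).
have d0p : 0 < d0 by rewrite !lt_min; apply/and3P; split; lra.
have d01 : d0 <= (be - al) / 4 by rewrite ge_min lexx.
have d02 : d0 <= al / 2 by rewrite /d0 !ge_min lexx orbT.
have d03 : d0 <= (1 - be) / 2 by rewrite /d0 !ge_min lexx !orbT.
have [r1 [v [r1p pv vE]]] := analytic_root d0p Qal sal.
have [r2 [w [r2p pw wE]]] := analytic_root d0p Qbe sbe.
have [r3 r3p adm] : exists2 r3, 0 < r3 & forall h : R, `|h| <= r3 -> admissible b ((c1 + h) ^+ 2).
  case: ax => [c0|[/eqP c0 b1]].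
    exists (`|c1| / 2); first by rewrite divr_gt0 // normr_gt0; move: c0; rewrite exprn_even_gt0.
    move=> h hc; left; rewrite exprn_even_gt0 //=; apply/eqP => E.
    have c1n : 0 < `|c1| by rewrite normr_gt0; move: c0; rewrite exprn_even_gt0.
    have : c1 = - h by lra.
    by move=> E'; move: hc c1n; rewrite E' normrN; lra.
  exists 1 => // h _; have := sqr_ge0 (c1 + h); rewrite le_eqVlt => /predU1P[<-|]; [by right|by left].
pose r := Num.min (Num.min r1 r2) r3.
have rp0 : 0 < r by rewrite !lt_min r1p r2p.
have rr1 : r <= r1 by rewrite /r !ge_min lexx.
have rr2 : r <= r2 by rewrite /r !ge_min lexx orbT.
have rr3 : r <= r3 by rewrite /r ge_min lexx orbT.
have pv' : pser r v d0 by exact: pser_shrink (ltW rp0) rr1 pv.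
have pw' : pser r w d0 by exact: pser_shrink (ltW rp0) rr2 pw.
exists r, (fun phi h k => al + v phi h k), (fun phi h k => be + w phi h k); split => //.
- by apply: convergent_add (convergent_cst r al) _; exists d0.
- by apply: convergent_add (convergent_cst r be) _; exists d0.
- by move=> _ h k hr _; apply: adm; exact: le_trans rr3.
move=> phi h k hr kr.
have := pser_le phi (ltW rp0) pv' hr kr; rewrite ler_norml => /andP[v1 v2].
have := pser_le phi (ltW rp0) pw' hr kr; rewrite ler_norml => /andP[w1 w2].
split; [lra|lra|lra|apply: vE; exact: le_trans rr1|apply: wE; exact: le_trans rr2].
Qed.

(** The quotient G is bounded below on [al, be], uniformly in phi, so that its
    inverse square root, the densities and their integrals are series too. *)
Lemma analytic_phase (c1 y0 : R) : admissible b (c1 ^+ 2) -> potential_well a b (c1 ^+ 2) y0 ->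
  exists r (F1 F2 : R -> R -> R -> R), [/\ 0 < r, convergent r F1, convergent r F2 &
    forall phi h k : R, `|h| <= r -> `|k| <= r ->
     [/\ admissible b ((c1 + h) ^+ 2), potential_well a b ((c1 + h) ^+ 2) (y0 + k),
         phase1 ((c1 + h) ^+ 2) (y0 + k) = F1 phi h k &
         phase2 ((c1 + h) ^+ 2) (y0 + k) = F2 phi h k]].
Proof.
move=> ax pw; have [al [be rp]] := root_pair_exists a0 b0 ax pw.
have [r [AL [BE [r0 cA cB adm rpE]]]] := analytic_root_pair ax rp.
have rge := ltW r0.
have n00 : `|0 : R| <= r by rewrite normr0.
have E0 phi : AL phi 0 0 = al /\ BE phi 0 0 = be.
  have := rpE phi 0 0 n00 n00; rewrite !addr0 => rp'.
  exact: (root_pair_inj a0 b0 ax rp rp').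
pose U phi h k := umid (AL phi h k) (BE phi h k) phi.
have cU : convergent r U.
  apply: (convergent_sub rge).
    by apply: (convergent_mul rge) (convergent_cst r 2^-1); exact: convergent_add.
  apply: (convergent_mul rge).
    by apply: (convergent_mul rge) (convergent_cst r 2^-1); exact: convergent_sub.
  exists 1; apply: pser_coef => //; first exact: continuous_cos.
  by move=> phi; rewrite ler_norml cos_geN1 cos_le1.
pose G phi h k := Gpol a b (y0 + k) (AL phi h k) (BE phi h k) (U phi h k).
have cG : convergent r G.
  have cG' : convergent r (fun phi h k => (-1) * ((y0 + k) * dd2 (wseq a b) (AL phi h k) (U phi h k) (BE phi h k))).
    apply: (convergent_scale _ rge); apply: (convergent_mul rge).
      exact: convergent_add (convergent_cst r y0) (convergent_k rge).
    exact: convergent_dd2.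
  by apply: convergent_eq cG' => phi h k _ _; rewrite /G /Gpol mulN1r.
have [al0 ab be1 _ _] := rp.
have U0 phi : U phi 0 0 = umid al be phi by rewrite /U; have [-> ->] := E0 phi.
have G0 phi : G phi 0 0 = Gpol a b y0 al be (umid al be phi).
  by rewrite /G U0 addr0; have [-> ->] := E0 phi.
have [g g0 gG] : exists2 g, 0 < g & forall phi, g <= G phi 0 0.
  have cc : {within `[al, be], continuous (Gpol a b y0 al be)}.
    apply: derivable_within_continuous => z _.
    by have [l []] := dv_Gpol a b y0 al be z.
  have [c hc cm] := EVT_min (ltW ab) cc.
  exists (Gpol a b y0 al be c).
    by apply: (Gpol_gt0 a0 b0 ax rp); move: hc; rewrite in_itv /=; lra.
  by move=> phi; rewrite G0; apply: cm; rewrite in_itv /= umid_itv // ltW.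
have [r1 [r1p r1r cS]] := convergent_invsqrt r0 cG g0 gG.
have [r2 [r2p r2r cI2]] : exists r', [/\ 0 < r', r' <= r & convergent r' (fun phi h k => (U phi h k)^-1)].
  apply: (convergent_inv r0 cU al0) => phi; rewrite U0.
  by have /andP[] := umid_itv phi (ltW ab).
have [r3 [r3p r3r cI1]] : exists r', [/\ 0 < r', r' <= r & convergent r' (fun phi h k => (1 - U phi h k)^-1)].
  apply: (@convergent_inv _ r (fun phi h k => 1 - U phi h k) (1 - be) r0); last 2 first.
  - by rewrite subr_gt0.
  - by move=> phi; rewrite U0; have /andP[_ h] := umid_itv phi (ltW ab); rewrite lerD2l lerN2.
  - exact: convergent_sub rge (convergent_cst r 1) cU.
pose q := Num.min r1 (Num.min r2 r3).
have q0 : 0 < q by rewrite !lt_min r1p r2p r3p.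
have q1 : q <= r1 by rewrite /q ge_min lexx.
have q2 : q <= r2 by rewrite /q !ge_min lexx orbT.
have q3 : q <= r3 by rewrite /q !ge_min lexx !orbT.
have [M1 p1] := convergent_mul (ltW q0) (convergent_shrink (ltW q0) q3 cI1) (convergent_shrink (ltW q0) q1 cS).
have [M2 p2] := convergent_mul (ltW q0) (convergent_shrink (ltW q0) q2 cI2) (convergent_shrink (ltW q0) q1 cS).
exists q; eexists; eexists; split.
- exact: q0.
- eexists; exact: pser_prim (ltW q0) (pi_ge0 R) p1.
- eexists; exact: pser_prim (ltW q0) (pi_ge0 R) p2.
move=> phi h k hq kq.
have hr : `|h| <= r by apply: le_trans (le_trans q1 r1r).
have kr : `|k| <= r by apply: le_trans (le_trans q1 r1r).
have ad := adm phi h k hr kr; have rph := rpE phi h k hr kr.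
have rt := rootsE ad rph.
have AE p : AL p h k = AL phi h k /\ BE p h k = BE phi h k.
  exact: (root_pair_inj a0 b0 ad rph (rpE p h k hr kr)).
split => //.
- have [p0 pp p1' _ _] := rph; have [us [_ _ _ H]] := root_pair_sign a0 b0 ad rph.
  exists ((AL phi h k + BE phi h k) / 2); first by lra.
  by have [|h1 _ _] := H ((AL phi h k + BE phi h k) / 2); [lra|apply: h1; lra].
- rewrite /phase1 rt /=; congr (prim _ _); apply/funext => p.
  by rewrite /dens1 /G /U; have [-> ->] := AE p.
- rewrite /phase2 rt /=; congr (prim _ _); apply/funext => p.
  by rewrite /dens2 /G /U; have [-> ->] := AE p.
Qed.

End Phase.

(** * The metric and its geodesic equations *)

Section Directional.
Context {R : realType} {n : nat}.
Implicit Types (f : 'rV[R]_n -> R) (x v : 'rV[R]_n).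

Lemma derive_line f x v (l : R) : dv (fun t => f (t *: v + x)) 0 l -> is_derive x v f l.
Proof.
move=> [d1 d2].
have E : (fun h : R => h^-1 *: (f (h *: v + x) - f x)) =
  (fun h : R => h^-1 *: ((fun t => f (t *: v + x)) (h *: 1 + 0) - (fun t => f (t *: v + x)) 0)).
  apply/funext => h /=; rewrite scale0r add0r addr0.
  by rewrite /GRing.scale /= mulr1.
by split; [rewrite /derivable /= E; exact: d1|rewrite /derive /= E; exact: d2].
Qed.

Lemma partial_line (i : 'I_n) f x (l : R) :
  dv (fun t => f (t *: delta_mx 0 i + x)) 0 l -> partial i f x = l.
Proof. by move=> /derive_line []. Qed.

Lemma dv_coord_line x v (j : 'I_n) : dv (fun t => (t *: v + x) 0 j) 0 (v 0 j).
Proof.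
have -> : (fun t => (t *: v + x) 0 j) = (fun t => v 0 j * t + x 0 j).
  by apply/funext => t; rewrite !mxE mulrC.
by apply: dv_eq (dvD (dvZ _ (dv_id 0)) (dv_cst _ 0)) _; rewrite mulr1 addr0.
Qed.

Lemma coord_line0 x v (j : 'I_n) : (0 *: v + x) 0 j = x 0 j.
Proof. by rewrite scale0r add0r. Qed.

Lemma dv_comp_line (F : R -> R) x v (j : 'I_n) (l : R) : dv F (x 0 j) l ->
  dv (fun t => F ((t *: v + x) 0 j)) 0 (l * v 0 j).
Proof.
move=> dF; apply: (@dv_comp _ F (fun t => (t *: v + x) 0 j)); last exact: dv_coord_line.
by rewrite coord_line0.
Qed.

Lemma differentiable_comp_coord (F : R -> R) x (j : 'I_n) (l : R) : dv F (x 0 j) l ->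
  differentiable (fun y : 'rV[R]_n => F (y 0 j)) x.
Proof.
move=> [dF _]; apply: (@differentiable_comp _ _ _ _ (fun y : 'rV[R]_n => y 0 j) F).
  exact: differentiable_coord.
exact/derivable1_diffP.
Qed.

End Directional.

Lemma I3P (i : 'I_3) : [\/ i = 0, i = 1 | i = 2].
Proof.
by case: i => [[|[|[|//]]] Hi]; [constructor 1|constructor 2|constructor 3]; exact: val_inj.
Qed.

Section Metric.
Context {R : realType}.
Variables k1 k2 : nat.
Implicit Types (x v : 'rV[R]_3) (s : R).

Definition sphere_coord (j : nat) x : R :=
  [:: cos (x 0 0) * cos (x 0 1); cos (x 0 0) * sin (x 0 1);
      sin (x 0 0) * cos (x 0 2); sin (x 0 0) * sin (x 0 2)]`_j.

Definition dsphere_coord (j : nat) x v : R :=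
  [:: - sin (x 0 0) * v 0 0 * cos (x 0 1) + cos (x 0 0) * (- sin (x 0 1) * v 0 1);
      - sin (x 0 0) * v 0 0 * sin (x 0 1) + cos (x 0 0) * (cos (x 0 1) * v 0 1);
      cos (x 0 0) * v 0 0 * cos (x 0 2) + sin (x 0 0) * (- sin (x 0 2) * v 0 2);
      cos (x 0 0) * v 0 0 * sin (x 0 2) + sin (x 0 0) * (cos (x 0 2) * v 0 2)]`_j.

Lemma is_derive_sphere_coord (j : nat) x v : is_derive x v (sphere_coord j) (dsphere_coord j x v).
Proof.
apply: derive_line; rewrite /sphere_coord /dsphere_coord.
have P (F G : R -> R) (i k : 'I_3) (l m : R) : dv F (x 0 i) l -> dv G (x 0 k) m ->
    dv (fun t => F ((t *: v + x) 0 i) * G ((t *: v + x) 0 k)) 0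
       (l * v 0 i * G (x 0 k) + F (x 0 i) * (m * v 0 k)).
  move=> dF dG; apply: dv_eq (dvM (dv_comp_line v dF) (dv_comp_line v dG)) _.
  by rewrite !coord_line0.
case: j => [|[|[|[|j]]]] /=.
- exact: P (dv_cos _) (dv_cos _).
- exact: P (dv_cos _) (dv_sin _).
- exact: P (dv_sin _) (dv_cos _).
- exact: P (dv_sin _) (dv_sin _).
- by rewrite nth_nil; exact: dv_cst.
Qed.

Lemma differentiable_sphere_coord (j : nat) x : differentiable (sphere_coord j) x.
Proof.
rewrite /sphere_coord; case: j => [|[|[|[|j]]]] /=.
- by apply: differentiableM; apply: differentiable_comp_coord (dv_cos _).
- by apply: differentiableM; [apply: differentiable_comp_coord (dv_cos _)|apply: differentiable_comp_coord (dv_sin _)].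
- by apply: differentiableM; [apply: differentiable_comp_coord (dv_sin _)|apply: differentiable_comp_coord (dv_cos _)].
- by apply: differentiableM; apply: differentiable_comp_coord (dv_sin _).
- by rewrite nth_nil; exact: differentiable_cst.
Qed.

Lemma sphere_paramE x (j : 'I_4) : sphere_param x 0 j = sphere_coord j x.
Proof. by rewrite mxE. Qed.

Lemma differentiable_sphere_param x : differentiable (@sphere_param R) x.
Proof.
have -> : @sphere_param R = \sum_(j < 4) (fun y => sphere_coord j y *: (delta_mx 0 j : 'rV[R]_4)).
  apply/funext => y; rewrite fct_sumE [LHS]row_sum_delta; apply: eq_bigr => j _.
  by rewrite sphere_paramE.
apply: differentiable_sum => j; apply: differentiableZl.
exact: differentiable_sphere_coord.
Qed.

Lemma jacobian_sphere x (i : 'I_3) (j : 'I_4) :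
  ('J (@sphere_param R) x) i j = dsphere_coord j x (delta_mx 0 i).
Proof.
have df := differentiable_sphere_param x.
have := deriveEjacobian (delta_mx 0 i) df; rewrite -rowE => E.
have -> : ('J (@sphere_param R) x) i j = (row i ('J (@sphere_param R) x)) 0 j by rewrite [RHS]mxE.
rewrite -E derive_mx ?mxE; last exact: diff_derivable.
have -> : (fun t => sphere_param t 0 j) = sphere_coord j by apply/funext => t; exact: sphere_paramE.
by have [_ ->] := is_derive_sphere_coord j x (delta_mx 0 i).
Qed.

Definition gcoef (i : nat) s : R := rho k1 k2 s ^+ 2 * [:: 1; cos s ^+ 2; sin s ^+ 2]`_i.

Lemma round_metricE x (i j : 'I_3) :
  round_metric x i j = if i == j then [:: 1; cos (x 0 0) ^+ 2; sin (x 0 0) ^+ 2]`_i else 0.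
Proof.
have c0 := cos2Dsin2 (x 0 0); have c1 := cos2Dsin2 (x 0 1); have c2 := cos2Dsin2 (x 0 2).
rewrite /round_metric mxE.
under eq_bigr do rewrite [_^T _ _]mxE !jacobian_sphere.
rewrite !big_ord_recl big_ord0 /dsphere_coord /=.
have [->|->|->] := I3P i; have [->|->|->] := I3P j; rewrite ?eqxx /= !mxE /=.
all: rewrite ?mulr1 ?mulr0 ?add0r ?addr0 ?mulr1 ?mulr0.
all: move: c0 c1 c2; move: (cos (x 0 0)) (sin (x 0 0)) (cos (x 0 1)) (sin (x 0 1))
  (cos (x 0 2)) (sin (x 0 2)) => C0 S0 C1 S1 C2 S2 c0 c1 c2.
- transitivity (S0 ^+ 2 * (C1 ^+ 2 + S1 ^+ 2) + C0 ^+ 2 * (C2 ^+ 2 + S2 ^+ 2)); first by ring.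
  by rewrite c1 c2 !mulr1 addrC.
- by ring.
- by ring.
- by ring.
- transitivity (C0 ^+ 2 * (C1 ^+ 2 + S1 ^+ 2)); first by ring.
  by rewrite c1 mulr1.
- by ring.
- by ring.
- by ring.
- transitivity (S0 ^+ 2 * (C2 ^+ 2 + S2 ^+ 2)); first by ring.
  by rewrite c2 mulr1.
Qed.

Lemma gbarE x (i j : 'I_3) : gbar k1 k2 x i j = if i == j then gcoef i (x 0 0) else 0.
Proof.
rewrite /gbar mxE round_metricE /gcoef; case: eqP => // _; exact: mulr0.
Qed.

Lemma norm2_gbar (gamma : R -> 'rV[R]_3) t :
  norm2 (gbar k1 k2) gamma t = \sum_(i < 3) gcoef i (mag gamma t) * velocity gamma i t ^+ 2.
Proof.
rewrite /norm2; apply: eq_bigr => i _; rewrite (bigD1 i) //= big1 ?addr0.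
  by rewrite gbarE eqxx /mag /Defs.coord; ring.
by move=> j; rewrite gbarE eq_sym => /negbTE ->; rewrite !mul0r.
Qed.

Definition drho s : R := - (k1%:R * cos s ^+ k1.-1 * sin s) * sin s ^+ k2 +
  cos s ^+ k1 * (k2%:R * sin s ^+ k2.-1 * cos s).

Lemma dv_rho s : dv (rho k1 k2) s (drho s).
Proof.
apply: dv_eq (dvM (dvX k1 (dv_cos s)) (dvX k2 (dv_sin s))) _.
by rewrite /drho; ring.
Qed.

Definition dgcoef (i : nat) s : R := 2 * rho k1 k2 s * drho s * [:: 1; cos s ^+ 2; sin s ^+ 2]`_i +
  rho k1 k2 s ^+ 2 * [:: 0; - 2 * cos s * sin s; 2 * sin s * cos s]`_i.

Lemma dv_gcoef (i : nat) s : dv (gcoef i) s (dgcoef i s).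
Proof.
have d : dv (fun s => [:: 1; cos s ^+ 2; sin s ^+ 2]`_i) s [:: 0; - 2 * cos s * sin s; 2 * sin s * cos s]`_i.
  case: i => [|[|[|i]]] /=.
  - exact: dv_cst.
  - by apply: dv_eq (dvX 2 (dv_cos s)) _ => /=; ring.
  - by apply: dv_eq (dvX 2 (dv_sin s)) _ => /=; ring.
  - by rewrite !nth_nil; exact: dv_cst.
apply: dv_eq (dvM (dvX 2 (dv_rho s)) d) _.
by rewrite /dgcoef /=; ring.
Qed.

Lemma partial_gbar x (i j l : 'I_3) :
  partial l (fun y => gbar k1 k2 y i j) x = (l == 0)%:R * ((i == j)%:R * dgcoef i (x 0 0)).
Proof.
apply: partial_line; under eq_fun do rewrite gbarE.
case: eqP => _; last by rewrite mul0r mulr0; exact: dv_cst.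
rewrite mul1r; apply: dv_eq (dv_comp_line (delta_mx 0 l) (dv_gcoef i (x 0 0))) _.
by rewrite !mxE eqxx /= mulrC eq_sym.
Qed.

Lemma gcoef_gt0 (i : 'I_3) s : 0 < s < pi / 2 -> 0 < gcoef i s.
Proof.
move=> /andP[s0 s1].
have c0 : 0 < cos s by apply: cos_gt0_pihalf; rewrite s1 (lt_trans _ s0) // oppr_lt0 divr_gt0 ?pi_gt0.
have sn0 : 0 < sin s by apply: sin_gt0_pi; rewrite s0 (lt_trans s1) // ltr_pdivrMr // mulr_natr mulr2n ltrDl pi_gt0.
rewrite /gcoef mulr_gt0 ?exprn_gt0 // ?mulr_gt0 ?exprn_gt0 //.
by have [->|->|->] := I3P i; rewrite /= ?exprn_gt0.
Qed.

Lemma invmx_gbar x (i j : 'I_3) : 0 < x 0 0 < pi / 2 ->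
  invmx (gbar k1 k2 x) i j = (i == j)%:R * (gcoef i (x 0 0))^-1.
Proof.
move=> hs; pose B : 'M[R]_3 := \matrix_(i, j) ((i == j)%:R * (gcoef i (x 0 0))^-1).
have E : gbar k1 k2 x *m B = 1%:M.
  apply/matrixP => p q; rewrite !mxE (bigD1 p) //= big1 ?addr0.
    rewrite gbarE eqxx mxE; case: eqP => [->|_]; last by rewrite mul0r mulr0.
    by rewrite mul1r divff // gt_eqF // gcoef_gt0.
  by move=> m; rewrite gbarE eq_sym => /negbTE ->; rewrite mul0r.
have [gu _] := mulmx1_unit E.
have -> : invmx (gbar k1 k2 x) = B by rewrite -[LHS]mulmx1 -E mulKmx.
by rewrite mxE.
Qed.

Lemma christoffel_gbar x (k i j : 'I_3) : 0 < x 0 0 < pi / 2 ->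
  christoffel (gbar k1 k2) k i j x = 2^-1 * ((gcoef k (x 0 0))^-1 *
   ((i == 0)%:R * ((j == k)%:R * dgcoef j (x 0 0)) + (j == 0)%:R * ((i == k)%:R * dgcoef i (x 0 0))
    - (k == 0)%:R * ((i == j)%:R * dgcoef i (x 0 0)))).
Proof.
move=> hs; rewrite /christoffel (bigD1 k) //= big1 ?addr0.
  by rewrite invmx_gbar // eqxx mul1r !partial_gbar.
by move=> l lk; rewrite invmx_gbar // eq_sym (negbTE lk) !mul0r.
Qed.

(** The metric is diagonal and depends on s only, which leaves few Christoffel
    symbols: the geodesic equations are the three scalar equations below. *)
Lemma geodesic_gbar (gamma : R -> 'rV[R]_3) (acc : 'I_3 -> R -> R) :
  (forall t, 0 < mag gamma t < pi / 2) ->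
  (forall t i, dv (Defs.coord gamma i) t (velocity gamma i t)) ->
  (forall t i, dv (velocity gamma i) t (acc i t)) ->
  (forall t, let s := mag gamma t in
    2 * gcoef 0 s * acc 0 t + dgcoef 0 s * velocity gamma 0 t ^+ 2 =
    dgcoef 1 s * velocity gamma 1 t ^+ 2 + dgcoef 2 s * velocity gamma 2 t ^+ 2) ->
  (forall t, let s := mag gamma t in
    gcoef 1 s * acc 1 t + dgcoef 1 s * velocity gamma 0 t * velocity gamma 1 t = 0) ->
  (forall t, let s := mag gamma t in
    gcoef 2 s * acc 2 t + dgcoef 2 s * velocity gamma 0 t * velocity gamma 2 t = 0) ->
  geodesic (gbar k1 k2) gamma.
Proof.
move=> hs dc da e0 e1 e2 t k.
have [d1 _] := dc t k; have [d2 a2] := da t k.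
split; [exact: d1|exact: d2|rewrite derive1E a2].
under eq_bigr do under eq_bigr do rewrite christoffel_gbar ?hs //.
have g (i : 'I_3) := gcoef_gt0 i (hs t).
have n0 : gcoef 0 (gamma t 0 0) != 0 := lt0r_neq0 (g 0).
have n1 : gcoef 1 (gamma t 0 0) != 0 := lt0r_neq0 (g 1).
have n2 : gcoef 2 (gamma t 0 0) != 0 := lt0r_neq0 (g 2).
move: (e0 t) (e1 t) (e2 t) => /= {}e0 {}e1 {}e2.
rewrite !big_ord_recl !big_ord0.
have -> : lift ord0 ord0 = 1 :> 'I_3 by exact: val_inj.
have -> : lift ord0 (lift ord0 ord0) = 2 :> 'I_3 by exact: val_inj.
have -> : ord0 = 0 :> 'I_3 by exact: val_inj.
rewrite /mag /Defs.coord in e0 e1 e2.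
have [->|->|->] := I3P k; rewrite /=.
all: have E2 : ((1 %% 3 + 1 %% 3) %% 3)%N = 2%N by [].
all: have E1 : (1 %% 3)%N = 1%N by [].
all: rewrite ?E2 ?E1 {E1 E2}.
all: move: e0 e1 e2 n0 n1 n2 {g a2 d1 d2}.
all: move: (gcoef 0 _) (gcoef 1 _) (gcoef 2 _) (dgcoef 0 _) (dgcoef 1 _) (dgcoef 2 _).
all: move: (acc 0 t) (acc 1 t) (acc 2 t) (velocity gamma 0 t) (velocity gamma 1 t) (velocity gamma 2 t).
all: move=> A0 A1 A2 v0 v1 v2 g0 g1 g2 D0 D1 D2 e0 e1 e2 n0 n1 n2.
- have n20 : 2 * g0 != 0 by rewrite mulf_neq0 ?pnatr_eq0.
  apply: (mulfI n20); rewrite mulr0.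
  transitivity (2 * g0 * A0 + D0 * v0 ^+ 2 - (D1 * v1 ^+ 2 + D2 * v2 ^+ 2)); first by field.
  by rewrite e0 subrr.
- by apply: (mulfI n1); rewrite mulr0; transitivity (g1 * A1 + D1 * v0 * v1); first by field.
- by apply: (mulfI n2); rewrite mulr0; transitivity (g2 * A2 + D2 * v0 * v2); first by field.
Qed.
End Metric.

(** * Colatitude and half oscillations *)

Section InverseOfPrimitive.
Context {R : realType}.
Implicit Types (f g : R -> R).

Lemma prim_lt f (x y : R) : continuous f -> (forall z, 0 < f z) -> x < y -> prim f x < prim f y.
Proof.
move=> cf f0 xy; have d z := dv_prim z cf.
have [||c hc E] := @MVT _ (prim f) f x y xy.
- by move=> z _; exact: d.
- by apply: derivable_within_continuous => z _; have [] := d z.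
by rewrite -subr_gt0 E mulr_gt0 ?subr_gt0.
Qed.

Lemma prim_ge f (c x y : R) : continuous f -> (forall z, c <= f z) -> x <= y ->
  c * (y - x) <= prim f y - prim f x.
Proof.
move=> cf fc xy; have d z := dv_prim z cf.
have [||z hz ->] := @MVT_segment _ (prim f) f x y xy.
- by move=> z _; exact: d.
- by apply: derivable_within_continuous => z _; have [] := d z.
by rewrite ler_wpM2r ?subr_ge0.
Qed.

(** The primitive of a function bounded below by c > 0 is an increasing bijection
    of the line. *)
Lemma prim_inverse f (c : R) : continuous f -> 0 < c -> (forall z, c <= f z) ->
  exists g, [/\ forall t, prim f (g t) = t, forall x, g (prim f x) = x &
    forall t, dv g t (f (g t))^-1].
Proof.
move=> cf c0 fc; have f0 z : 0 < f z := lt_le_trans c0 (fc z).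
have d z := dv_prim z cf.
have inj x y : prim f x = prim f y -> x = y.
  move=> E; case: (ltgtP x y) => // h; have := prim_lt cf f0 h; by rewrite E ltxx.
have cp : continuous (prim f) by move=> z; exact: dv_continuous (d z).
have surj t : exists x, prim f x = t.
  pose B := `|t| / c + 1.
  have B0 : 0 < B by rewrite ltr_wpDl // divr_ge0 // ltW.
  have cB : `|t| <= c * B by rewrite mulrDr mulrCA divff ?gt_eqF // mulr1 mulr1 lerDl ltW.
  have h1 : t <= prim f B.
    have := prim_ge cf fc (ltW B0); rewrite prim0 // !subr0 => h.
    by apply: le_trans h; apply: le_trans cB; exact: ler_norm.
  have h2 : prim f (- B) <= t.
    have BN0 : - B <= 0 by lra.
    have := prim_ge cf fc BN0; rewrite prim0 // sub0r opprK => h.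
    by have := ler_normlW (_ : `|- t| <= c * B); rewrite normrN => /(_ cB); lra.
  have [|||x _ <-] := @IVT R (prim f) (- B) B t; last by exists x.
  - by lra.
  - exact: continuous_subspaceT.
  - by rewrite ge_min le_max h1 h2 orbT.
have [g gK] := choice surj.
have Kg x : g (prim f x) = x by apply: inj; rewrite gK.
exists g; split => // t; rewrite -[X in dv g X _](gK t).
apply: (@is_derive_inverse R (prim f) g (f (g t)) (g t)).
- by near=> x; exact: Kg.
- by near=> x; exact: cp.
- exact: d.
- by rewrite gt_eqF.
Unshelve. all: by end_near. Qed.

End InverseOfPrimitive.

Section Colatitude.
Context {R : realType}.
Implicit Types (u s : R).

(** acos is continuous up to the end points of its domain, being the inverse of
    cos on a segment. *)
Lemma continuous_acos_comp (h : R -> R) : continuous h -> (forall t, -1 <= h t <= 1) ->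
  continuous (fun t => acos (h t)).
Proof.
move=> ch hb.
have ca : {within `[(cos (pi : R)), cos (0 : R)], continuous (@acos R)}.
  apply: segment_can_ge_continuous; first exact: pi_ge0.
    by apply: continuous_subspaceT; exact: continuous_cos.
  by move=> x hx; apply: cosK.
rewrite cospi cos0 in ca; move/subspace_continuousP : ca => ca t.
have hB t' : [set` `[-1, 1]] (h t') by rewrite /= in_itv /= hb.
have := ca (h t) (hB t); apply: cvg_comp.
move=> P wP; have N : nbhs t (fun t' => [set` `[-1, 1]] (h t') -> P (h t')) := ch t _ wP.
by apply: filterS N => t' H; exact: H (hB t').
Qed.

(** The inverse of s |-> sin^2 s on [0, pi / 2]. *)
Definition colat u : R := acos (1 - 2 * u) / 2.

Lemma colat_itv u : 0 < u < 1 -> 0 < colat u < pi / 2.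
Proof.
move=> hu; rewrite /colat.
have h1 : 0 < acos (1 - 2 * u) by apply: acos_gt0; lra.
have h2 : acos (1 - 2 * u) < pi by apply: acos_ltpi; lra.
by apply/andP; split; lra.
Qed.

Lemma trig_pihalf s : 0 < s < pi / 2 -> 0 < cos s /\ 0 < sin s.
Proof.
move=> /andP[s0 s1]; split.
  by apply: cos_gt0_pihalf; rewrite s1 (lt_trans _ s0) // oppr_lt0 divr_gt0 ?pi_gt0.
by apply: sin_gt0_pi; rewrite s0 (lt_trans s1) // ltr_pdivrMr // mulr_natr mulr2n ltrDl pi_gt0.
Qed.

Lemma sin2_colat u : 0 <= u <= 1 -> sin (colat u) ^+ 2 = u.
Proof.
move=> hu; have := cos_mulr2n (colat u).
have -> : colat u *+ 2 = acos (1 - 2 * u) by rewrite /colat [LHS]mulr2n -splitr.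
rewrite acosK ?in_itv /=; last by lra.
by rewrite sin2cos2 mulr2n; lra.
Qed.

Lemma cos2_colat u : 0 <= u <= 1 -> cos (colat u) ^+ 2 = 1 - u.
Proof. by move=> hu; rewrite cos2sin2 sin2_colat. Qed.

Lemma dv_colat u : 0 < u < 1 -> dv colat u (2 * sin (colat u) * cos (colat u))^-1.
Proof.
move=> hu; have [c0 s0] := trig_pihalf (colat_itv hu).
have hx : -1 < 1 - 2 * u < 1 by lra.
have d1 : dv (@acos R) (1 - 2 * u) (- (Num.sqrt (1 - (1 - 2 * u) ^+ 2))^-1) by exact: is_derive1_acos.
have d2 : dv (fun v => 1 - 2 * v) u (- 2).
  by apply: dv_eq (dvB (dv_cst 1 u) (dvZ 2 (dv_id u))) _; ring.
have d := dvM (@dv_comp _ (@acos R) (fun v => 1 - 2 * v) u _ _ d1 d2) (dv_cst 2^-1 u).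
apply: dv_eq d _.
have -> : 1 - (1 - 2 * u) ^+ 2 = (2 * sin (colat u) * cos (colat u)) ^+ 2.
  by rewrite !exprMn sin2_colat ?cos2_colat; lra.
rewrite sqrtr_sqr gtr0_norm ?mulr_gt0 //.
by field; rewrite !gt_eqF.
Qed.

End Colatitude.

Section HalfCell.
Context {R : realType}.

(** Along a half oscillation the phase is a function of the magnitude alone: th
    minus the primitive of dens at phi has derivative 0 between the turning
    times, and is continuous at these times although acos is not differentiable
    there. *)
Lemma half_cell (al be sg c p q : R) (u th A dens : R -> R) : al < be -> p < q ->
  continuous u -> continuous th -> continuous dens -> (forall t, al <= u t <= be) ->
  (forall t, p < t < q -> al < u t < be) ->
  (forall t, p < t < q -> dv u t (sg * A t)) ->
  let phi t := acos (((al + be) / 2 - u t) / ((be - al) / 2)) in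
  (forall t, p < t < q -> dv th t (c * (dens (phi t) * A t / Num.sqrt ((u t - al) * (be - u t))))) ->
  sg * (th q - th p) = c * (prim dens (phi q) - prim dens (phi p)).
Proof.
move=> ab pq cu cth cd ub ub' du phi dth.
have r0 : 0 < (be - al) / 2 by lra.
pose v t := ((al + be) / 2 - u t) / ((be - al) / 2).
have cv : continuous v.
  move=> t; apply: cvgM; last exact: cvg_cst.
  by apply: cvgB; [exact: cvg_cst|exact: cu].
have vb t : -1 <= v t <= 1.
  by rewrite /v ler_pdivlMr // ler_pdivrMr //; have := ub t; lra.
have cphi : continuous phi := continuous_acos_comp cv vb.
pose f t := sg * th t - c * prim dens (phi t).
have cf : continuous f.
  move=> t; apply: cvgB; first by apply: cvgM; [exact: cvg_cst|exact: cth].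
  apply: cvgM; first exact: cvg_cst.
  by apply: (@continuous_comp _ _ _ phi (prim dens)); [exact: cphi|exact: dv_continuous (dv_prim _ cd)].
have df t : p < t < q -> dv f t 0.
  move=> ht; have hu := ub' t ht; have /andP[h1 h2] := hu.
  have hv : -1 < v t < 1 by rewrite /v ltr_pdivlMr // ltr_pdivrMr //; lra.
  have d1 : dv v t (- (sg * A t) / ((be - al) / 2)).
    apply: dv_eq (dvM (dvB (dv_cst ((al + be) / 2) t) (du t ht)) (dv_cst ((be - al) / 2)^-1 t)) _.
    by ring.
  have d2 : dv (@acos R) (v t) (- (Num.sqrt (1 - v t ^+ 2))^-1) by exact: is_derive1_acos.
  have d3 := dv_comp d2 d1.
  have d4 := @dv_comp _ (prim dens) phi t _ _ (dv_prim _ cd) d3.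
  apply: dv_eq (dvB (dvZ sg (dth t ht)) (dvZ c d4)) _.
  have w0 : 0 < (u t - al) * (be - u t) by rewrite mulr_gt0 ?subr_gt0.
  have -> : Num.sqrt (1 - v t ^+ 2) = Num.sqrt ((u t - al) * (be - u t)) / ((be - al) / 2).
    have -> : 1 - v t ^+ 2 = ((u t - al) * (be - u t)) * ((((be - al) / 2)^-1) ^+ 2).
      by rewrite /v; field; lra.
    by rewrite sqrtrM ?(ltW w0) // sqrtr_sqr gtr0_norm // invr_gt0.
  have s0 : Num.sqrt ((u t - al) * (be - u t)) != 0 by rewrite gt_eqF // sqrtr_gt0.
  by field; rewrite s0 /=; lra.
have [||z _] := @MVT_segment _ f (fun=> 0) p q (ltW pq).
- by move=> z; rewrite in_itv /= => hz; apply: df.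
- exact: continuous_subspaceT.
by rewrite mul0r /f; lra.
Qed.

End HalfCell.

(** * First integrals along a profile *)

Section ProfileRelations.
Context {R : realType}.
Variables k1 k2 : nat.
Implicit Types (gamma : R -> 'rV[R]_3) (C : 'rV[R]_2) (s u eps : R).

Local Notation Q := (Qpol k1.+1 k2.+1).
Local Notation rh := (rho k1 k2).

Lemma sqr1_neq0 eps : eps ^+ 2 = 1 -> eps != 0.
Proof. by move=> e1; have := oner_neq0 R; rewrite -e1 expf_eq0. Qed.

Lemma wgt_sin2 s : wgt k1.+1 k2.+1 (sin s ^+ 2) = rh s ^+ 2 * cos s ^+ 2 * sin s ^+ 2.
Proof.
rewrite /wgt /rho -cos2sin2 (exprS (cos s ^+ 2)) (exprS (sin s ^+ 2)).
by rewrite (exprAC _ 2 k1) (exprAC _ 2 k2); ring.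
Qed.

Lemma ell_sin2 (x : R) s : ell x (sin s ^+ 2) = sin s ^+ 2 + x * cos s ^+ 2.
Proof. by rewrite /ell -cos2sin2. Qed.

Lemma rho_gt0 s : 0 < s < pi / 2 -> 0 < rh s.
Proof. by move=> /trig_pihalf[c0 s0]; rewrite /rho mulr_gt0 ?exprn_gt0. Qed.

Lemma sin2_itv s : 0 < s < pi / 2 -> 0 < sin s ^+ 2 < 1.
Proof.
move=> /trig_pihalf[c0 s0]; rewrite exprn_gt0 //=.
have h : 0 < cos s ^+ 2 by rewrite exprn_gt0.
by have := cos2sin2 s; lra.
Qed.

Lemma sin2_lt s s' : 0 < s -> s < s' -> s' < pi / 2 -> sin s ^+ 2 < sin s' ^+ 2.
Proof.
move=> s0 ss s1.
have [_ h0] : 0 < cos s /\ 0 < sin s by apply: trig_pihalf; lra.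
rewrite ltr_pXn2r ?nnegrE ?(ltW h0) //; last first.
  by have [_ /ltW] : 0 < cos s' /\ 0 < sin s' by apply: trig_pihalf; lra.
by rewrite ltr_sin // in_itv /=; have := pi_gt0 R; lra.
Qed.

(** The parameters express the angular velocities through mu_1, and then the
    definition of C_2 becomes the equation of motion of u = sin^2 s. *)
Lemma profile_relation gamma C eps t : 0 < mag gamma t < pi / 2 -> eps != 0 ->
  has_parameters k1 k2 eps gamma C ->
  let s := mag gamma t in let m := mu1 k1 k2 gamma t in
  [/\ m != 0, m = eps * `|m|,
      velocity gamma 1 t = m / (rh s ^+ 2 * cos s ^+ 2),
      velocity gamma 2 t = C 0 0 * m / (rh s ^+ 2 * sin s ^+ 2) &
      m ^+ 2 * Q (C 0 0 ^+ 2) (C 0 1) (sin s ^+ 2) =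
        (rh s ^+ 2 * cos s * sin s * velocity gamma 0 t) ^+ 2].
Proof.
move=> hs e0 /(_ t) [he hC1 hC2] s m.
have [c0 sn0] := trig_pihalf hs; have r0 := rho_gt0 hs.
rewrite -/s in c0 sn0 r0; rewrite -/m in he hC1 hC2.
have m0 : m != 0 by apply: contra_neq e0 => E; rewrite -he E sgr0.
have v1 : velocity gamma 1 t = m / (rh s ^+ 2 * cos s ^+ 2).
  by rewrite /m /mu1 -/s; field; rewrite !gt_eqF.
have v2 : velocity gamma 2 t = C 0 0 * m / (rh s ^+ 2 * sin s ^+ 2).
  by rewrite hC1 /mu2 -/s; field; rewrite m0 !gt_eqF.
split => //; first by rewrite -he -numEsg.
have E : C 0 1 * m ^+ 2 = rh s ^+ 2 * velocity gamma 0 t ^+ 2 + m ^+ 2 / (rh s ^+ 2 * cos s ^+ 2)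
    + C 0 0 ^+ 2 * m ^+ 2 / (rh s ^+ 2 * sin s ^+ 2).
  rewrite hC2 divfK ?expf_neq0 // /energy mulrA divff ?pnatr_eq0 // mul1r norm2_gbar.
  rewrite !big_ord_recl big_ord0.
  have -> : lift ord0 ord0 = 1 :> 'I_3 by exact: val_inj.
  have -> : lift ord0 (lift ord0 ord0) = 2 :> 'I_3 by exact: val_inj.
  have -> : ord0 = 0 :> 'I_3 by exact: val_inj.
  rewrite v1 v2 /gcoef -/s /=; field; rewrite !gt_eqF //.
rewrite /Qpol wgt_sin2 ell_sin2.
transitivity (C 0 1 * m ^+ 2 * (rh s ^+ 2 * cos s ^+ 2 * sin s ^+ 2)
   - m ^+ 2 * (sin s ^+ 2 + C 0 0 ^+ 2 * cos s ^+ 2)); first by ring.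
by rewrite E; field; rewrite !gt_eqF.
Qed.

End ProfileRelations.

(** * Phase increments over a cell *)

Section CellPhase.
Context {R : realType}.
Variables k1 k2 : nat.
Implicit Types (gamma : R -> 'rV[R]_3) (C : 'rV[R]_2) (s u eps : R).

Local Notation Q := (Qpol k1.+1 k2.+1).
Local Notation rh := (rho k1 k2).

Lemma cell_bounds gamma sm sp t0 t2 t : sm < sp -> complete_cell gamma sm sp t0 t2 -> t0 <= t <= t2 ->
  sm <= mag gamma t <= sp.
Proof.
move=> smsp [t1 [/andP[t01 t12] [<- <- E2] h1 h2]] /andP[t0t tt2].
have H1 x y : t0 <= x -> x <= y -> y <= t1 -> mag gamma x <= mag gamma y.
  move=> x0 xy y1; move: xy; rewrite le_eqVlt => /predU1P[->|xy]; first exact: lexx.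
  by apply/ltW/h1; rewrite ?in_itv /=; lra.
have H2 x y : t1 <= x -> x <= y -> y <= t2 -> mag gamma y <= mag gamma x.
  move=> x0 xy y1; move: xy; rewrite le_eqVlt => /predU1P[->|xy]; first exact: lexx.
  by apply/ltW/h2; rewrite ?in_itv /=; lra.
case: (leP t t1) => h; first by rewrite !H1 //; lra.
by rewrite -{1}E2 !H2 //; lra.
Qed.

Lemma oscillates_bounds gamma sm sp t : oscillates gamma sm sp -> sm <= mag gamma t <= sp.
Proof. by move=> [_ smsp _ /(_ t) [t0 [t2 [ht cc]]]]; exact: cell_bounds smsp cc ht. Qed.

Lemma dv_mag gamma t : profile k1 k2 gamma -> dv (mag gamma) t (velocity gamma 0 t).
Proof. by move=> [_ /(_ t 0) [d _ _]]; split; [exact: d|rewrite /velocity derive1E]. Qed.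

Lemma dv_coord gamma t (i : 'I_3) : profile k1 k2 gamma -> dv (fun t => gamma t 0 i) t (velocity gamma i t).
Proof. by move=> [_ /(_ t i) [d _ _]]; split; [exact: d|rewrite /velocity derive1E]. Qed.

Lemma umid_acos (al be u : R) : al < be -> al <= u <= be ->
  umid al be (acos (((al + be) / 2 - u) / ((be - al) / 2))) = u.
Proof.
move=> ab hu; have r0 : 0 < (be - al) / 2 by lra.
rewrite /umid acosK; first by field; lra.
by rewrite in_itv /= ler_pdivlMr // ler_pdivrMr //; lra.
Qed.

(** At a turning time the magnitude is extremal among all times, so its velocity
    vanishes, and Q with it. *)
Lemma turning_root_pair gamma C eps sm sp t0 t2 : eps != 0 -> profile k1 k2 gamma ->
  oscillates gamma sm sp -> has_parameters k1 k2 eps gamma C ->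
  complete_cell gamma sm sp t0 t2 ->
  root_pair k1.+1 k2.+1 (C 0 0 ^+ 2) (C 0 1) (sin sm ^+ 2) (sin sp ^+ 2).
Proof.
move=> e0 pr os hp [t1 [/andP[t01 t12] [E0 E1 E2] h1 h2]].
have [sm0 smsp spp _] := os.
have stat t : (forall t', mag gamma t <= mag gamma t') \/ (forall t', mag gamma t' <= mag gamma t) ->
    Q (C 0 0 ^+ 2) (C 0 1) (sin (mag gamma t) ^+ 2) = 0.
  move=> ext; have v0 : velocity gamma 0 t = 0.
    apply: dv_unique (dv_mag t pr) _.
    have dd : forall z, z \in `]t - 1, t + 1[ -> derivable (mag gamma) z 1.
      by move=> z _; have [] := dv_mag z pr.
    have tt : t \in `]t - 1, t + 1[ by rewrite in_itv /=; lra.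
    have l : t - 1 <= t + 1 by lra.
    by case: ext => ext; [apply: (derive1_at_min l dd tt)|apply: (derive1_at_max l dd tt)] => z _.
  have [m0 _ _ _] := profile_relation (pr.1 t) e0 hp.
  rewrite v0 mulr0 expr0n /= => /eqP; rewrite mulf_eq0 expf_eq0 /= (negbTE m0) /=.
  by move/eqP.
have bd t := oscillates_bounds t os.
have al1 := sin2_itv (_ : 0 < sm < pi / 2); have be1 := sin2_itv (_ : 0 < sp < pi / 2).
have hsm : 0 < sm < pi / 2 by lra. have hsp : 0 < sp < pi / 2 by lra.
have /andP[? ?] := al1 hsm; have /andP[? ?] := be1 hsp.
split => //.
- exact: sin2_lt.
- by rewrite -{1}E0; apply: stat; left => t'; rewrite E0; have /andP[] := bd t'.
- by rewrite -{1}E1; apply: stat; right => t'; rewrite E1; have /andP[] := bd t'.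
Qed.

(** The velocity of u is a multiple of the square root of Q, that is of the square
    roots of (u - al)(be - u) and of G, with the sign of the half cell. *)
Lemma half_cell_phase gamma C eps al be sg p q (i : 'I_3) (dens : R -> R) c0 : 
  eps != 0 -> profile k1 k2 gamma -> has_parameters k1 k2 eps gamma C ->
  admissible k2.+1 (C 0 0 ^+ 2) -> root_pair k1.+1 k2.+1 (C 0 0 ^+ 2) (C 0 1) al be ->
  sg ^+ 2 = 1 -> p < q ->
  (forall t, al <= sin (mag gamma t) ^+ 2 <= be) ->
  (forall t, p < t < q -> al < sin (mag gamma t) ^+ 2 < be) ->
  (forall t, p < t < q -> 0 <= sg * velocity gamma 0 t) ->
  continuous dens ->
  (forall t, p < t < q -> velocity gamma i t = c0 * dens (acos (((al + be) / 2 - sin (mag gamma t) ^+ 2) / ((be - al) / 2)))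
     * (`|mu1 k1 k2 gamma t| * Num.sqrt (Gpol k1.+1 k2.+1 (C 0 1) al be (sin (mag gamma t) ^+ 2)) / rh (mag gamma t) ^+ 2)) ->
  let phi t := acos (((al + be) / 2 - sin (mag gamma t) ^+ 2) / ((be - al) / 2)) in
  sg * (gamma q 0 i - gamma p 0 i) = c0 / 2 * (prim dens (phi q) - prim dens (phi p)).
Proof.
move=> e0 pr hp ax rp sg1 pq ub ub' sv cd vi phi.
have [al0 ab be1 _ _] := rp.
pose u t := sin (mag gamma t) ^+ 2.
have du t : dv u t (2 * sin (mag gamma t) * cos (mag gamma t) * velocity gamma 0 t).
  apply: dv_eq (dvX 2 (@dv_comp _ (@sin R) (mag gamma) t _ _ (dv_sin _) (dv_mag t pr))) _.
  by rewrite /=; ring.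
have dg t := dv_coord t i pr.
pose A t := 2 * sin (mag gamma t) * cos (mag gamma t) * (sg * velocity gamma 0 t).
apply: (@half_cell R al be sg (c0 / 2) p q u (fun t => gamma t 0 i) A dens ab pq) => //.
- by move=> t; exact: dv_continuous (du t).
- by move=> t; exact: dv_continuous (dg t).
- move=> t _; apply: dv_eq (du t) _; rewrite /A.
  have -> : sg * (2 * sin (mag gamma t) * cos (mag gamma t) * (sg * velocity gamma 0 t)) =
    sg ^+ 2 * (2 * sin (mag gamma t) * cos (mag gamma t) * velocity gamma 0 t) by ring.
  by rewrite sg1 mul1r.
move=> t ht; apply: dv_eq (dg t) _; rewrite (vi t ht) -/(u t).
set d := dens _; set m := mu1 _ _ _ _.
have hs := pr.1 t; have [cs0 sn0] := trig_pihalf hs; have r0 := rho_gt0 k1 k2 hs.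
have hu := ub' t ht.
have w0 : 0 < (u t - al) * (be - u t) by rewrite mulr_gt0 ?subr_gt0 /u; lra.
have g0 : 0 < Gpol k1.+1 k2.+1 (C 0 1) al be (u t).
  by apply: (Gpol_gt0 (isT : (0 < k1.+1)%N) (isT : (0 < k2.+1)%N) ax rp); exact: sin2_itv.
have sw0 : 0 < Num.sqrt ((u t - al) * (be - u t)) by rewrite sqrtr_gt0.
suff E : A t * rh (mag gamma t) ^+ 2 =
    2 * `|m| * (Num.sqrt ((u t - al) * (be - u t)) * Num.sqrt (Gpol k1.+1 k2.+1 (C 0 1) al be (u t))).
  have -> : A t = 2 * `|m| * (Num.sqrt ((u t - al) * (be - u t)) *
     Num.sqrt (Gpol k1.+1 k2.+1 (C 0 1) al be (u t))) / rh (mag gamma t) ^+ 2.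
    by rewrite -E mulfK // expf_neq0 // gt_eqF.
  by field; rewrite !gt_eqF.
have A0 : 0 <= A t * rh (mag gamma t) ^+ 2.
  apply: mulr_ge0; last exact: sqr_ge0.
  by apply: mulr_ge0; [rewrite !mulr_ge0 // ltW|exact: sv].
rewrite -sqrtrM ?(ltW w0) // -(Gpol_factor _ rp).
have [m0 _ _ _] := profile_relation hs e0 hp; rewrite -/m -/(u t) => EQ.
have Q0 : 0 <= Q (C 0 0 ^+ 2) (C 0 1) (u t) by rewrite (Gpol_factor _ rp) mulr_ge0 // ltW.
have B0 : 0 <= 2 * `|m| * Num.sqrt (Q (C 0 0 ^+ 2) (C 0 1) (u t)) by rewrite !mulr_ge0 ?sqrtr_ge0.
apply/eqP; rewrite -(eqrXn2 (isT : (0 < 2)%N) A0 B0).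
apply/eqP; rewrite [RHS]exprMn [X in _ = X * _]exprMn sqr_sqrtr // real_normK ?num_real //.
transitivity (4 * (m ^+ 2 * Q (C 0 0 ^+ 2) (C 0 1) (u t))); last by ring.
rewrite EQ /A; transitivity (4 * sg ^+ 2 * (rh (mag gamma t) ^+ 2 * cos (mag gamma t) * sin (mag gamma t) * velocity gamma 0 t) ^+ 2); first by ring.
by rewrite sg1 mulr1.
Qed.

(** Each half of the cell contributes half of the integral, since the velocity of
    u and the increment of phi change sign together. *)
Lemma cell_phase_increment gamma C eps sm sp t0 t2 : eps != 0 -> profile k1 k2 gamma ->
  oscillates gamma sm sp -> has_parameters k1 k2 eps gamma C ->
  complete_cell gamma sm sp t0 t2 -> admissible k2.+1 (C 0 0 ^+ 2) ->
  gamma t2 0 1 - gamma t0 0 1 = eps * phase1 k1.+1 k2.+1 (C 0 0 ^+ 2) (C 0 1) /\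
  gamma t2 0 2 - gamma t0 0 2 = eps * (C 0 0 * phase2 k1.+1 k2.+1 (C 0 0 ^+ 2) (C 0 1)).
Proof.
move=> e0 pr os hp cc ax; have rp := turning_root_pair e0 pr os hp cc.
have [t1 [/andP[t01 t12] [E0 E1 E2] h1 h2]] := cc; have [sm0 smsp spp _] := os.
have bd t := oscillates_bounds t os.
set al := sin sm ^+ 2 in rp; set be := sin sp ^+ 2 in rp.
have [al0 ab be1 _ _] := rp.
have sin2_le s s' : 0 < s -> s <= s' -> s' < pi / 2 -> sin s ^+ 2 <= sin s' ^+ 2.
  move=> s0; rewrite le_eqVlt => /predU1P[->|ss] s1; first exact: lexx.
  by apply/ltW/sin2_lt.
have ub t : al <= sin (mag gamma t) ^+ 2 <= be.
  by have := bd t; rewrite /al /be => /andP[? ?]; rewrite !sin2_le //; lra.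
have ubs t : sm < mag gamma t < sp -> al < sin (mag gamma t) ^+ 2 < be.
  by move=> /andP[? ?]; rewrite /al /be !sin2_lt //; lra.
have ub1 t : t0 < t < t1 -> al < sin (mag gamma t) ^+ 2 < be.
  by move=> ht; apply: ubs; rewrite -E0 -E1 !h1 // ?in_itv /=; lra.
have ub2 t : t1 < t < t2 -> al < sin (mag gamma t) ^+ 2 < be.
  by move=> ht; apply: ubs; rewrite -E2 -E1 !h2 // ?in_itv /=; lra.
have v1 t : t0 < t < t1 -> 0 <= 1 * velocity gamma 0 t.
  move=> ht; rewrite mul1r.
  have := @incr_derive1_ge0_itv R (mag gamma) true false t0 t1 t _ h1.
  rewrite in_itv /=; apply => //.
  by move=> z _; have [] := dv_mag z pr.
have v2 t : t1 < t < t2 -> 0 <= (-1) * velocity gamma 0 t.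
  move=> ht; rewrite mulN1r oppr_ge0.
  have := @decr_derive1_le0_itv R (mag gamma) true false t1 t2 t _ _.
  rewrite in_itv /=; apply => //.
    by move=> z _; have [] := dv_mag z pr.
  by move=> y x hy hx xy; apply: h2.
have a0 : (0 < k1.+1)%N by []. have b0 : (0 < k2.+1)%N by [].
have umE t := umid_acos ab (ub t).
have vi1 t : velocity gamma 1 t = eps * dens1 k1.+1 k2.+1 (C 0 1) al be
    (acos (((al + be) / 2 - sin (mag gamma t) ^+ 2) / ((be - al) / 2))) *
    (`|mu1 k1 k2 gamma t| * Num.sqrt (Gpol k1.+1 k2.+1 (C 0 1) al be (sin (mag gamma t) ^+ 2)) / rh (mag gamma t) ^+ 2).
  have hs := pr.1 t; have [c0 s0] := trig_pihalf hs; have r0 := rho_gt0 k1 k2 hs.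
  have [m0 mE -> _ _] := profile_relation hs e0 hp.
  have g0 : 0 < Gpol k1.+1 k2.+1 (C 0 1) al be (sin (mag gamma t) ^+ 2).
    by apply: (Gpol_gt0 a0 b0 ax rp); exact: sin2_itv.
  have sg0 : Num.sqrt (Gpol k1.+1 k2.+1 (C 0 1) al be (sin (mag gamma t) ^+ 2)) != 0 by rewrite gt_eqF // sqrtr_gt0.
  rewrite {1}mE /dens1 umE -cos2sin2; field.
  by rewrite sg0 !gt_eqF.
have vi2 t : velocity gamma 2 t = (eps * C 0 0) * dens2 k1.+1 k2.+1 (C 0 1) al be
    (acos (((al + be) / 2 - sin (mag gamma t) ^+ 2) / ((be - al) / 2))) *
    (`|mu1 k1 k2 gamma t| * Num.sqrt (Gpol k1.+1 k2.+1 (C 0 1) al be (sin (mag gamma t) ^+ 2)) / rh (mag gamma t) ^+ 2).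
  have hs := pr.1 t; have [c0 s0] := trig_pihalf hs; have r0 := rho_gt0 k1 k2 hs.
  have [m0 mE _ -> _] := profile_relation hs e0 hp.
  have g0 : 0 < Gpol k1.+1 k2.+1 (C 0 1) al be (sin (mag gamma t) ^+ 2).
    by apply: (Gpol_gt0 a0 b0 ax rp); exact: sin2_itv.
  have sg0 : Num.sqrt (Gpol k1.+1 k2.+1 (C 0 1) al be (sin (mag gamma t) ^+ 2)) != 0 by rewrite gt_eqF // sqrtr_gt0.
  rewrite {1}mE /dens2 umE; field.
  by rewrite sg0 !gt_eqF.
have r2 : be - al != 0 by rewrite gt_eqF // subr_gt0.
have p0 : acos (((al + be) / 2 - sin (mag gamma t0) ^+ 2) / ((be - al) / 2)) = 0.
  by rewrite E0 -/al -[RHS]acos1; congr (acos _); field; rewrite r2.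
have p1 : acos (((al + be) / 2 - sin (mag gamma t1) ^+ 2) / ((be - al) / 2)) = pi.
  by rewrite E1 -/be -[RHS]acosN1; congr (acos _); field; rewrite r2.
have p2 : acos (((al + be) / 2 - sin (mag gamma t2) ^+ 2) / ((be - al) / 2)) = 0.
  by rewrite E2 -/al -[RHS]acos1; congr (acos _); field; rewrite r2.
have cd1 : continuous (dens1 k1.+1 k2.+1 (C 0 1) al be) := continuous_dens1 a0 b0 ax rp.
have cd2 : continuous (dens2 k1.+1 k2.+1 (C 0 1) al be) := continuous_dens2 a0 b0 ax rp.
have sq1 : (1 : R) ^+ 2 = 1 by rewrite expr1n.
have sqN : (- 1 : R) ^+ 2 = 1 by rewrite sqrrN expr1n.
have A1 := half_cell_phase e0 pr hp ax rp sq1 t01 ub ub1 v1 cd1 (fun t _ => vi1 t).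
have A2 := half_cell_phase e0 pr hp ax rp sqN t12 ub ub2 v2 cd1 (fun t _ => vi1 t).
have B1 := half_cell_phase e0 pr hp ax rp sq1 t01 ub ub1 v1 cd2 (fun t _ => vi2 t).
have B2 := half_cell_phase e0 pr hp ax rp sqN t12 ub ub2 v2 cd2 (fun t _ => vi2 t).
rewrite /= p0 p1 prim0 // subr0 in A1; rewrite /= p1 p2 prim0 // in A2.
rewrite /= p0 p1 prim0 // subr0 in B1; rewrite /= p1 p2 prim0 // in B2.
have rt := rootsE a0 b0 ax rp.
rewrite /phase1 /phase2 rt /=.
set P1 := prim _ _ in A1 A2 *; set P2 := prim _ _ in B1 B2 *.
split; last by rewrite mulrA; lra.
by lra.
Qed.

End CellPhase.

(** * Existence of oscillating profiles *)

Section Existence.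
Context {R : realType}.
Variables k1 k2 : nat.
Implicit Types (s u t phi : R).

Local Notation Q := (Qpol k1.+1 k2.+1).
Local Notation rh := (rho k1 k2).
Local Notation drh := (drho k1 k2).

Lemma cosD2pi_int phi (z : int) : cos (phi + (pi *+ 2) *~ z) = cos phi.
Proof.
case: z => n; first exact: (periodicn (@cosD2pi R)).
by rewrite -[LHS](periodicn (@cosD2pi R) n.+1) NegzE mulrNz subrK.
Qed.

(** Differentiate both sides of [wgt_sin2]. *)
Lemma dwgt_sin2 s : 0 < s < pi / 2 ->
  dwgt k1.+1 k2.+1 (sin s ^+ 2) = rh s * drh s * cos s * sin s + rh s ^+ 2 * (cos s ^+ 2 - sin s ^+ 2).
Proof.
move=> hs; have [c0 s0] := trig_pihalf hs.
have d1 := @dv_comp _ _ (fun s => sin s ^+ 2) s _ _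
  (dv_wgt (isT : (0 < k1.+1)%N) (isT : (0 < k2.+1)%N) (sin s ^+ 2)) (dvX 2 (dv_sin s)).
have d2 := dvM (dvM (dvX 2 (dv_rho k1 k2 s)) (dvX 2 (dv_cos s))) (dvX 2 (dv_sin s)).
have d2' : dv (fun s => wgt k1.+1 k2.+1 (sin s ^+ 2)) s (((2%:R * rh s ^+ 1 * drh s) * cos s ^+ 2 + rh s ^+ 2 * (2%:R * cos s ^+ 1 * - sin s)) * sin s ^+ 2 + (rh s ^+ 2 * cos s ^+ 2) * (2%:R * sin s ^+ 1 * cos s)).
  by apply: dv_near d2; apply: (@nearW _ (nbhs s)) => z; rewrite wgt_sin2.
have E := dv_unique d1 d2'.
have n0 : 2 * sin s * cos s != 0 by rewrite !mulf_neq0 ?gt_eqF.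
by apply: (mulIf n0); move: E => /=; rewrite !expr1 => E; lra.
Qed.

Lemma colat_lt u u' : 0 < u -> u < u' -> u' < 1 -> colat u < colat u'.
Proof.
move=> u0 uu u1; have h : 0 < u < 1 by lra. have h' : 0 < u' < 1 by lra.
rewrite ltNge le_eqVlt; apply/negP => /predU1P[E|L].
  have : sin (colat u) ^+ 2 = sin (colat u') ^+ 2 by rewrite E.
  by rewrite !sin2_colat; lra.
have /andP[a1 a2] := colat_itv h; have /andP[b1 b2] := colat_itv h'.
by have := sin2_lt b1 L a2; rewrite !sin2_colat; lra.
Qed.

(** The radial geodesic equation, once V^2 is replaced by its value from the
    energy, is a rational identity in r, c and s. *)
Lemma radial_identity (r dr c s C1 C2 e V : R) : r != 0 -> c != 0 -> s != 0 -> e ^+ 2 = 1 ->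
  V ^+ 2 = (C2 * (r ^+ 2 * c ^+ 2 * s ^+ 2) - (s ^+ 2 + C1 ^+ 2 * c ^+ 2)) / (r ^+ 2 * s * c) ^+ 2 ->
  2 * r ^+ 2 * ((C2 * (r * dr * c * s + r ^+ 2 * (c ^+ 2 - s ^+ 2)) - (1 - C1 ^+ 2)) / (r ^+ 2 * (r ^+ 2 * s * c))
      - V ^+ 2 * (2 * r * dr * s * c + r ^+ 2 * (c ^+ 2 - s ^+ 2)) / (r ^+ 2 * s * c)) + 2 * r * dr * V ^+ 2 =
  (2 * r * dr * c ^+ 2 - 2 * r ^+ 2 * c * s) * (e / (r ^+ 2 * c ^+ 2)) ^+ 2 +
  (2 * r * dr * s ^+ 2 + 2 * r ^+ 2 * s * c) * (e * C1 / (r ^+ 2 * s ^+ 2)) ^+ 2.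
Proof.
move=> r0 c0 s0 e1 ->.
transitivity (e ^+ 2 * ((2 * r * dr * c ^+ 2 - 2 * r ^+ 2 * c * s) / (r ^+ 2 * c ^+ 2) ^+ 2 +
  (2 * r * dr * s ^+ 2 + 2 * r ^+ 2 * s * c) * C1 ^+ 2 / (r ^+ 2 * s ^+ 2) ^+ 2)).
  by rewrite e1; field; rewrite r0 c0 s0.
by field; rewrite r0 c0 s0.
Qed.

Variables (C : 'rV[R]_2) (eps al be : R).
Hypotheses (eps1 : eps ^+ 2 = 1) (C1n0 : C 0 0 != 0).
Hypothesis rp : root_pair k1.+1 k2.+1 (C 0 0 ^+ 2) (C 0 1) al be.

Local Notation Gp := (Gpol k1.+1 k2.+1 (C 0 1) al be).
Local Notation um := (umid al be).

Let a0 : (0 < k1.+1)%N := isT.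
Let b0 : (0 < k2.+1)%N := isT.

Let ax : admissible k2.+1 (C 0 0 ^+ 2).
Proof. by left; rewrite exprn_even_gt0. Qed.

Let um01 phi : 0 < um phi < 1. Proof. exact: umid01 rp. Qed.
Let ab : al < be. Proof. by case: rp. Qed.

(** The derivative of the time with respect to phi when |mu_1| = 1. *)
Definition slowness phi : R := rh (colat (um phi)) ^+ 2 / (2 * Num.sqrt (Gp (um phi))).

Lemma slowness_bound : continuous slowness /\ exists2 c, 0 < c & forall phi, c <= slowness phi.
Proof.
pose f u := rh (colat u) ^+ 2 / (2 * Num.sqrt (Gp u)).
have G0 u : 0 < u < 1 -> 0 < Gp u by move=> hu; exact: (Gpol_gt0 a0 b0 ax rp).
have df u : 0 < u < 1 -> exists l, dv f u l.
  move=> hu; have g0 := G0 u hu.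
  have [l dl] := dv_Gpol k1.+1 k2.+1 (C 0 1) al be u.
  eexists; apply: dvM.
    exact: (dvX 2 (dv_comp (dv_rho k1 k2 (colat u)) (dv_colat hu))).
  apply: dvV; first by rewrite gt_eqF // mulr_gt0 // sqrtr_gt0.
  exact: (dvZ 2 (@dv_comp _ (@Num.sqrt R) Gp u _ _ (dv_sqrt g0) dl)).
split.
  move=> phi; have [l dl] := df (um phi) (um01 phi).
  exact: (dv_continuous (@dv_comp _ f um phi _ _ dl (dv_umid al be phi))).
have cf : {within `[al, be], continuous f}.
  apply: derivable_within_continuous => u; rewrite in_itv /= => hu.
  have [al0 _ be1 _ _] := rp.
  by have [|l []] := df u; first lra.
have [c hc cm] := EVT_min (ltW ab) cf.
have hc01 : 0 < c < 1 by have [al0 _ be1 _ _] := rp; move: hc; rewrite in_itv /=; lra.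
exists (f c).
  have rc := rho_gt0 k1 k2 (colat_itv hc01).
  by rewrite /f divr_gt0 ?exprn_gt0 // mulr_gt0 // sqrtr_gt0 G0.
by move=> phi; apply: cm; rewrite in_itv /= umid_itv // ltW.
Qed.

(** Time is a primitive of the slowness in the angle phi, hence a bijection of the
    line; its inverse yields an oscillation of the magnitude for all times, and
    the phases are obtained by integration. *)
Lemma profile_exists : exists gamma sm sp t0 t2,
  [/\ profile k1 k2 gamma /\ oscillates gamma sm sp, doubly_spiral k1 k2 gamma,
      has_parameters k1 k2 eps gamma C & complete_cell gamma sm sp t0 t2].
Proof.
have [cs [c c0 cc]] := slowness_bound.
have [ph [phK Kph dph]] := prim_inverse cs c0 cc.
have cd1 : continuous (dens1 k1.+1 k2.+1 (C 0 1) al be) := continuous_dens1 a0 b0 ax rp.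
have cd2 : continuous (dens2 k1.+1 k2.+1 (C 0 1) al be) := continuous_dens2 a0 b0 ax rp.
pose S t := colat (um (ph t)).
have hS t : 0 < S t < pi / 2 by exact: colat_itv.
have trg t := trig_pihalf (hS t).
have r0 t : 0 < rh (S t) := rho_gt0 k1 k2 (hS t).
have sS t : sin (S t) ^+ 2 = um (ph t) by apply: sin2_colat; have := um01 (ph t); lra.
have cS t : cos (S t) ^+ 2 = 1 - um (ph t) by apply: cos2_colat; have := um01 (ph t); lra.
have G0 t : 0 < Gp (um (ph t)) by apply: (Gpol_gt0 a0 b0 ax rp).
have sG t : 0 < Num.sqrt (Gp (um (ph t))) by rewrite sqrtr_gt0.
have sl t : (slowness (ph t))^-1 = 2 * Num.sqrt (Gp (um (ph t))) / rh (S t) ^+ 2.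
  by rewrite /slowness invf_div.
pose D s := rh s ^+ 2 * sin s * cos s.
have D0 t : 0 < D (S t) by have [? ?] := trg t; rewrite /D !mulr_gt0 ?exprn_gt0.
pose N phi := (be - al) / 2 * sin phi * Num.sqrt (Gp (um phi)).
pose V t := N (ph t) / D (S t).
have dU t : dv (fun t => um (ph t)) t ((be - al) / 2 * sin (ph t) * (slowness (ph t))^-1).
  exact: dv_comp (dv_umid al be (ph t)) (dph t).
have dS t : dv S t (V t).
  apply: dv_eq (@dv_comp _ (@colat R) (fun t => um (ph t)) t _ _ (dv_colat (um01 (ph t))) (dU t)) _.
  rewrite sl /V /N /D -/(S t); have [? ?] := trg t.
  by field; rewrite !gt_eqF.
pose m1 := eps. pose m2 := eps * C 0 0.
pose th1 t := eps / 2 * prim (dens1 k1.+1 k2.+1 (C 0 1) al be) (ph t).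
pose th2 t := eps * C 0 0 / 2 * prim (dens2 k1.+1 k2.+1 (C 0 1) al be) (ph t).
have d1 t : dv th1 t (eps / (rh (S t) ^+ 2 * cos (S t) ^+ 2)).
  apply: dv_eq (dvZ (eps / 2) (@dv_comp _ _ ph t _ _ (dv_prim (ph t) cd1) (dph t))) _.
  rewrite sl /dens1 cS; have /andP[? ?] := um01 (ph t).
  by field; rewrite !gt_eqF ?subr_gt0.
have d2 t : dv th2 t (eps * C 0 0 / (rh (S t) ^+ 2 * sin (S t) ^+ 2)).
  apply: dv_eq (dvZ (eps * C 0 0 / 2) (@dv_comp _ _ ph t _ _ (dv_prim (ph t) cd2) (dph t))) _.
  rewrite sl /dens2 sS; have /andP[? ?] := um01 (ph t).
  by field; rewrite !gt_eqF.
pose gamma t : 'rV[R]_3 := \row_(i < 3) [:: S t; th1 t; th2 t]`_i.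
have g0 : Defs.coord gamma 0 = S by apply/funext => t; rewrite /Defs.coord mxE.
have g1 : Defs.coord gamma 1 = th1 by apply/funext => t; rewrite /Defs.coord mxE.
have g2 : Defs.coord gamma 2 = th2 by apply/funext => t; rewrite /Defs.coord mxE.
have vE f (i : 'I_3) (l : R -> R) : Defs.coord gamma i = f -> (forall t, dv f t (l t)) -> velocity gamma i = l.
  by move=> E df; apply/funext => z; rewrite /velocity E derive1E; have [_] := df z.
have v0 := vE _ _ _ g0 dS; have v1 := vE _ _ _ g1 d1; have v2 := vE _ _ _ g2 d2.
have mS t : mag gamma t = S t by rewrite /mag g0.
have V2 t : V t ^+ 2 = Q (C 0 0 ^+ 2) (C 0 1) (um (ph t)) / D (S t) ^+ 2.
  rewrite (Gpol_factor _ rp) /V /N expr_div_n; congr (_ / _).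
  rewrite !exprMn sqr_sqrtr; last exact: ltW.
  by rewrite sin2cos2 /umid; field.
have QS (t : R) : Q (C 0 0 ^+ 2) (C 0 1) (um (ph t)) = C 0 1 * (rh (S t) ^+ 2 * cos (S t) ^+ 2 * sin (S t) ^+ 2)
    - (sin (S t) ^+ 2 + C 0 0 ^+ 2 * cos (S t) ^+ 2).
  by rewrite -(sS t) /Qpol wgt_sin2 ell_sin2.
pose dD s := 2 * rh s * drh s * sin s * cos s + rh s ^+ 2 * (cos s ^+ 2 - sin s ^+ 2).
pose A0 t := (C 0 1 * dwgt k1.+1 k2.+1 (sin (S t) ^+ 2) - (1 - C 0 0 ^+ 2)) / (rh (S t) ^+ 2 * D (S t))
   - V t ^+ 2 * dD (S t) / D (S t).
have dV t : dv V t (A0 t).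
  have dDs : dv D (S t) (dD (S t)).
    apply: dv_eq (dvM (dvM (dvX 2 (dv_rho k1 k2 (S t))) (dv_sin _)) (dv_cos _)) _.
    by rewrite /dD /=; ring.
  have [l dl] := dv_Gpol k1.+1 k2.+1 (C 0 1) al be (um (ph t)).
  have dG := dv_comp dl (dv_umid al be (ph t)).
  have dsG := @dv_comp _ (@Num.sqrt R) (fun phi => Gp (um phi)) (ph t) _ _ (dv_sqrt (G0 t)) dG.
  have dN := dvM (dvZ ((be - al) / 2) (dv_sin (ph t))) dsG.
  have dNt := @dv_comp _ N ph t _ _ dN (dph t).
  have dDt := @dv_comp _ D S t _ _ dDs (dS t).
  have Dn : D (S t) != 0 by rewrite gt_eqF.
  apply: dv_eq (dvM dNt (@dvV _ (fun t => D (S t)) t _ Dn dDt)) _.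
  have NV : N (ph t) = V t * D (S t) by rewrite /V divfK.
  rewrite sl /A0 sS -(Qpol_deriv a0 b0 rp dl) NV.
  have sg2 : Gp (um (ph t)) = Num.sqrt (Gp (um (ph t))) ^+ 2 by rewrite sqr_sqrtr // ltW.
  set sg := Num.sqrt _ in sg2 *; rewrite sg2.
  have E1 : be - um (ph t) = (be - al) / 2 * (1 + cos (ph t)) by rewrite /umid; field.
  have E2 : um (ph t) - al = (be - al) / 2 * (1 - cos (ph t)) by rewrite /umid; field.
  rewrite E1 E2.
  have cs2 : cos (ph t) ^+ 2 = 1 - sin (ph t) ^+ 2 := cos2sin2 (ph t).
  have -> : (be - al) / 2 * (1 - cos (ph t)) * ((be - al) / 2 * (1 + cos (ph t))) * l =
     ((be - al) / 2 * sin (ph t)) ^+ 2 * l.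
    transitivity (((be - al) / 2) ^+ 2 * (1 - cos (ph t) ^+ 2) * l); first by ring.
    by rewrite cs2; ring.
  have sgn : sg != 0 by rewrite gt_eqF // sG.
  have rn : rh (S t) != 0 by rewrite gt_eqF.
  move: (V t) (D (S t)) Dn (dD (S t)) => W d Dn d'.
  by field; rewrite sgn rn Dn.
pose A1 t := - (eps * dgcoef k1 k2 1 (S t) * V t) / (rh (S t) ^+ 2 * cos (S t) ^+ 2) ^+ 2.
pose A2 t := - (eps * C 0 0 * dgcoef k1 k2 2 (S t) * V t) / (rh (S t) ^+ 2 * sin (S t) ^+ 2) ^+ 2.
have dv1 t : dv (fun t => eps / (rh (S t) ^+ 2 * cos (S t) ^+ 2)) t (A1 t).
  have n0 : gcoef k1 k2 1 (S t) != 0 by rewrite gt_eqF // (gcoef_gt0 k1 k2 (1 : 'I_3) (hS t)).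
  have d := dvZ eps (@dvV _ (fun t => gcoef k1 k2 1 (S t)) t _ n0 (@dv_comp _ (gcoef k1 k2 1) S t _ _ (dv_gcoef k1 k2 1 (S t)) (dS t))).
  apply: dv_eq d _; rewrite /A1 /gcoef /=.
  by ring.
have dv2 t : dv (fun t => eps * C 0 0 / (rh (S t) ^+ 2 * sin (S t) ^+ 2)) t (A2 t).
  have n0 : gcoef k1 k2 2 (S t) != 0 by rewrite gt_eqF // (gcoef_gt0 k1 k2 (2 : 'I_3) (hS t)).
  have d := dvZ (eps * C 0 0) (@dvV _ (fun t => gcoef k1 k2 2 (S t)) t _ n0 (@dv_comp _ (gcoef k1 k2 2) S t _ _ (dv_gcoef k1 k2 2 (S t)) (dS t))).
  apply: dv_eq d _; rewrite /A2 /gcoef /=.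
  by ring.
have geo : geodesic (gbar k1 k2) gamma.
  apply: (@geodesic_gbar _ k1 k2 gamma (fun i t => [:: A0 t; A1 t; A2 t]`_i)).
  - by move=> t; rewrite mS.
  - move=> t i; have [->|->|->] := I3P i.
    + by rewrite g0 v0; exact: dS.
    + by rewrite g1 v1; exact: d1.
    + by rewrite g2 v2; exact: d2.
  - move=> t i; have [->|->|->] := I3P i => /=.
    + by rewrite v0; exact: dV.
    + by rewrite v1; exact: dv1.
    + by rewrite v2; exact: dv2.
  - move=> t s; rewrite v0 v1 v2 /= {}/s mS.
    have [c1 s1] := trg t.
    have rn : rh (S t) != 0 by rewrite gt_eqF.
    have cn : cos (S t) != 0 by rewrite gt_eqF.
    have sn : sin (S t) != 0 by rewrite gt_eqF.
    have HV : V t ^+ 2 = (C 0 1 * (rh (S t) ^+ 2 * cos (S t) ^+ 2 * sin (S t) ^+ 2)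
       - (sin (S t) ^+ 2 + C 0 0 ^+ 2 * cos (S t) ^+ 2)) / (rh (S t) ^+ 2 * sin (S t) * cos (S t)) ^+ 2.
      by rewrite V2 QS.
    have E := @radial_identity _ (drh (S t)) _ _ (C 0 0) (C 0 1) eps (V t) rn cn sn eps1 HV.
    rewrite /A0 (dwgt_sin2 (hS t)) /gcoef /dgcoef /dD /D /=.
    rewrite !mulr1 mulr0 addr0 {1}E; ring.
  - move=> t s; rewrite v0 v1 /= {}/s mS /A1 /gcoef /=.
    have [c1 s1] := trg t.
    by field; rewrite !gt_eqF.
  - move=> t s; rewrite v0 v2 /= {}/s mS /A2 /gcoef /=.
    have [c1 s1] := trg t.
    by field; rewrite !gt_eqF.
have pr : profile k1 k2 gamma by split => // t; rewrite mS; exact: hS.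
have mu1E t : mu1 k1 k2 gamma t = eps.
  have [c1 s1] := trg t; rewrite /mu1 mS v1; field; rewrite !gt_eqF //.
have mu2E t : mu2 k1 k2 gamma t = eps * C 0 0.
  have [c1 s1] := trg t; rewrite /mu2 mS v2; field; rewrite !gt_eqF //.
have e0 : eps != 0 by exact: sqr1_neq0 eps1.
have ds : doubly_spiral k1 k2 gamma.
  by move=> t; rewrite mu1E mu2E mulf_neq0 // mulf_neq0.
have hp : has_parameters k1 k2 eps gamma C.
  move=> t; rewrite mu1E mu2E; split.
  - have /orP[/eqP->|/eqP->] : (eps == 1) || (eps == -1) by rewrite -sqrf_eq1 eps1.
      by rewrite sgr1.
    by rewrite sgrN sgr1.
  - by rewrite mulrAC divff // mul1r.
  - rewrite eps1 divr1 /energy mulrA divff ?pnatr_eq0 // mul1r norm2_gbar.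
    rewrite !big_ord_recl big_ord0.
    have -> : lift ord0 ord0 = 1 :> 'I_3 by exact: val_inj.
    have -> : lift ord0 (lift ord0 ord0) = 2 :> 'I_3 by exact: val_inj.
    have -> : ord0 = 0 :> 'I_3 by exact: val_inj.
    have [c1 s1] := trg t.
    rewrite v0 v1 v2 mS V2 QS /gcoef /D /=.
    transitivity (C 0 1 + (eps ^+ 2 - 1) * ((rh (S t) ^+ 2 * cos (S t) ^+ 2)^-1 + C 0 0 ^+ 2 / (rh (S t) ^+ 2 * sin (S t) ^+ 2))).
      by rewrite eps1 subrr mul0r addr0.
    by field; rewrite !gt_eqF.
(* the cells are bounded by the times at which phi is a multiple of 2 pi *)
pose T z := prim slowness ((pi *+ 2) *~ z).
pose T' z := prim slowness (pi + (pi *+ 2) *~ z).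
have pi0 := pi_gt0 R.
have ph_lt x y : x < y -> ph x < ph y.
  move=> xy; rewrite ltNge; apply/negP; rewrite le_eqVlt => /predU1P[E|L].
    by move: xy; rewrite -(phK x) -(phK y) E ltxx.
  have := prim_lt cs (fun z => lt_le_trans c0 (cc z)) L; rewrite !phK; lra.
have ph_le x y : x <= y -> ph x <= ph y.
  by rewrite le_eqVlt => /predU1P[->//|/ph_lt/ltW].
have um_lt (z : int) x y : (pi *+ 2) *~ z <= x -> x < y -> y <= pi + (pi *+ 2) *~ z -> um x < um y.
  move=> zx xy yz.
  have E w : um w = um (w - (pi *+ 2) *~ z) by rewrite /umid -(cosD2pi_int (w - _) z) subrK.
  rewrite (E x) (E y) /umid; have r1 : 0 < (be - al) / 2 by have := ab; lra.
  have : cos (y - (pi *+ 2) *~ z) < cos (x - (pi *+ 2) *~ z).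
    by rewrite ltr_cos ?in_itv /=; lra.
  by nra.
have um_gt (z : int) x y : pi + (pi *+ 2) *~ z <= x -> x < y -> y <= (pi *+ 2) *~ (z + 1) -> um y < um x.
  rewrite mulrzDr mulr1z mulr2n => zx xy yz.
  have E w : um w = (al + be) / 2 + (be - al) / 2 * cos (w - pi - (pi *+ 2) *~ z).
    rewrite /umid -(cosD2pi_int (w - pi - _) z) subrK -[in LHS](subrK pi w) cosDpi; ring.
  rewrite (E x) (E y); have r1 : 0 < (be - al) / 2 by have := ab; lra.
  move: zx yz; rewrite -(mulr2n pi) => zx yz.
  have : cos (y - pi - (pi *+ 2) *~ z) < cos (x - pi - (pi *+ 2) *~ z).
    by rewrite ltr_cos ?in_itv /=; move: (pi *+ 2 *~ z) zx yz => w; rewrite ?mulr2n => zx yz; lra.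
  by nra.
have phT z : ph (T z) = (pi *+ 2) *~ z by exact: Kph.
have phT' z : ph (T' z) = pi + (pi *+ 2) *~ z by exact: Kph.
have ST z : S (T z) = colat al.
  by rewrite /S phT /umid -[_ *~ z]add0r cosD2pi_int cos0; congr colat; field.
have ST' z : S (T' z) = colat be.
  by rewrite /S phT' /umid cosD2pi_int cospi; congr colat; field.
have TT' z : T z < T' z.
  by apply: prim_lt => //; [by move=> w; exact: lt_le_trans (cc w)|rewrite ltrDr].
have T'T z : T' z < T (z + 1).
  by apply: prim_lt => //; [by move=> w; exact: lt_le_trans (cc w)|rewrite mulrzDr mulr1z addrC ltrD2l mulr2n ltrDl].
have cell z : complete_cell gamma (colat al) (colat be) (T z) (T (z + 1)).
  exists (T' z); split.
  - by rewrite TT' T'T.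
  - by rewrite !mS !ST ST'.
  - move=> x y; rewrite !in_itv /= => /andP[x1 x2] /andP[y1 y2] xy; rewrite !mS.
    apply: colat_lt; [by have := um01 (ph x); lra| |by have := um01 (ph y); lra].
    apply: (um_lt z); last by rewrite -phT'; exact: ph_le.
      by rewrite -phT; exact: ph_le.
    exact: ph_lt.
  - move=> x y; rewrite !in_itv /= => /andP[x1 x2] /andP[y1 y2] xy; rewrite !mS.
    apply: colat_lt; [by have := um01 (ph y); lra| |by have := um01 (ph x); lra].
    apply: (um_gt z); last by rewrite -phT; exact: ph_le.
      by rewrite -phT'; exact: ph_le.
    exact: ph_lt.
have [al0 ab' be1 _ _] := rp.
have hal : 0 < al < 1 by lra. have hbe : 0 < be < 1 by lra.
have osc : oscillates gamma (colat al) (colat be).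
  split.
  - by have /andP[] := colat_itv hal.
  - exact: colat_lt.
  - by have /andP[] := colat_itv hbe.
  move=> t; pose z := Num.floor (ph t / (pi *+ 2)).
  have p2 : 0 < pi *+ 2 :> R by rewrite pmulrn_lgt0.
  have h1 : (pi *+ 2) *~ z <= ph t.
    have : z%:~R <= ph t / (pi *+ 2) by exact: floor_le.
    by rewrite ler_pdivlMr // mulrzl.
  have h2 : ph t < (pi *+ 2) *~ (z + 1).
    have : ph t / (pi *+ 2) < (z + 1)%:~R by exact: floorD1_gt.
    by rewrite ltr_pdivrMr // mulrzl.
  exists (T z), (T (z + 1)); split; last exact: cell.
  apply/andP; split; rewrite leNgt; apply/negP => /ph_lt; rewrite phT; lra.
by exists gamma, (colat al), (colat be), (T 0), (T (0 + 1)); split.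
Qed.

End Existence.

(** * The regular doubly spiral locus *)

Section Locus.
Context {R : realType}.
Variables k1 k2 : nat.
Implicit Types (C : 'rV[R]_2) (eps : R).

Local Notation Q := (Qpol k1.+1 k2.+1).
Let a0 : (0 < k1.+1)%N := isT.
Let b0 : (0 < k2.+1)%N := isT.

Lemma Ppot_lt (C1 C2 s : R) : 0 < s < pi / 2 ->
  (Ppot k1 k2 C1 s < C2) = (0 < Q (C1 ^+ 2) C2 (sin s ^+ 2)).
Proof.
move=> hs; have [c0 s0] := trig_pihalf hs; have r0 := rho_gt0 k1 k2 hs.
rewrite /Ppot ltr_pdivrMr; last by rewrite !mulr_gt0 ?exprn_gt0.
by rewrite /Qpol wgt_sin2 ell_sin2 subr_gt0.
Qed.

Lemma UsetP C : Uset k1 k2 C <-> potential_well k1.+1 k2.+1 (C 0 0 ^+ 2) (C 0 1).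
Proof.
have p0 : 0 < pi / 2 :> R by rewrite divr_gt0 ?pi_gt0.
pose S := [set Ppot k1 k2 (C 0 0) s | s in [set` `]0, (pi / 2 : R)[]].
have lb : has_lbound S.
  exists 0 => z [s]; rewrite /= in_itv /= => hs <-.
  have [c0 s0] := trig_pihalf hs; have r0 := rho_gt0 k1 k2 hs.
  apply: divr_ge0; first exact: addr_ge0 (sqr_ge0 _) (mulr_ge0 (sqr_ge0 _) (sqr_ge0 _)).
  exact: mulr_ge0 (mulr_ge0 (sqr_ge0 _) (sqr_ge0 _)) (sqr_ge0 _).
split=> [H|[u hu Qu]].
  have hi : S !=set0.
    by exists (Ppot k1 k2 (C 0 0) (pi / 4)), (pi / 4) => //; rewrite /= in_itv /=; lra.
  have [_ [s hs' <-] Ps] := inf_lt hi H; have hs : 0 < s < pi / 2 by move: hs'; rewrite /= in_itv.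
  by rewrite Ppot_lt // in Ps; exists (sin s ^+ 2) => //; exact: sin2_itv.
apply: le_lt_trans (ge_inf lb _) _; first by exists (colat u); rewrite // /= in_itv /= colat_itv.
by rewrite Ppot_lt ?colat_itv // sin2_colat //; lra.
Qed.

Lemma admissible_sqr (c : R) : c != 0 -> admissible k2.+1 (c ^+ 2).
Proof. by move=> c0; left; rewrite exprn_even_gt0. Qed.

Definition chambers C : Prop := potential_well k1.+1 k2.+1 (C 0 0 ^+ 2) (C 0 1) /\ C 0 0 != 0.

Lemma chambersP C : (chamber_pos k1 k2 `|` chamber_neg k1 k2) C <-> chambers C.
Proof.
split=> [[[/UsetP U /= c]|[/UsetP U /= c]]|[/UsetP U c]].
- by split => //; rewrite gt_eqF.
- by split => //; rewrite lt_eqF.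
- by case: (ltgtP (C 0 0) 0) c => // c _; [right|left].
Qed.

Definition phase_formula eps C : 'rV[R]_2 :=
  \row_(i < 2) [:: eps * phase1 k1.+1 k2.+1 (C 0 0 ^+ 2) (C 0 1) / (2 * pi);
    eps * (C 0 0 * phase2 k1.+1 k2.+1 (C 0 0 ^+ 2) (C 0 1)) / (2 * pi)]`_i.

Lemma locusP eps C : eps ^+ 2 = 1 -> doubly_spiral_locus k1 k2 eps C <-> chambers C.
Proof.
move=> e1; have e0 : eps != 0 by exact: sqr1_neq0 e1.
split=> [[gamma [[pr [sm [sp os]]] ds hp]]|[pw c0]].
  have c0 : C 0 0 != 0.
    have := ds 0; have [_ -> _] := hp 0; rewrite mulf_eq0 negb_or => /andP[m1 m2].
    by rewrite mulf_neq0 // invr_neq0.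
  split => //; have [_ _ _ /(_ 0) [t0 [t2 [_ cc]]]] := os.
  have rp := turning_root_pair e0 pr os hp cc.
  have [al0 ab be1 _ _] := rp; have [us [_ _ _ H]] := root_pair_sign a0 b0 (admissible_sqr c0) rp.
  exists ((sin sm ^+ 2 + sin sp ^+ 2) / 2); first by lra.
  by have [|h _ _] := H ((sin sm ^+ 2 + sin sp ^+ 2) / 2); [lra|apply: h; lra].
have [al [be rp]] := root_pair_exists a0 b0 (admissible_sqr c0) pw.
have [gamma [sm [sp [t0 [t2 [[pr os] ds hp cc]]]]]] := profile_exists e1 c0 rp.
by exists gamma; split => //; split => //; exists sm, sp.
Qed.

(** A profile exists, and all cells of all profiles with these parameters have the
    same increments, so the value chosen by phase_map is this one. *)
Lemma phase_mapE eps C : eps ^+ 2 = 1 -> chambers C -> phase_map k1 k2 eps C = phase_formula eps C.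
Proof.
move=> e1 [pw c0]; have e0 : eps != 0 by exact: sqr1_neq0 e1.
have [al [be rp]] := root_pair_exists a0 b0 (admissible_sqr c0) pw.
have [gamma [sm [sp [t0 [t2 [pros ds hp cc]]]]]] := profile_exists e1 c0 rp.
have ex : exists d, cell_phase k1 k2 eps C d.
  by eexists; exists gamma, sm, sp, t0, t2; split.
have := xgetPex 0 ex; rewrite -/(phase_map k1 k2 eps C).
move=> [g [sm' [sp' [s0 [s2 [[pr os] ds' hp' cc' ->]]]]]].
have [E1 E2] := cell_phase_increment e0 pr os hp' cc' (admissible_sqr c0).
apply/rowP => i; rewrite !mxE.
by case: i => [[|[|i]] Hi] //=; rewrite ?E1 ?E2.
Qed.

End Locus.

(** * Partial derivatives of analytic functions *)

Section AnalyticNear.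
Context {R : realType}.
Notation germ := (R -> R -> R -> R).
Implicit Types (f g : R -> R -> R).

Definition analytic_near f (x y : R) : Prop := exists2 r, 0 < r & exists2 F : germ, convergent r F &
  forall p h k, `|h| <= r -> `|k| <= r -> f (x + h) (y + k) = F p h k.

Lemma analytic_near_mul f g x y : analytic_near f x y -> analytic_near g x y ->
  analytic_near (fun s t => f s t * g s t) x y.
Proof.
move=> [r r0 [F cF FE]] [q q0 [G cG GE]].
have m0 : 0 < Num.min r q by rewrite lt_min r0.
have mr : Num.min r q <= r by rewrite ge_min lexx.
have mq : Num.min r q <= q by rewrite ge_min lexx orbT.
exists (Num.min r q) => //; eexists.
  exact: convergent_mul (ltW m0) (convergent_shrink (ltW m0) mr cF) (convergent_shrink (ltW m0) mq cG).
by move=> p h k hm km; rewrite (FE p) ?(GE p) //; apply: le_trans; eassumption.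
Qed.

Lemma analytic_near_sub f g x y : analytic_near f x y -> analytic_near g x y ->
  analytic_near (fun s t => f s t - g s t) x y.
Proof.
move=> [r r0 [F cF FE]] [q q0 [G cG GE]].
have m0 : 0 < Num.min r q by rewrite lt_min r0.
have mr : Num.min r q <= r by rewrite ge_min lexx.
have mq : Num.min r q <= q by rewrite ge_min lexx orbT.
exists (Num.min r q) => //; eexists.
  exact: convergent_sub (ltW m0) (convergent_shrink (ltW m0) mr cF) (convergent_shrink (ltW m0) mq cG).
by move=> p h k hm km; rewrite (FE p) ?(GE p) //; apply: le_trans; eassumption.
Qed.

Lemma analytic_near_scale (c : R) f x y : analytic_near f x y -> analytic_near (fun s t => c * f s t) x y.
Proof.
move=> [r r0 [F cF FE]]; exists r => //; eexists; first exact: (@convergent_scale _ r c F (ltW r0) cF).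
by move=> p h k hr kr; rewrite (FE p).
Qed.

Lemma analytic_near_fst x y : analytic_near (fun s _ => s) x y.
Proof.
exists 1 => //; exists (fun _ h _ => x + h) => //.
exact: convergent_add (convergent_cst 1 x) (convergent_h ler01).
Qed.

Lemma analytic_near_swap f x y : analytic_near f x y -> analytic_near (fun s t => f t s) y x.
Proof.
move=> [r r0 [F [M pF] FE]]; exists r => //; exists (fun p h k => F p k h).
  by exists M; exact: pser_swap.
by move=> p h k hr kr; rewrite (FE p).
Qed.

Definition pd1 f (x y : R) : R := ((fun s => f s y)^`())%classic x.
Definition pd2 f (x y : R) : R := ((fun t => f x t)^`())%classic y.

Lemma dv_quadratic (g : R -> R) (x l K r : R) : 0 < r ->
  (forall t, `|t| <= r -> `|g (x + t) - g x - t * l| <= K * t ^+ 2) -> dv g x l.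
Proof.
move=> r0 H.
have K0 : 0 <= K.
  have := le_trans (normr_ge0 _) (H r _); rewrite gtr0_norm // lexx => /(_ isT).
  by rewrite pmulr_lge0 // exprn_gt0.
have L : h^-1 *: (g (h *: 1 + x) - g x) @[h --> 0^'] --> l.
  apply/cvgrPdist_le => e e0.
  have d0 : 0 < Num.min r (e / (K + 1)) by rewrite lt_min r0 divr_gt0 //; lra.
  apply/nbhs_ballP; exists (Num.min r (e / (K + 1))) => // t /=.
  rewrite /ball /= sub0r normrN => td tn0.
  have tr : `|t| <= r by apply: ltW; apply: lt_le_trans td _; rewrite ge_min lexx.
  have te : `|t| <= e / (K + 1) by apply: ltW; apply: lt_le_trans td _; rewrite ge_min lexx orbT.
  rewrite /GRing.scale /= mulr1 (addrC t x).
  have -> : l - t^-1 * (g (x + t) - g x) = - (t^-1 * (g (x + t) - g x - t * l)) by field.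
  rewrite normrN normrM normfV ler_pdivrMl ?normr_gt0 //.
  apply: le_trans (H t tr) _; rewrite -(real_normK (num_real t)) expr2 mulrA mulrC.
  apply: ler_wpM2l => //; apply: le_trans (ler_wpM2l K0 te) _.
  rewrite mulrCA ler_piMr ?(ltW e0) // ler_pdivrMr; lra.
by split; [apply/cvg_ex; exists l|exact: cvg_lim].
Qed.

Lemma analytic_near_pd1 f x y : analytic_near f x y -> exists2 r, 0 < r & exists2 F : germ, convergent r F &
  forall p h k, `|h| <= r -> `|k| <= r -> dv (fun s => f s (y + k)) (x + h) (F p h k).
Proof.
move=> [r r0 [F [M pF] FE]].
have q0 : 0 < r / 2 by lra.
have [|F' [pF' HF']] := @pser_dh R (r / 2) F M q0.
  by rewrite mulrCA divff ?pnatr_eq0 // mulr1.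
have s0 : 0 < r / 4 by lra.
exists (r / 4) => //; exists F'.
  by exists (M / (r / 2)); apply: pser_shrink pF'; lra.
move=> p h k hr kr; apply: (@dv_quadratic _ _ _ (M / (r / 2) ^+ 2) (r / 4)) => // t tr.
have htr : `|h + t| <= r / 2 by apply: le_trans (ler_normD _ _) _; lra.
have hr' : `|h| <= r / 2 by lra. have kr' : `|k| <= r / 2 by lra.
rewrite -(addrA x) (FE p (h + t)) ?(FE p h); [|lra|lra|lra|lra].
exact: HF'.
Qed.

Lemma pd1_analytic f x y : analytic_near f x y -> analytic_near (pd1 f) x y.
Proof.
move=> /analytic_near_pd1 [r r0 [F cF FE]]; exists r => //; exists F => // p h k hr kr.
by rewrite /pd1 derive1E; have [_] := FE p h k hr kr.
Qed.

Lemma pd2_analytic f x y : analytic_near f x y -> analytic_near (pd2 f) x y.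
Proof. by move=> /analytic_near_swap/pd1_analytic/analytic_near_swap. Qed.

Lemma dv_pd1 f x y : analytic_near f x y -> dv (fun s => f s y) x (pd1 f x y).
Proof.
move=> /analytic_near_pd1 [r r0 [F cF FE]].
have n0 : `|0 : R| <= r by rewrite normr0 ltW.
have := FE 0 0 0 n0 n0; rewrite !addr0 => d; rewrite /pd1 derive1E.
by have [_ ->] := d.
Qed.

Lemma dv_pd2 f x y : analytic_near f x y -> dv (fun t => f x t) y (pd2 f x y).
Proof. by move=> /analytic_near_swap/dv_pd1. Qed.

Lemma analytic_near_lipschitz f x y : analytic_near f x y -> exists r K, [/\ 0 < r, 0 <= K &
  forall h k h' k', `|h| <= r -> `|k| <= r -> `|h'| <= r -> `|k'| <= r ->
   `|f (x + h) (y + k) - f (x + h') (y + k')| <= K * (`|h - h'| + `|k - k'|)].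
Proof.
have one (g : R -> R -> R) (u v : R) : analytic_near g u v -> exists r K, [/\ 0 < r, 0 <= K &
  forall h k h', `|h| <= r -> `|k| <= r -> `|h'| <= r ->
   `|g (u + h) (v + k) - g (u + h') (v + k)| <= K * `|h - h'|].
  move=> /analytic_near_pd1 [r r0 [F [M pF] FE]]; exists r, M; split => //; first exact: pser_ge0 pF.
  move=> h k h' hr kr hr'; wlog hh : h h' hr hr' / h <= h'.
    move=> W; case: (leP h h') => [|/ltW] hh; first exact: W.
    by rewrite distrC (distrC h); exact: W.
  have dd z : z \in `[u + h, u + h'] -> dv (g^~ (v + k)) z (F 0 (z - u) k).
    rewrite in_itv /= => hz; have -> : z = u + (z - u) by ring.
    have -> : u + (z - u) - u = z - u by ring.
    by apply: FE => //; move: hr hr'; rewrite !ler_norml; lra.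
  have [|||z hz E] := @MVT_segment _ (g^~ (v + k)) (fun z => F 0 (z - u) k) (u + h) (u + h').
  - by rewrite lerD2l.
  - by move=> z hz; apply: dd; move: hz; rewrite !in_itv /=; lra.
  - by apply: derivable_within_continuous => z hz; have [] := dd z hz.
  rewrite distrC E normrM (_ : u + h' - (u + h) = - (h - h')); last by ring.
  rewrite normrN ler_wpM2r //; apply: pser_le (ltW r0) pF _ kr.
  by move: hr hr' hz; rewrite !ler_norml in_itv /=; lra.
move=> af; have [r [K [r0 K0 H]]] := one f x y af.
have [q [L [q0 L0 H']]] := one _ y x (analytic_near_swap af).
have m0 : 0 < Num.min r q by rewrite lt_min r0.
have mr : Num.min r q <= r by rewrite ge_min lexx.
have mq : Num.min r q <= q by rewrite ge_min lexx orbT.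
exists (Num.min r q), (K + L); split => //; first exact: addr_ge0.
move=> h k h' k' hm km hm' km'.
have h1 := H h k h' (le_trans hm mr) (le_trans km mr) (le_trans hm' mr).
have h2 := H' k h' k' (le_trans km mq) (le_trans hm' mq) (le_trans km' mq).
have -> : f (x + h) (y + k) - f (x + h') (y + k') = (f (x + h) (y + k) - f (x + h') (y + k)) +
   (f (x + h') (y + k) - f (x + h') (y + k')) by ring.
apply: le_trans (ler_normD _ _) _.
have n1 := normr_ge0 (h - h'); have n2 := normr_ge0 (k - k').
by nra.
Qed.

(** Strict differentiability: both points vary in a box around (x, y).  This is
    what makes the iteration of [plane_map_open] contract. *)
Lemma analytic_near_taylor f x y : analytic_near f x y -> exists r K, [/\ 0 < r, 0 <= K &
  forall d h k h' k', 0 <= d -> d <= r -> `|h| <= d -> `|k| <= d -> `|h'| <= d -> `|k'| <= d ->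
   `|f (x + h) (y + k) - f (x + h') (y + k') - (h - h') * pd1 f x y - (k - k') * pd2 f x y|
     <= K * d * (`|h - h'| + `|k - k'|)].
Proof.
have one (g : R -> R -> R) (u v : R) : analytic_near g u v -> exists r K, [/\ 0 < r, 0 <= K &
  forall d h k h', 0 <= d -> d <= r -> `|h| <= d -> `|k| <= d -> `|h'| <= d ->
   `|g (u + h) (v + k) - g (u + h') (v + k) - (h - h') * pd1 g u v| <= K * d * `|h - h'|].
  move=> ag; have [r [K [r0 K0 HL]]] := analytic_near_lipschitz (pd1_analytic ag).
  have [q q0 [F _ FE]] := analytic_near_pd1 ag.
  have m0 : 0 < Num.min r q by rewrite lt_min r0.
  have mr : Num.min r q <= r by rewrite ge_min lexx.
  have mq : Num.min r q <= q by rewrite ge_min lexx orbT.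
  exists (Num.min r q), (2 * K); split => //; first exact: mulr_ge0.
  move=> d h k h' d0 dm; have dr := le_trans dm mr; have dq := le_trans dm mq.
  wlog hh : h h' / h <= h'.
    move=> W hr kr hr'; case: (leP h h') => [|/ltW] hh; first exact: W.
    rewrite -normrN (distrC h).
    have -> : - (g (u + h) (v + k) - g (u + h') (v + k) - (h - h') * pd1 g u v) =
      g (u + h') (v + k) - g (u + h) (v + k) - (h' - h) * pd1 g u v by ring.
    exact: W.
  move=> hr kr hr'.
  have dd z : z \in `[u + h, u + h'] -> dv (g^~ (v + k)) z (pd1 g z (v + k)).
    rewrite in_itv /= => hz.
    have := FE 0 (z - u) k; have -> : u + (z - u) = z by ring.
    move=> W; have zu : `|z - u| <= q by move: hr hr'; rewrite !ler_norml; lra.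
    have W' := W zu (le_trans kr dq).
    by rewrite /pd1 derive1E; have [_ ->] := W'.
  have [|||z hz E] := @MVT_segment _ (g^~ (v + k)) (fun z => pd1 g z (v + k)) (u + h) (u + h').
  - by rewrite lerD2l.
  - by move=> z hz; apply: dd; move: hz; rewrite !in_itv /=; lra.
  - by apply: derivable_within_continuous => z hz; have [] := dd z hz.
  have zd : `|z - u| <= d by move: hr hr' hz; rewrite !ler_norml in_itv /=; lra.
  have n0 : `|0 : R| <= r by rewrite normr0 ltW.
  have := HL (z - u) k 0 0 (le_trans zd dr) (le_trans kr dr) n0 n0.
  rewrite !addr0 !subr0 (_ : u + (z - u) = z); last by ring.
  move=> B; have -> : g (u + h) (v + k) - g (u + h') (v + k) - (h - h') * pd1 g u v =
     (h - h') * (pd1 g z (v + k) - pd1 g u v).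
    have -> : g (u + h) (v + k) - g (u + h') (v + k) = - (g (u + h') (v + k) - g (u + h) (v + k)) by ring.
    by rewrite E; ring.
  rewrite normrM mulrC ler_wpM2r //; apply: le_trans B _.
  have -> : 2 * K * d = K * (d + d) by ring.
  by rewrite ler_wpM2l // lerD.
move=> af; have [r [K [r0 K0 H]]] := one f x y af.
have [q [L [q0 L0 H']]] := one _ y x (analytic_near_swap af).
have m0 : 0 < Num.min r q by rewrite lt_min r0.
have mr : Num.min r q <= r by rewrite ge_min lexx.
have mq : Num.min r q <= q by rewrite ge_min lexx orbT.
exists (Num.min r q), (K + L); split => //; first exact: addr_ge0.
move=> d h k h' k' d0 dm hd kd hd' kd'.
have h1 := H d h k h' d0 (le_trans dm mr) hd kd hd'.
have h2 := H' d k h' k' d0 (le_trans dm mq) kd hd' kd'.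
rewrite -/(pd2 f x y) in h2.
have -> : f (x + h) (y + k) - f (x + h') (y + k') - (h - h') * pd1 f x y - (k - k') * pd2 f x y =
  (f (x + h) (y + k) - f (x + h') (y + k) - (h - h') * pd1 f x y) +
   (f (x + h') (y + k) - f (x + h') (y + k') - (k - k') * pd2 f x y) by ring.
apply: le_trans (ler_normD _ _) _; apply: le_trans (lerD h1 h2) _.
have n1 := normr_ge0 (h - h'); have n2 := normr_ge0 (k - k').
have p1 := mulr_ge0 (mulr_ge0 K0 d0) n2; have p2 := mulr_ge0 (mulr_ge0 L0 d0) n1.
by rewrite !mulrDl !mulrDr; lra.
Qed.

End AnalyticNear.

(** * The identity theorem on lines *)

Section Identity.
Context {R : realType}.
Notation germ := (R -> R -> R -> R).

Lemma pser_lipschitz0 (r M : R) (F : germ) p (k : R) : 0 < r -> pser r F M -> `|k| <= r ->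
  `|F p 0 k - F p 0 0| <= `|k| / r * M.
Proof.
move=> r0 pF kr; have h : 0 <= `|k| / r <= 1.
  by rewrite divr_ge0 ?(ltW r0) //= ler_pdivrMr // mul1r.
have := pser_small (ltW r0) h pF; rewrite divfK ?gt_eqF // => ps.
by apply: (pser_le p (normr_ge0 k) ps _ (lexx _)); rewrite normr0.
Qed.

(** Dividing by k as often as one likes bounds the function by
    (|k| / r)^n M for every n. *)
Lemma pser_isolated_zeros (r M : R) (F : germ) : 0 < r -> pser r F M ->
  (forall p d, 0 < d -> exists k, [/\ k != 0, `|k| < d & F p 0 k = 0]) ->
  forall p k, `|k| < r -> F p 0 k = 0.
Proof.
move=> r0 pF Z p k kr.
have claim n : exists2 Fn, pser r Fn (M / r ^+ n) & forall p k, `|k| <= r -> F p 0 k = k ^+ n * Fn p 0 k.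
  elim: n => [|n [Fn pn En]].
    by exists F => [|? ? _]; [rewrite expr0 divr1|rewrite expr0 mul1r].
  have [q|F1 [p1 E1]] := pser_factor r0 pn.
    apply/eqP; rewrite -normr_eq0; apply/negP => /negP n0.
    have A0 : 0 < `|Fn q 0 0| by rewrite normr_gt0 -normr_eq0.
    have N0 := pser_ge0 pn; set N := M / r ^+ n in pn N0.
    have d0 : 0 < Num.min r (`|Fn q 0 0| * r / (N + 1)).
      by rewrite lt_min r0 divr_gt0 ?mulr_gt0 //; lra.
    have [l [l0 ld lZ]] := Z q _ d0.
    have lr : `|l| <= r by apply: ltW; apply: lt_le_trans ld _; rewrite ge_min lexx.
    have lA : `|l| < `|Fn q 0 0| * r / (N + 1) by apply: lt_le_trans ld _; rewrite ge_min lexx orbT.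
    have Fl : Fn q 0 l = 0.
      by have /esym/eqP := En q l lr; rewrite lZ mulf_eq0 expf_eq0 (negbTE l0) andbF => /eqP.
    have := pser_lipschitz0 q r0 pn lr; rewrite Fl sub0r normrN; apply/negP; rewrite -ltNge.
    move: lA; rewrite ltr_pdivlMr; last by lra.
    have -> : `|l| / r * N = (`|l| * N) / r by ring.
    by rewrite ltr_pdivrMr //; have := normr_ge0 l; lra.
  exists F1; first by rewrite exprSr invfM mulrA; exact: p1.
  by move=> q l lr; rewrite En // E1 // exprSr mulrA.
have th1 : `| `|k| / r| < 1.
  by rewrite ger0_norm ?divr_ge0 ?(ltW r0) // ltr_pdivrMr // mul1r.
apply/eqP; rewrite -normr_eq0 eq_le normr_ge0 andbT.
have lim : ((`|k| / r) ^+ n * M) @[n --> \oo] --> (0 : R).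
  rewrite -(mul0r M); apply: cvgM; [exact: cvg_expr|exact: cvg_cst].
apply: (cvgr_to_ge lim); apply: nearW => n; have [Fn pn En] := claim n.
rewrite (En _ _ (ltW kr)) normrM normrX; 
have B : `|Fn p 0 k| <= M / r ^+ n by apply: (pser_le p (ltW r0) pn _ (ltW kr)); rewrite normr0 ltW.
apply: le_trans (ler_wpM2l (exprn_ge0 n (normr_ge0 k)) B) _.
by rewrite expr_div_n le_eqVlt; apply/orP; left; apply/eqP; ring.
Qed.

(** The set of points near which f vanishes is open, it is closed by
    [pser_isolated_zeros], and a segment is connected. *)
Lemma analytic_line_identity (f : R -> R -> R) (x a b t0 d : R) :
  (forall t, a <= t <= b -> analytic_near f x t) -> a <= t0 <= b -> 0 < d ->
  (forall t, `|t - t0| < d -> f x t = 0) -> forall t, a <= t <= b -> f x t = 0.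
Proof.
move=> af ht0 d0 Z t ht; pose S := [set s | f x s = 0].
have loc s : a <= s <= b -> closure S° s -> S° s.
  move=> hs cl; have [r r0 [F [M pF] FE]] := af s hs.
  have n0 : `|0 : R| <= r by rewrite normr0 ltW.
  have FZ : forall p k, `|k| < r -> F p 0 k = 0.
    apply: (pser_isolated_zeros r0 pF _) => p e e0.
    have m0 : 0 < Num.min r e by rewrite lt_min r0.
    have [s' [S's bs']] := cl _ (nbhsx_ballx s _ m0).
    have : nbhs s' (S `&` ball s (Num.min r e)).
      by apply: filterI; [exact: S's|apply: open_nbhs_nbhs; split => //; exact: ball_open].
    move=> /nbhs_ballP [q /= q0 sub].
    have [s'' [sn bs]] : exists s'', s'' != s /\ ball s' q s''.
      case: (eqVneq s' s) => [E|sn]; last by exists s'; split => //; exact: ballxx.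
      exists (s' + q / 2); split; first by apply/eqP; lra.
      by rewrite /ball /= opprD addrA subrr sub0r normrN ger0_norm; lra.
    have [Ss /= ] := sub _ bs; rewrite /ball /= distrC lt_min => /andP[br be].
    exists (s'' - s); split => //; first by rewrite subr_eq0.
    by have := FE p 0 (s'' - s) n0 (ltW br); rewrite addr0 addrC subrK => <-.
  apply/nbhs_ballP; exists r => // u; rewrite /ball /= distrC => ur.
  by have := FE 0 0 (u - s) n0 (ltW ur); rewrite addr0 addrC subrK FZ.
have := @segment_connected R a b ([set` `[a, b]] `&` S°).
have St0 : S° t0.
  by apply/nbhs_ballP; exists d => // u; rewrite /ball /= distrC => /Z.
move=> /(_ _ _ _) E.
suff : ([set` `[a, b]] `&` S°) t by case=> _ /interior_subset.
rewrite E; first by rewrite /= in_itv.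
- by exists t0; split => //; rewrite /= in_itv.
- by exists S° => //; exact: open_interior.
- exists (closure S°); first exact: closed_closure.
  apply/seteqP; split=> s [+ h]; rewrite /= in_itv /= => hs; split; rewrite /= ?in_itv //.
    exact: subset_closure.
  exact: loc.
Qed.

End Identity.

(** * The first phase at C_1 = 0 in tall wells *)

Section IncrementBound.
Context {R : realType}.

Lemma increment_le (f df : R -> R) (p q B : R) : p <= q -> continuous f ->
  (forall z, p < z < q -> dv f z (df z)) -> (forall z, p < z < q -> df z <= B) ->
  f q - f p <= B * (q - p).
Proof.
rewrite le_eqVlt => /predU1P[-> _ _ _|pq cf d dB]; first by rewrite !subrr mulr0.
have [||z] := @MVT _ f df p q pq.
- by move=> z; rewrite in_itv /= => hz; exact: d.
- exact: continuous_subspaceT.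
by rewrite in_itv /= => hz ->; rewrite ler_wpM2r ?dB // subr_ge0 ltW.
Qed.

End IncrementBound.

Section PhaseAtZero.
Context {R : realType}.
Variables (a b : nat).
Hypotheses (a0 : (0 < a)%N) (b1 : (1 < b)%N).
Let b0 : (0 < b)%N := ltnW b1.
Implicit Types (y u : R).

Local Notation Q := (@Qpol R a b 0).
Let n : R := (a + b)%:R - 1.

Lemma Qpol0E y u : Q y u = y * wgt a b u - u.
Proof. by rewrite /Qpol /ell mul0r addr0. Qed.

Lemma dwgt_wgt u : dwgt a b u * (u * (1 - u)) = wgt a b u * (b%:R - (a + b)%:R * u).
Proof.
by rewrite /dwgt /wgt; case: a a0 => // a' _; case: b b0 => // b' _ /=; rewrite !exprS; ring.
Qed.

(** At x = 0 this is y (1 - u)^a u^(b - 1) - 1, which is monotone on each side of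
    u = (b - 1) / n, n = a + b - 1. *)
Definition excess y u : R := Q y u / u.

Lemma dv_excess y u : 0 < u < 1 ->
  dv (excess y) u ((excess y u + 1) * (b%:R - 1 - n * u) / (u * (1 - u))).
Proof.
move=> /andP[u0 u1]; have un : u != 0 by rewrite gt_eqF.
have un1 : 1 - u != 0 by rewrite gt_eqF // subr_gt0.
apply: dv_eq (dvM (dv_Qpol a0 b0 0 y u) (dvV un (dv_id u))) _.
have E : dwgt a b u = wgt a b u * (b%:R - (a + b)%:R * u) / (u * (1 - u)).
  by rewrite -dwgt_wgt; field; rewrite un un1.
by rewrite /excess Qpol0E E /n; field; rewrite un un1.
Qed.

Section Branch.
Variables (y al be : R).
Hypothesis rp : root_pair a b 0 y al be.

Let adm : admissible b (0 : R) := or_intror (conj erefl b1).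
Let U := umid al be.
Let D := dens1 a b y al be.

Let cD : continuous D. Proof. exact: (continuous_dens1 a0 b0 adm rp). Qed.

Lemma umid_prod phi : (U phi - al) * (be - U phi) = ((be - al) / 2 * sin phi) ^+ 2.
Proof.
by rewrite exprMn sin2cos2 /U /umid; field.
Qed.

(** Where the excess is monotone in u, the arc tangent of its square root is an
    integration variable with respect to which the phase has the density
    2 sqrt u / |n u - (b - 1)|. *)
Lemma branch_bound (sg K p q : R) : sg ^+ 2 = 1 -> 0 <= K -> 0 <= p -> p <= q -> q <= pi ->
  (forall phi, p < phi < q -> 2 * Num.sqrt (U phi) <= K * (sg * (n * U phi - (b%:R - 1)))) ->
  prim D q - prim D p <= K * (pi / 2).
Proof.
move=> sg1 K0 p0 pq qpi HK; have [al0 ab be1 Qal Qbe] := rp.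
have hU phi : 0 < U phi < 1 := umid01 phi rp.
pose t phi := Num.sqrt (excess y (U phi)).
have ct : continuous t.
  move=> phi; apply: continuous_comp; last exact: sqrt_continuous.
  exact: dv_continuous (dv_comp (dv_excess y (hU phi)) (dv_umid al be phi)).
pose tau phi := atan (t phi).
have ctau : continuous tau by move=> phi; apply: continuous_comp; [exact: ct|exact: continuous_atan].
have [tau0 tau1] : (forall phi, 0 <= tau phi) /\ (forall phi, tau phi <= pi / 2).
  by split => phi; [rewrite -(@atan0 R) le_atan ?sqrtr_ge0|exact/ltW/atan_ltpi2].
pose f phi := prim D phi + sg * K * tau phi.
suff : f q - f p <= 0 * (q - p).
  have := tau0 p; have := tau1 p; have := tau0 q; have := tau1 q; rewrite /f mul0r.
  have : sg = 1 \/ sg = -1 by move/eqP: sg1; rewrite sqrf_eq1 => /orP[/eqP|/eqP]; auto.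
  case=> ->; nra.
pose df phi := D phi + sg * K * ((b%:R - 1 - n * U phi) / (2 * t phi * (U phi * (1 - U phi))) * ((be - al) / 2 * sin phi)).
have cf : continuous f.
  move=> phi; apply: cvgD; first exact: dv_continuous (dv_prim phi cD).
  by apply: cvgM; [exact: cvg_cst|exact: ctau].
have sinp phi : p < phi < q -> 0 < (be - al) / 2 * sin phi.
  by move=> h; rewrite mulr_gt0 ?sin_gt0_pi //; lra.
have Qp phi : p < phi < q -> 0 < excess y (U phi).
  move=> h; rewrite divr_gt0 //; last by have /andP[] := hU phi.
  rewrite (Gpol_factor _ rp) umid_prod mulr_gt0 ?exprn_gt0 ?sinp //.
  exact: Gumid_gt0 adm rp.
apply: (@increment_le _ f df) => // phi h; have e0 := Qp phi h; have /andP[u0 u1] := hU phi.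
  have t0 : 0 < t phi by rewrite sqrtr_gt0.
  apply: dvD; first exact: dv_prim.
  apply: dvZ; have d1 := dv_comp (dv_excess y (hU phi)) (dv_umid al be phi).
  have d2 := @dv_comp _ _ (fun z => excess y (U z)) phi _ _ (dv_sqrt e0) d1.
  have d3 : dv (@atan R) (t phi) (1 + t phi ^+ 2)^-1 by exact: is_derive1_atan.
  apply: dv_eq (dv_comp d3 d2) _; rewrite -/(t phi) sqr_sqrtr ?(ltW e0) //.
  rewrite -/(U phi).
  have n1 : t phi != 0 by rewrite gt_eqF.
  have n2 : U phi != 0 by rewrite gt_eqF.
  have n3 : 1 - U phi != 0 by rewrite gt_eqF //; lra.
  have n4 : 1 + excess y (U phi) != 0 by rewrite gt_eqF //; lra.
  by field; apply/and4P; split.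
have t0 : 0 < t phi by rewrite sqrtr_gt0.
have s0 := sinp phi h; set r := (be - al) / 2 * sin phi in s0 *.
have g0 : 0 < Gpol a b y al be (U phi) by exact: Gumid_gt0 adm rp.
have sU : 0 < Num.sqrt (U phi) by rewrite sqrtr_gt0.
have Gs : Num.sqrt (Gpol a b y al be (U phi)) = Num.sqrt (U phi) * t phi / r.
  have -> : Gpol a b y al be (U phi) = U phi * excess y (U phi) / r ^+ 2.
    rewrite /excess (Gpol_factor _ rp) umid_prod -/r; field.
    by rewrite !gt_eqF.
  rewrite sqrtrM; last by rewrite mulr_ge0 ?ltW.
  by rewrite sqrtrM ?(ltW u0) // sqrtrV ?sqr_ge0 // sqrtr_sqr ger0_norm // ltW.
have -> : df phi = r / (2 * (1 - U phi) * t phi * U phi) * (2 * Num.sqrt (U phi) - K * (sg * (n * U phi - (b%:R - 1)))).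
  rewrite /df /D /dens1 -/(U phi) Gs -/r.
  have sE := sqr_sqrtr (ltW u0); set v := Num.sqrt (U phi) in sU sE *; rewrite -sE.
  field; rewrite !gt_eqF //; rewrite ?sE ?subr_gt0 //.
rewrite mulr_ge0_le0 ?subr_le0 ?HK //.
by rewrite divr_ge0 ?(ltW s0) // !mulr_ge0 ?(ltW t0) ?(ltW u0) //; lra.
Qed.

End Branch.

Lemma umid_mono (al be phi psi : R) : al < be -> 0 <= phi -> phi <= psi -> psi <= pi ->
  umid al be phi <= umid al be psi.
Proof.
move=> ab p0 pq qpi; rewrite /umid lerD2l lerN2 ler_wpM2l //; first lra.
move: pq; rewrite le_eqVlt => /predU1P[->//|pq].
by apply: ltW; rewrite ltr_cos // in_itv /=; lra.
Qed.

Lemma umid_surj (al be u : R) : al < be -> al <= u <= be -> exists2 phi, 0 <= phi <= pi & umid al be phi = u.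
Proof.
move=> ab hu; have p0 := pi_ge0 R.
have cu : {within `[0, pi], continuous (umid al be)}.
  by apply: derivable_within_continuous => z _; have [] := dv_umid al be z.
have [|phi hphi E] := @IVT R (umid al be) 0 pi u p0 cu; last by exists phi; rewrite // -in_itv.
have -> : umid al be 0 = al by rewrite /umid cos0; field.
have -> : umid al be pi = be by rewrite /umid cospi; field.
by rewrite ge_min le_max; have /andP[-> ->] := hu; rewrite orbT.
Qed.

Lemma dens1_le (y al be M : R) : root_pair a b 0 y al be -> 0 < M -> forall phi,
  1 <= (M * (1 - umid al be phi)) ^+ 2 * Gpol a b y al be (umid al be phi) ->
  dens1 a b y al be phi <= M.
Proof.
move=> rp M0 phi; have adm : admissible b (0 : R) := or_intror (conj erefl b1).
have g0 := Gumid_gt0 a0 b0 phi adm rp; have /andP[u0 u1] := umid01 phi rp.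
rewrite /dens1; set g := Gpol _ _ _ _ _ _ in g0 *; set u := umid al be phi in u0 u1 *.
have s0 : 0 < Num.sqrt g by rewrite sqrtr_gt0.
rewrite -{1}(sqr_sqrtr (ltW g0)) -exprMn -invfM => h.
have v0 : 0 < 1 - u by lra.
rewrite -[leLHS]mul1r ler_pdivrMr ?mulr_gt0 // mulrA.
by rewrite -(@ler_pXn2r _ 2) ?nnegrE ?expr1n // !mulr_ge0 ?ltW.
Qed.

(** The integral is split at the points where u equals ul and ur: on the outer
    arcs [branch_bound] applies, on the middle one the density is at most M. *)
Lemma phase1_three_arcs y (ul ur K1 K2 M : R) : 0 <= K1 -> 0 <= K2 -> 0 < M ->
  0 < ul -> ul <= ur -> ur < 1 ->
  (forall u, ul <= u <= ur -> 1 <= (M * (1 - u)) ^+ 2 * Q y u) ->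
  (forall u, 0 < u <= ul -> 2 * Num.sqrt u <= K1 * (b%:R - 1 - n * u)) ->
  (forall u, ur <= u < 1 -> 2 * Num.sqrt u <= K2 * (n * u - (b%:R - 1))) ->
  potential_well a b 0 y /\ phase1 a b 0 y <= (K1 + K2) * (pi / 2) + M * pi.
Proof.
move=> K10 K20 M0 ul0 ulr ur1 Qmid HK1 HK2.
have adm : admissible b (0 : R) := or_intror (conj erefl b1).
have qpos u : ul <= u <= ur -> 0 < Q y u.
  move=> /Qmid h; rewrite ltNge; apply/negP => h'.
  by have := mulr_ge0_le0 (sqr_ge0 (M * (1 - u))) h'; lra.
have pw : potential_well a b 0 y by exists ul; [lra|apply: qpos; rewrite lexx].
split => //; have [al [be rp]] := root_pair_exists a0 b0 adm pw.
have [al0 ab be1 _ _] := rp.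
have inwell u : ul <= u <= ur -> al < u < be.
  move=> hu; apply: (root_pair_inside a0 b0 adm rp) (qpos u hu); lra.
rewrite /phase1 (rootsE a0 b0 adm rp) /=.
set D := dens1 a b y al be; pose U := umid al be.
have cD : continuous D := continuous_dens1 a0 b0 adm rp.
have hl : al < ul < be by apply: inwell; rewrite lexx.
have hr : al < ur < be by apply: inwell; rewrite lexx andbT.
have [|p1 /andP[p10 p1pi] Up1] := @umid_surj al be ul ab.
  by have /andP[/ltW -> /ltW ->] := hl.
have [|p2 /andP[p20 p2pi] Up2] := @umid_surj al be ur ab.
  by have /andP[/ltW -> /ltW ->] := hr.
have p12 : p1 <= p2.
  rewrite leNgt; apply/negP => h; have := umid_mono ab p20 (ltW h) p1pi.
  rewrite Up1 Up2 => E; have {}E : ul = ur by apply/eqP; rewrite eq_le ulr.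
  move: h; rewrite ltNge => /negP; apply; rewrite leNgt; apply/negP => h.
  have : umid al be p2 < umid al be p1.
    rewrite /umid ltrD2l ltrN2 ltr_pM2l ?divr_gt0 ?subr_gt0 //.
    by rewrite ltr_cos // in_itv /= ?p10 ?p1pi ?p20 ?p2pi.
  by rewrite Up1 Up2 E ltxx.
have sgN : (-1) ^+ 2 = 1 :> R by rewrite sqrrN expr1n.
have sg1 : (1 : R) ^+ 2 = 1 by rewrite expr1n.
have B1 : prim D p1 - prim D 0 <= K1 * (pi / 2).
  apply: (branch_bound rp sgN) => // phi /andP[h1 h2].
  have /andP[u0 _] := umid01 phi rp.
  rewrite mulN1r opprB; apply: HK1; rewrite u0 -Up1 /=.
  exact: umid_mono ab (ltW h1) (ltW h2) p1pi.
have B3 : prim D pi - prim D p2 <= K2 * (pi / 2).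
  apply: (branch_bound rp sg1) => // phi /andP[h1 h2].
  have /andP[_ u1] := umid01 phi rp.
  rewrite mul1r; apply: HK2; rewrite u1 andbT -Up2.
  exact: umid_mono ab p20 (ltW h1) (ltW h2).
have B2 : prim D p2 - prim D p1 <= M * (p2 - p1).
  apply: (@increment_le _ _ D) => //.
  - by move=> z; exact: dv_continuous (dv_prim z cD).
  - by move=> z _; exact: dv_prim.
  move=> phi /andP[h1 h2]; apply: (dens1_le rp M0).
  have u1 : ul <= umid al be phi.
    by rewrite -Up1; exact: umid_mono ab p10 (ltW h1) (le_trans (ltW h2) p2pi).
  have u2 : umid al be phi <= ur.
    by rewrite -Up2; exact: umid_mono ab (le_trans p10 (ltW h1)) (ltW h2) p2pi.
  have g0 := Gumid_gt0 a0 b0 phi adm rp.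
  apply: le_trans (Qmid (umid al be phi) _) _; first by rewrite u1 u2.
  rewrite ler_wpM2l ?sqr_ge0 // (Gpol_factor _ rp) ler_piMl ?(ltW g0) //.
  have /andP[v1 v2] := umid_itv phi (ltW ab).
  by apply: mulr_ile1; rewrite ?subr_ge0 // lerBlDr; apply: le_trans (_ : 1 <= _); lra.
have p00 : prim D 0 = 0 by exact: prim0.
have B2' : M * (p2 - p1) <= M * pi by rewrite ler_wpM2l ?(ltW M0) // lerBlDr; lra.
by clear - p00 B1 B2 B2' B3; lra.
Qed.

(** As y grows the roots tend to 0 and 1, only a neighbourhood of u = 1
    contributes and the phase tends to pi / a.  The constants give the two outer
    arcs and the middle one at most 1 / 16, 9 / 8 and 1 / 16 of pi / a. *)
Lemma phase1_tall_well : exists y, potential_well a b 0 y /\ phase1 a b 0 y <= 5 / 4 * (pi / a%:R).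
Proof.
have aR : 1 <= a%:R :> R by rewrite ler1n.
have bR : 2 <= b%:R :> R by rewrite (ler_nat R 2).
have nE : n = a%:R + b%:R - 1 by rewrite /n natrD.
have n2 : 2 <= n by lra.
have n0 : 0 < n by lra.
have na : a%:R <= n by lra.
pose v : R := a%:R^-1; pose m := n^-1.
have v0 : 0 < v by rewrite /v invr_gt0; lra.
have m0 : 0 < m by rewrite /m invr_gt0.
have mv : m <= v by rewrite /m /v lef_pV2 ?posrE; lra.
have nm : n * m = 1 by rewrite /m divff // gt_eqF.
have av : a%:R * v = 1 by rewrite /v divff // gt_eqF; lra.
pose e := a%:R * m / 9; pose ul := (m / 32) ^+ 2.
have am0 : 0 < a%:R * m by rewrite mulr_gt0 //; lra.
have am1 : a%:R * m <= 1 by have := ler_wpM2r (ltW m0) na; rewrite nm.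
have e0 : 0 < e by rewrite divr_gt0.
have e1 : e <= 1 / 9 by rewrite /e; lra.
have ne : n * e = a%:R / 9 by rewrite /e mulrA mulrCA nm mulr1.
have ul0 : 0 < ul by rewrite exprn_gt0 // divr_gt0.
have ulE : Num.sqrt ul = m / 32 by rewrite sqrtr_sqr ger0_norm // divr_ge0 // ltW.
have m2 : m <= 1 / 2 by have := ler_wpM2r (ltW m0) n2; rewrite nm; lra.
have ul1 : n * ul <= 1 / 2.
  have -> : n * ul = (n * m) * m / 1024 by rewrite /ul; field.
  by rewrite nm; lra.
have ul2 : ul <= 1 / 4 by rewrite /ul expr2; nra.
(* on [ul, 1 - e] the value of y below makes Q at least ul * L, and L is such
   that the density is then at most v / 16 *)
pose L := (16 * a%:R / e) ^+ 2 / ul.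
have L0 : 0 < L by rewrite divr_gt0 // exprn_gt0 // divr_gt0 //; lra.
have ulL : ul * L = (16 * a%:R / e) ^+ 2 by rewrite /L mulrCA divff ?mulr1 // gt_eqF.
pose wm := e ^+ a * ul ^+ b.-1.
have wm0 : 0 < wm by apply: mulr_gt0; exact: exprn_gt0.
clearbody e ul L.
have ulm : ul <= 1 - e by lra.
exists ((1 + L) / wm); set y := _ / wm.
have y0 : 0 < y by rewrite divr_gt0 //; lra.
have ywm : y * wm = 1 + L by rewrite divfK // gt_eqF.
clearbody y.
have M0 : 0 < v / 16 by rewrite divr_gt0.
have [|||||||||pw P] := @phase1_three_arcs y ul (1 - e) (m / 8) (9 / 4 * v) (v / 16).
- by rewrite divr_ge0 // ltW.
- by rewrite mulr_ge0 // ltW.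
- exact: M0.
- exact: ul0.
- exact: ulm.
- by rewrite ltrBlDr ltrDl.
- move=> u /andP[h1 h2]; have u0 : 0 < u := lt_le_trans ul0 h1.
  have eu : e <= 1 - u by lra.
  have wE : wgt a b u = (1 - u) ^+ a * u ^+ b.-1 * u.
    by rewrite /wgt -mulrA -exprSr prednK.
  have wg : wm <= (1 - u) ^+ a * u ^+ b.-1.
    apply: ler_pM; [exact/exprn_ge0/ltW|exact/exprn_ge0/ltW| |].
      by apply: lerXn2r; rewrite ?nnegrE ?(ltW e0) // (le_trans (ltW e0)).
    by apply: lerXn2r; rewrite ?nnegrE ?(ltW ul0) // (ltW u0).
  have QL : ul * L <= Q y u.
    have := ler_wpM2l (ltW y0) wg; rewrite Qpol0E wE ywm; set z := _ * _ ^+ b.-1 => h3.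
    have h4 : L <= y * z - 1 by rewrite lerBrDl.
    have -> : y * (z * u) - u = u * (y * z - 1) by ring.
    by apply: ler_pM => //; exact: ltW.
  have me : v / 16 * e <= v / 16 * (1 - u) by rewrite ler_wpM2l // ltW.
  have me0 : 0 <= v / 16 * e by rewrite mulr_ge0 // ltW.
  apply: le_trans (_ : (v / 16 * e) ^+ 2 * (ul * L) <= _).
    have E : v / 16 * e * (16 * a%:R / e) = a%:R * v by field; rewrite gt_eqF.
    by rewrite ulL -exprMn E av expr1n.
  apply: ler_pM => //; first exact: sqr_ge0.
    by rewrite mulr_ge0 // ltW.
  by apply: lerXn2r => //; rewrite nnegrE // (le_trans me0).
- move=> u /andP[u0 uul].
  have su : Num.sqrt u <= m / 32 by rewrite -ulE ler_sqrt // ltW.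
  have nu : n * u <= 1 / 2 by apply: le_trans ul1; rewrite ler_wpM2l // ltW.
  apply: le_trans (_ : m / 8 * (1 / 2) <= _); first by lra.
  by rewrite ler_wpM2l ?divr_ge0 ?(ltW m0) //; lra.
- move=> u /andP[eu u1].
  have su : Num.sqrt u <= 1 by rewrite -(@sqrtr1 R) ler_sqrt // ltW.
  have nu : n * (1 - e) <= n * u by rewrite ler_wpM2l // ltW.
  have nu' : 8 / 9 * a%:R <= n * u - (b%:R - 1) by move: nu; rewrite mulrBr ne; lra.
  apply: le_trans (_ : 9 / 4 * v * (8 / 9 * a%:R) <= _); last first.
    by rewrite ler_wpM2l // mulr_ge0 // ltW.
  have -> : 9 / 4 * v * (8 / 9 * a%:R) = 2 * (a%:R * v) by field.
  by rewrite av; lra.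
split => //; apply: le_trans P _.
have pi0 := pi_gt0 R; rewrite -/v.
by clear - mv pi0 v0; nra.
Qed.

End PhaseAtZero.

(** * The first phase at C_1 = 0 in shallow wells *)

Section ShallowWell.
Context {R : realType}.
Variables (a b : nat).
Hypotheses (a0 : (0 < a)%N) (b1 : (1 < b)%N).
Let b0 : (0 < b)%N := ltnW b1.
Implicit Types (y u : R).

Local Notation Q := (@Qpol R a b 0).

Lemma dv_dd1_diag (s : seq R) u : dv (fun v => dd1 s v v) u (2 * dd2 s u u u).
Proof.
elim: s => [|c s IH] /=; first by apply: dv_eq (dv_cst _ u) _; rewrite mulr0.
by apply: dv_eq (dvD (dv_horner_rec s u) (dvM (dv_id u) IH)) _; ring.
Qed.

Lemma small_near_dd2 (s : seq R) (c : R) :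
  small_near (fun v w phi h k => dd2 s (c + v phi h k) (c + h) (c + w phi h k)) (dd2 s c c c).
Proof.
elim: s => [|c' s IH] /=; first exact: small_near_cst.
apply: small_near_add; first exact: small_near_dd1 (small_near_fst c) (small_near_h c).
exact: small_near_mul (small_near_snd c) IH.
Qed.

(** Differentiating u (1 - u) wgt' = (b - (a + b) u) wgt at the maximum u0 of
    wgt / u yields the second derivative of wgt there. *)
Lemma bottom_curvature (n := (a + b)%:R - 1 : R) (u0 := (b%:R - 1) / n) :
  [/\ 0 < u0 < 1, 1 - u0 = a%:R / n & 
   (1 - u0) ^+ 2 * ((u0 / wgt a b u0) * dd2 (wseq a b) u0 u0 u0) = - (a%:R / 2)].
Proof.
have aR : 1 <= a%:R :> R by rewrite ler1n.
have bR : 2 <= b%:R :> R by rewrite (ler_nat R 2).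
have nE : n = a%:R + b%:R - 1 by rewrite /n natrD.
have n0 : n != 0 by rewrite gt_eqF //; lra.
have uE : 1 - u0 = a%:R / n by rewrite /u0 nE; field; rewrite -nE.
have hu : 0 < u0 < 1.
  by rewrite divr_gt0 ?ltr_pdivrMr /=; lra.
split => //; have /andP[u0p u01] := hu.
have w0 := wgt_gt0 a b hu; set w := wgt a b u0 in w0 *; set d := dd2 _ _ _ _.
have [un vn wn] : [/\ u0 != 0, 1 - u0 != 0 & w != 0] by split; rewrite gt_eqF //; lra.
have du : dv (dwgt a b) u0 (2 * d).
  by apply: dv_near (dv_dd1_diag (wseq a b) u0); apply: (@nearW _ (nbhs u0)) => v; rewrite dwgt_dd1.
have E1 := dvM du (dvM (dv_id u0) (dvB (dv_cst 1 u0) (dv_id u0))).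
have E2 := dvM (dv_wgt a0 b0 u0) (dvB (dv_cst (b%:R : R) u0) (dvZ (a + b)%:R (dv_id u0))).
have EE : (fun y => dwgt a b y * (y * (1 - y))) = (fun y => wgt a b y * (b%:R - (a + b)%:R * y)) :> (R -> R).
  by apply/funext => v; exact: dwgt_wgt.
rewrite EE in E1; have E := dv_unique E1 E2.
have nE' : (a + b)%:R = n + 1 :> R by rewrite /n subrK.
have W := dwgt_wgt a0 b1 u0; rewrite -/w in W E.
have nu : (a + b)%:R * u0 = b%:R - 1 + u0.
  have nu0 : n * u0 = b%:R - 1 by rewrite /u0 mulrC divfK.
  by rewrite nE' mulrDl mul1r nu0.
rewrite nu in W E.
have W' : dwgt a b u0 * u0 = w.
  apply: (mulIf vn); rewrite -mulrA W; ring.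
have nn : n = a%:R / (1 - u0) by rewrite uE; field; rewrite n0 /= gt_eqF //; lra.
have E' : 2 * d * (u0 * (1 - u0)) = - (n * w).
  move: E; rewrite nE' (_ : b%:R - (b%:R - 1 + u0) = 1 - u0); last by ring.
  move=> E; have : 2 * d * (u0 * (1 - u0)) = dwgt a b u0 * u0 - w * (n + 1) by lra.
  by rewrite W' => ->; ring.
have -> : d = - (n * w) / (2 * (u0 * (1 - u0))) by rewrite -E'; field; rewrite un vn.
by rewrite nn; field; rewrite un wn vn.
Qed.

Lemma phase1_ge y al be (m : R) : root_pair a b 0 y al be -> 0 < m ->
  (forall u, al <= u <= be -> (1 - u) ^+ 2 * Gpol a b y al be u <= m ^+ 2) ->
  pi / m <= phase1 a b 0 y.
Proof.
move=> rp m0 H; have adm : admissible b (0 : R) := or_intror (conj erefl b1).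
have [_ ab _ _ _] := rp; have cD := continuous_dens1 a0 b0 adm rp.
rewrite /phase1 (rootsE a0 b0 adm rp) /= mulrC.
have := @prim_ge _ (dens1 a b y al be) m^-1 0 pi cD _ (pi_ge0 R).
rewrite prim0 // !subr0; apply=> phi.
have hu := umid_itv phi (ltW ab); have /andP[u0 u1] := umid01 phi rp.
have g0 := Gumid_gt0 a0 b0 phi adm rp; have {}H := H _ hu; rewrite /dens1 -invfM.
set u := umid al be phi in u1 g0 H *.
have v0 : 0 < 1 - u by rewrite subr_gt0.
have s0 : 0 < Num.sqrt (Gpol a b y al be u) by rewrite sqrtr_gt0.
rewrite lef_pV2 ?posrE ?mulr_gt0 // -(@ler_pXn2r _ 2) // ?nnegrE ?(ltW m0) //.
  by rewrite exprMn sqr_sqrtr // ltW.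
by rewrite mulr_ge0 ?ltW.
Qed.

Lemma root_pair_in y (c d u : R) : 0 < c -> c < u -> u < d -> d < 1 ->
  Q y c < 0 -> 0 < Q y u -> Q y d < 0 ->
  exists al be, [/\ root_pair a b 0 y al be, c < al, al < u, u < be & be < d].
Proof.
move=> c0 cu ud d1 Qc Qu Qd; have adm : admissible b (0 : R) := or_intror (conj erefl b1).
have u01 : 0 < u < 1 by rewrite (lt_trans c0) // (lt_trans ud).
have c01 : 0 < c < 1 by rewrite c0 (lt_trans cu) //; have /andP[] := u01.
have d01 : 0 < d < 1 by rewrite d1 andbT (lt_trans _ ud) //; have /andP[] := u01.
have pw : potential_well a b 0 y by exists u.
have [al [be rp]] := root_pair_exists a0 b0 adm pw; exists al, be.
have [_ ab _ Qal Qbe] := rp; have [_ [_ _ _ H]] := root_pair_sign a0 b0 adm rp.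
have outside v : 0 < v < 1 -> Q y v < 0 -> v < al \/ be < v.
  move=> hv Qv; have [h1 _ _] := H v hv; case: (ltgtP v al) => [h|h|E]; first by left.
  - case: (ltgtP v be) => [h'|h'|E]; [|by right|].
      by have := lt_trans (h1 _) Qv; rewrite ltxx h h' => /(_ isT).
    by move: Qv; rewrite E Qbe ltxx.
  - by move: Qv; rewrite E Qal ltxx.
have /andP[au ub] := root_pair_inside a0 b0 adm rp u01 Qu; split => //.
  by case: (outside c c01 Qc) => // h; move: (lt_trans (lt_trans ub h) cu); rewrite ltxx.
by case: (outside d d01 Qd) => // h; move: (lt_trans (lt_trans ud h) au); rewrite ltxx.
Qed.

(** By [bottom_curvature] the left-hand side is a / 2 at the bottom of the well,
    less than 9 a^2 / 16, and divided differences are continuous. *)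
Lemma harmonic_near_bottom (n := (a + b)%:R - 1 : R) (u0 := (b%:R - 1) / n) (y0 := u0 / wgt a b u0) :
  exists2 d0, 0 < d0 & forall y al be u d, d <= d0 ->
    `|y - y0| <= d -> `|al - u0| <= d -> `|be - u0| <= d -> `|u - u0| <= d ->
    (1 - u) ^+ 2 * Gpol a b y al be u <= (3 / 4 * a%:R) ^+ 2.
Proof.
have aR : 1 <= a%:R :> R by rewrite ler1n.
have sq : a%:R / 2 + 1 / 16 <= (3 / 4 * a%:R) ^+ 2 :> R by nra.
have [_ _ curv] := bottom_curvature.
rewrite -/n -/u0 -/y0 in curv; clearbody y0 u0.
pose E (v w : R -> R -> R -> R) (phi h k : R) := (1 - (u0 + h)) * (1 - (u0 + h)) *
  ((y0 + k) * dd2 (wseq a b) (u0 + v phi h k) (u0 + h) (u0 + w phi h k)).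
have [C C0 HC] : small_near E (- (a%:R / 2)).
  rewrite -curv expr2; apply: small_near_mul.
    by apply: small_near_mul; apply: small_near_sub (small_near_cst 1) (small_near_h u0).
  exact: small_near_mul (small_near_k y0) (small_near_dd2 _ _).
have d1p : 0 < (16 * (C + 1))^-1 by rewrite invr_gt0 mulr_gt0 // ltr_wpDl.
exists (Num.min 1 (16 * (C + 1))^-1); first by rewrite lt_min ltr01.
move=> y al be u d; rewrite le_min => /andP[d1 dC] hy hal hbe hu.
have d0 : 0 <= d := le_trans (normr_ge0 _) hu.
have Cd : C * d <= 1 / 16.
  by apply: le_trans (ler_wpM2l C0 dC) _; rewrite ler_pdivrMr; lra.
have cst (c : R) : `|c| <= d -> pser d (fun _ _ _ => c) d.
  by move=> h; apply: (pser_weak h); exact: pser_cst.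
have := pser_le 0 d0 (HC d d _ _ d0 (lexx _) d1 (cst _ hal) (cst _ hbe)) hu hy.
rewrite /E !(addrC u0) !(addrC y0) !subrK => /le_trans/(_ Cd).
rewrite ler_norml => /andP[B _]; apply: le_trans sq.
by rewrite /Gpol mulrN expr2; lra.
Qed.

(** Just above the bottom of the well both roots are close to u0, and the phase
    is close to the harmonic value pi sqrt (2 / a), which exceeds pi / a. *)
Lemma phase1_shallow_well : exists y, potential_well a b 0 y /\ 4 / 3 * (pi / a%:R) <= phase1 a b 0 y.
Proof.
have aR : 1 <= a%:R :> R by rewrite ler1n.
have [hu _ _] := bottom_curvature; have [d0 d0p near0] := harmonic_near_bottom.
move: hu near0; set n := (a + b)%:R - 1; set u0 := (b%:R - 1) / n; set y0 := u0 / wgt a b u0.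
move=> hu near0; have /andP[u0p u01] := hu.
have w0 := wgt_gt0 a b hu.
have n0 : 0 < n by rewrite /n subr_gt0 ltr1n; lia.
have nu0 : n * u0 = b%:R - 1 by rewrite /u0 mulrC divfK // gt_eqF.
have y0E : y0 * wgt a b u0 = u0 by rewrite /y0 divfK // gt_eqF.
have NE v : Npol a b 0 v = v * (b%:R - 1 - n * v) by rewrite /Npol /ell /n; ring.
clearbody y0 u0 n.
pose d := Num.min (Num.min (u0 / 2) ((1 - u0) / 2)) d0.
have dp : 0 < d by rewrite !lt_min d0p andbT !divr_gt0 // subr_gt0.
have dd0 : d <= d0 by rewrite ge_min lexx orbT.
have d1 : d <= u0 / 2 by rewrite !ge_min lexx.
have d2 : d <= (1 - u0) / 2 by rewrite !ge_min lexx orbT.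
clearbody d.
have c0 : 0 < u0 - d by lra. have c1 : u0 - d < u0 by rewrite ltrBlDr ltrDl.
have c2 : u0 < u0 + d by rewrite ltrDl. have c3 : u0 + d < 1 by lra.
have hl : 0 < u0 - d < 1 by lra. have hr : 0 < u0 + d < 1 by lra.
have adm : admissible b (0 : R) := or_intror (conj erefl b1).
have Q0 : Q y0 u0 = 0 by rewrite Qpol0E y0E subrr.
have [us [hus Np Nn mi md]] := ratio_mono a0 b0 adm.
have usE : us = u0.
  case: (ltgtP us u0) => // h.
    by have := Nn u0; rewrite NE nu0 subrr mulr0 ltxx h u01 => /(_ isT).
  by have := Np u0; rewrite NE nu0 subrr mulr0 ltxx h u0p => /(_ isT).
rewrite usE in mi md.
have r0 : y0 * (wgt a b u0 / ell 0 u0) = 1.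
  by rewrite /ell mul0r addr0 mulrA y0E divff // gt_eqF.
have y0p : 0 < y0 by rewrite -(pmulr_lgt0 _ w0) y0E.
have Qneg v : 0 < v < 1 -> wgt a b v / ell 0 v < wgt a b u0 / ell 0 u0 -> Q y0 v < 0.
  move=> hv h; rewrite Qpol_ratio // pmulr_rlt0 ?ell_gt0 // subr_lt0 -r0.
  by rewrite ltr_pM2l.
have Ql : Q y0 (u0 - d) < 0 by apply: Qneg => //; exact: mi.
have Qr : Q y0 (u0 + d) < 0 by apply: Qneg => //; exact: md.
pose k := Num.min d (Num.min (- Q y0 (u0 - d) / 2) (- Q y0 (u0 + d) / 2)).
have k0 : 0 < k by rewrite !lt_min dp /= !divr_gt0 // oppr_gt0.
have kd : k <= d by rewrite ge_min lexx.
have kl : k <= - Q y0 (u0 - d) / 2 by rewrite /k !ge_min lexx orbT.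
have kr : k <= - Q y0 (u0 + d) / 2 by rewrite /k !ge_min lexx !orbT.
clearbody k.
have Qk v : Q (y0 + k) v = Q y0 v + k * wgt a b v by rewrite !Qpol0E; ring.
have kw v : 0 < v < 1 -> k * wgt a b v <= k.
  move=> /andP[v0 v1]; rewrite ler_piMr ?(ltW k0) // /wgt.
  by apply: mulr_ile1; rewrite ?exprn_ge0 ?exprn_ile1 ?subr_ge0 ?lerBlDr ?lerDl ?(ltW v0) ?(ltW v1).
have Ql' : Q (y0 + k) (u0 - d) < 0 by rewrite Qk; have := kw _ hl; lra.
have Qr' : Q (y0 + k) (u0 + d) < 0 by rewrite Qk; have := kw _ hr; lra.
have Q0' : 0 < Q (y0 + k) u0 by rewrite Qk Q0 add0r mulr_gt0.
exists (y0 + k); split; first by exists u0.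
have [al [be [rp h1 h2 h3 h4]]] := root_pair_in c0 c1 c2 c3 Ql' Q0' Qr'.
have close v : u0 - d <= v -> v <= u0 + d -> `|v - u0| <= d.
  by move=> *; rewrite ler_distl; apply/andP.
have m0 : 0 < 3 / 4 * a%:R :> R by rewrite mulr_gt0 // ?divr_gt0 // ltr0n.
have := phase1_ge rp m0; have -> : pi / (3 / 4 * a%:R) = 4 / 3 * (pi / a%:R) :> R by field; lra.
apply=> u /andP[alu ube]; apply: (near0 _ _ _ _ _ dd0).
- by rewrite addrC addKr ger0_norm // ltW.
- by apply: close; [exact: ltW|exact/ltW/(lt_trans h2)].
- by apply: close; [exact/ltW/(lt_trans c1)|exact: ltW].
- by apply: close; [exact: le_trans (ltW h1) alu|exact: le_trans ube (ltW h4)].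
Qed.

End ShallowWell.

(** * The Jacobian determinant does not vanish identically if b > 1 *)

Section PhasePair.
Context {R : realType}.
Variables (a b : nat).
Hypotheses (a0 : (0 < a)%N) (b0 : (0 < b)%N).
Implicit Types (c y d : R).

(** The phase increments as functions of C_1 and C_2, up to the sign of mu_1 and
    the factor 2 pi. *)
Definition increment1 c y : R := phase1 a b (c ^+ 2) y.
Definition increment2 c y : R := c * phase2 a b (c ^+ 2) y.
Definition increment_jacobian c y : R := pd1 increment1 c y * pd2 increment2 c y - pd2 increment1 c y * pd1 increment2 c y.

Definition well c y : Prop := admissible b (c ^+ 2) /\ potential_well a b (c ^+ 2) y.

Lemma well_open c y : well c y -> exists2 r, 0 < r & forall h k, `|h| <= r -> `|k| <= r -> well (c + h) (y + k).
Proof.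
move=> [ad pw]; have [r [F1 [F2 [r0 _ _ H]]]] := analytic_phase a0 b0 ad pw.
by exists r => // h k hr kr; have [] := H 0 h k hr kr.
Qed.

Lemma analytic_near_phase2 c y : well c y -> analytic_near (fun s t => phase2 a b (s ^+ 2) t) c y.
Proof.
move=> [ad pw]; have [r [F1 [F2 [r0 _ cF H]]]] := analytic_phase a0 b0 ad pw.
by exists r => //; exists F2 => // p h k hr kr; have [] := H p h k hr kr.
Qed.

Lemma analytic_near_increment1 c y : well c y -> analytic_near increment1 c y.
Proof.
move=> [ad pw]; have [r [F1 [F2 [r0 cF _ H]]]] := analytic_phase a0 b0 ad pw.
by exists r => //; exists F1 => // p h k hr kr; have [] := H p h k hr kr.
Qed.

Lemma analytic_near_increment2 c y : well c y -> analytic_near increment2 c y.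
Proof. by move=> w; exact: analytic_near_mul (analytic_near_fst c y) (analytic_near_phase2 w). Qed.

Lemma analytic_near_increment_jacobian c y : well c y -> analytic_near increment_jacobian c y.
Proof.
move=> w; have a1 := analytic_near_increment1 w; have a2 := analytic_near_increment2 w.
apply: analytic_near_sub; apply: analytic_near_mul.
- exact: pd1_analytic.
- exact: pd2_analytic.
- exact: pd2_analytic.
- exact: pd1_analytic.
Qed.

Lemma potential_well_mono x x' y y' : x' <= x -> y <= y' -> potential_well a b x y -> potential_well a b x' y'.
Proof.
move=> xx yy [u hu Qu]; exists u => //; apply: lt_le_trans Qu _.
have := wgt_gt0 a b hu; have /andP[u0 u1] := hu; rewrite /Qpol /ell; nra.
Qed.

End PhasePair.

Section JacobianNotFlat.
Context {R : realType}.
Variables (a b : nat).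
Hypotheses (a0 : (0 < a)%N) (b1 : (1 < b)%N).
Let b0 : (0 < b)%N := ltnW b1.
Implicit Types (c y d : R).

Let adm c : admissible b (c ^+ 2).
Proof. by case: (eqVneq c 0) => [->|c0]; [right; rewrite expr0n|left; rewrite exprn_even_gt0]. Qed.

Lemma phase2_gt0 c y : well a b c y -> 0 < phase2 a b (c ^+ 2) y.
Proof.
move=> [ad pw]; have [al [be rp]] := root_pair_exists a0 b0 ad pw.
have cD := continuous_dens2 a0 b0 ad rp.
rewrite /phase2 (rootsE a0 b0 ad rp) /= -(prim0 cD); apply: prim_lt => //; last exact: pi_gt0.
move=> phi; have /andP[u0 u1] := umid01 phi rp.
by rewrite mulr_gt0 // invr_gt0 // sqrtr_gt0; exact: Gumid_gt0 ad rp.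
Qed.

Lemma dv_even (f : R -> R) l : (forall t, f (- t) = f t) -> dv f 0 l -> l = 0.
Proof.
move=> ev d; have d' : dv f (- 0) l by rewrite oppr0.
have := dv_comp d' (dvN (dv_id 0)).
rewrite (_ : (fun y => f (- y)) = f); last by apply/funext.
by move=> /(dv_unique d); lra.
Qed.

(** The first increment is even in C_1, the second one odd. *)
Lemma increment_jacobian_axis y : well a b 0 y -> increment_jacobian a b 0 y = - (pd2 (increment1 a b) 0 y * phase2 a b 0 y).
Proof.
move=> w; have a1 := analytic_near_increment1 a0 b0 w; have a2 := analytic_near_increment2 a0 b0 w.
have E1 : pd1 (increment1 a b) 0 y = 0.
  by apply: (dv_even _ (dv_pd1 a1)) => t; rewrite /increment1 sqrrN.
have E2 : pd1 (increment2 a b) 0 y = phase2 a b 0 y.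
  have := dvM (dv_id 0) (dv_pd1 (analytic_near_phase2 a0 b0 w)).
  by move=> /(dv_unique (dv_pd1 a2)) ->; rewrite expr0n /= mul0r addr0 mul1r.
by rewrite /increment_jacobian E1 E2 mul0r sub0r.
Qed.

(** If the determinant vanished on an open set, it would vanish along the lines
    C_2 = const up to the axis C_1 = 0, where the second factor of
    [increment_jacobian_axis] is positive.  The first phase would be constant on
    a part of the axis, hence on the whole axis, whereas it differs between tall
    and shallow wells. *)
Lemma increment_jacobian_not_flat c0 y0 d : well a b c0 y0 -> 0 < d ->
  exists c y, [/\ `|c - c0| < d, `|y - y0| < d & increment_jacobian a b c y != 0].
Proof.
move=> w d0; apply: contrapT => Z.
have J0 c y : `|c - c0| < d -> `|y - y0| < d -> increment_jacobian a b c y = 0.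
  by move=> hc hy; apply/eqP/negPn/negP => n0; apply: Z; exists c, y.
have [r r0 wr] := well_open a0 b0 w.
pose q := Num.min r d; have q0 : 0 < q by rewrite lt_min r0.
have qr : q <= r by rewrite ge_min lexx. have qd : q <= d by rewrite ge_min lexx orbT.
have Ax y : `|y - y0| < q -> increment_jacobian a b 0 y = 0.
  move=> hy; have wy : well a b c0 y.
    have := wr 0 (y - y0); rewrite addr0 (_ : y0 + (y - y0) = y); last by ring.
    by rewrite normr0; apply; lra.
  pose lo := Num.min 0 c0; pose hi := Num.max 0 c0.
  have hsq t : lo <= t <= hi -> t ^+ 2 <= c0 ^+ 2.
    by rewrite /lo /hi; case: (leP 0 c0) => h; nra.
  apply: (@analytic_line_identity _ (fun s t => increment_jacobian a b t s) y lo hi c0 d) => //.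
  - move=> t ht; apply: analytic_near_swap; apply: analytic_near_increment_jacobian => //; split; first exact: adm.
    by apply: potential_well_mono (hsq t ht) (lexx y) wy.2.
  - by rewrite ge_min le_max lexx !orbT.
  - by move=> t ht; apply: J0 => //; apply: lt_le_trans hy qd.
  - by rewrite ge_min le_max lexx.
have w0 y : potential_well a b 0 y -> well a b 0 y by move=> pw; split; [exact: adm|rewrite expr0n].
have wup y : y0 <= y -> well a b 0 y.
  move=> hy; apply: w0; apply: potential_well_mono hy w.2; exact: sqr_ge0.
have flat y : potential_well a b 0 y -> pd2 (increment1 a b) 0 y = 0.
  move=> pw; pose lo := Num.min y (y0 + q / 2); pose hi := Num.max y (y0 + q / 2).
  have wlo : potential_well a b 0 lo.
    rewrite /lo; case: leP => // _; have [|_] := wup (y0 + q / 2); first lra.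
    by rewrite expr0n.
  apply: (@analytic_line_identity _ _ 0 lo hi (y0 + q / 2) (q / 2)) => //.
  - move=> t /andP[ht _]; apply: pd2_analytic; apply: analytic_near_increment1 => //.
    by apply: w0; apply: potential_well_mono ht wlo.
  - by rewrite ge_min le_max lexx !orbT.
  - by rewrite divr_gt0.
  - move=> t; rewrite ltr_norml => ht.
    have wt : well a b 0 t by apply: wup; lra.
    have ty : `|t - y0| < q by rewrite ltr_norml; lra.
    have p2 := phase2_gt0 wt; rewrite expr0n in p2.
    have /eqP := Ax t ty; rewrite increment_jacobian_axis // oppr_eq0 mulf_eq0 (gt_eqF p2) orbF.
    by move/eqP.
  - by rewrite ge_min le_max lexx.
have cst y y' : y <= y' -> potential_well a b 0 y -> phase1 a b 0 y = phase1 a b 0 y'.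
  move=> yy pw; have E z : increment1 a b 0 z = phase1 a b 0 z by rewrite /increment1 expr0n.
  have dz z : y <= z -> dv (increment1 a b 0) z 0.
    move=> hz; have pz : potential_well a b 0 z by exact: potential_well_mono hz pw.
    have az := analytic_near_increment1 a0 b0 (w0 z pz).
    exact: dv_eq (dv_pd2 az) (flat z pz).
  have [||z hz] := @MVT_segment _ (increment1 a b 0) (fun=> 0) y y' yy.
  - by move=> z; rewrite in_itv /= => /andP[/ltW hz _]; exact: dz.
  - by apply: derivable_within_continuous => z; rewrite in_itv /= => /andP[/dz [dd _] _].
  by rewrite mul0r !E => /eqP; rewrite subr_eq0 => /eqP.
have [y1 [pw1 b1']] := phase1_tall_well (R := R) a0 b1.
have [y2 [pw2 b2]] := phase1_shallow_well (R := R) a0 b1.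
have : phase1 a b 0 y1 = phase1 a b 0 y2.
  by case: (leP y1 y2) => [h|/ltW h]; [exact: cst|apply/esym/cst].
have : 0 < pi / a%:R :> R by rewrite divr_gt0 ?pi_gt0 // ltr0n.
lra.
Qed.

End JacobianNotFlat.

(** * Exchange of the two circles *)

Section ChainRule.
Context {R : realType}.

Lemma dvP (f : R -> R) (x l : R) : dv f x l <-> h^-1 * (f (x + h) - f x) @[h --> 0^'] --> l.
Proof.
have E : (fun h => h^-1 *: (f (h *: 1 + x) - f x)) = (fun h : R => h^-1 * (f (x + h) - f x)).
  by apply/funext => h; rewrite /GRing.scale /= mulr1 (addrC h).
split=> [dd|L].
  have [d <-] := dd; move: d; rewrite /derivable /derive /= E => /cvg_ex [l1 L].
  by rewrite (cvg_lim (@norm_hausdorff _ _) L).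
by split; [rewrite /derivable /= E; apply/cvg_ex; exists l|rewrite /derive /= E; exact: cvg_lim].
Qed.

Lemma dv_chain2 (f : R -> R -> R) (X Y : R -> R) (t0 x' y' : R) : analytic_near f (X t0) (Y t0) ->
  dv X t0 x' -> dv Y t0 y' ->
  dv (fun t => f (X t) (Y t)) t0 (x' * pd1 f (X t0) (Y t0) + y' * pd2 f (X t0) (Y t0)).
Proof.
move=> af dX dY; have [r [K [r0 K0 H]]] := analytic_near_taylor af.
set p1 := pd1 _ _ _ in H *; set p2 := pd2 _ _ _ in H *.
have incr (Z : R -> R) (z : R) : dv Z t0 z -> (Z (t0 + h) - Z t0) @[h --> 0^'] --> (0 : R).
  move=> /dv_continuous cZ; suff : (Z (t0 + h) - Z t0) @[h --> 0^'] --> Z t0 - Z t0 by rewrite subrr.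
  apply: cvgB; last exact: cvg_cst.
  have L : (fun h => Z (t0 + h)) @ nbhs (0 : R) --> Z t0.
    have L0 : (fun h => t0 + h) @ nbhs (0 : R) --> t0.
      suff : (fun h => t0 + h) @ nbhs (0 : R) --> t0 + 0 by rewrite addr0.
      apply: cvgD; [exact: cvg_cst|exact: cvg_id].
    exact: cvg_comp L0 cZ.
  by apply: cvg_within_filter; exact: L.
have iX := incr X x' dX; have iY := incr Y y' dY.
have /dvP qX := dX; have /dvP qY := dY; apply/dvP.
pose DX h := X (t0 + h) - X t0; pose DY h := Y (t0 + h) - Y t0.
pose e h := h^-1 * (f (X (t0 + h)) (Y (t0 + h)) - f (X t0) (Y t0) - DX h * p1 - DY h * p2).
have -> : (fun h => h^-1 * (f (X (t0 + h)) (Y (t0 + h)) - f (X t0) (Y t0))) =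
   (fun h => (h^-1 * DX h * p1 + h^-1 * DY h * p2) + e h).
  by apply/funext => h; rewrite /e; ring.
have -> : x' * p1 + y' * p2 = (x' * p1 + y' * p2) + 0 by rewrite addr0.
apply: cvgD.
  by apply: cvgD; apply: cvgM => //; exact: cvg_cst.
pose B h := K * (`|DX h| + `|DY h|) * (`|h^-1 * DX h| + `|h^-1 * DY h|).
have cB : B h @[h --> 0^'] --> (0 : R).
  suff : B h @[h --> 0^'] --> K * (`|0 : R| + `|0 : R|) * (`|x'| + `|y'|).
    by rewrite normr0 addr0 mulr0 mul0r.
  apply: cvgM; first by apply: cvgM; [exact: cvg_cst|apply: cvgD; apply: cvg_norm].
  by apply: cvgD; apply: cvg_norm.
have cB' : (- B h) @[h --> 0^'] --> (0 : R) by rewrite -oppr0; apply: cvgN; rewrite oppr0.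
apply: (squeeze_cvgr _ cB' cB).
have sm (Z : R -> R) : Z h @[h --> 0^'] --> (0 : R) -> \forall h \near 0^', `|Z h| < r / 2.
  by move=> /cvgr0Pnorm_lt; apply; lra.
have smX := sm _ iX; have smY := sm _ iY.
near=> h.
have hX : `|DX h| < r / 2 by near: h. have hY : `|DY h| < r / 2 by near: h.
have nX := normr_ge0 (DX h); have nY := normr_ge0 (DY h).
have EX : X t0 + DX h = X (t0 + h) by rewrite /DX; ring.
have EY : Y t0 + DY h = Y (t0 + h) by rewrite /DY; ring.
have := H (`|DX h| + `|DY h|) (DX h) (DY h) 0 0 (addr_ge0 nX nY).
rewrite EX EY !addr0 !subr0 normr0 => T.
rewrite -ler_norml /e normrM /B.
apply: le_trans (ler_wpM2l (normr_ge0 _) (T _ _ _ _ _)) _; [lra|lra|lra|lra|lra|].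
by rewrite !normrM le_eqVlt; apply/orP; left; apply/eqP; ring.
Unshelve. all: by end_near. Qed.

End ChainRule.

Section Swap.
Context {R : realType}.
Variables (a b : nat).
Hypotheses (a0 : (0 < a)%N) (b0 : (0 < b)%N).
Implicit Types (c x y u : R).

(** The reflection u |-> 1 - u exchanges the roles of the two circles. *)
Lemma Qpol_swap x y u : 0 < x -> Qpol a b x y (1 - u) = x * Qpol b a x^-1 (y / x) u.
Proof.
move=> x0; rewrite /Qpol /wgt /ell subKr; field; lra.
Qed.

Lemma root_pair_swap x y al be : 0 < x ->
  root_pair a b x y al be -> root_pair b a x^-1 (y / x) (1 - be) (1 - al).
Proof.
move=> x0 [al0 ab be1 Qal Qbe].
have E u : Qpol a b x y u = 0 -> Qpol b a x^-1 (y / x) (1 - u) = 0.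
  rewrite -{1}(subKr 1 u) Qpol_swap // => /eqP.
  by rewrite mulf_eq0 (gt_eqF x0) /= => /eqP.
by split; [lra|lra|lra|exact: E|exact: E].
Qed.

Lemma potential_well_swap x y : 0 < x -> potential_well a b x y -> potential_well b a x^-1 (y / x).
Proof.
move=> x0 [u hu Qu]; exists (1 - u); first lra.
by move: Qu; rewrite -{1}(subKr 1 u) Qpol_swap // pmulr_rgt0.
Qed.

Lemma umid_swap (al be phi : R) : umid (1 - be) (1 - al) (pi - phi) = 1 - umid al be phi.
Proof. by rewrite /umid cosB cospi sinpi mul0r addr0 mulN1r; field. Qed.

Lemma continuous_reflect (f : R -> R) : continuous f -> continuous (fun phi => f (pi - phi)).
Proof.
move=> cf phi; have L : (pi - h) @[h --> phi] --> pi - phi.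
  by apply: cvgB; [exact: cvg_cst|exact: cvg_id].
exact: cvg_comp L (cf _).
Qed.

Lemma prim_reflect (f : R -> R) : continuous f -> prim (fun phi => f (pi - phi)) pi = prim f pi.
Proof.
move=> cf; rewrite (@primE _ _ (fun phi => - prim f (pi - phi))).
- by rewrite subrr subr0 prim0 // oppr0 sub0r opprK.
- exact: continuous_reflect.
- move=> phi; have d := dvB (dv_cst pi phi) (dv_id phi).
  by apply: dv_eq (dvN (@dv_comp _ _ (fun t => pi - t) phi _ _ (dv_prim (pi - phi) cf) d)) _; ring.
Qed.

Lemma prim_eq (f g : R -> R) x : continuous f -> continuous g -> 0 <= x ->
  (forall z, 0 < z < x -> f z = g z) -> prim f x = prim g x.
Proof.
move=> cf cg x0 fg; apply/eqP; rewrite eq_le; apply/andP.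
by split; apply: prim_le => // z hz; rewrite fg.
Qed.

Lemma phase1_swap x y : 0 < x -> admissible b x -> potential_well a b x y ->
  phase1 a b x y = (Num.sqrt x)^-1 * phase2 b a x^-1 (y / x).
Proof.
move=> x0 ax pw; have [al [be rp]] := root_pair_exists a0 b0 ax pw.
have x0' : 0 < x^-1 by rewrite invr_gt0.
have ax' : admissible a x^-1 by left.
have rp' := root_pair_swap x0 rp; have [al0 ab be1 _ _] := rp.
rewrite /phase1 /phase2 (rootsE a0 b0 ax rp) (rootsE b0 a0 ax' rp') /=.
have c1 := continuous_dens1 a0 b0 ax rp; have c2 := continuous_dens2 b0 a0 ax' rp'.
have c2' := continuous_reflect c2.
rewrite -(prim_reflect c2) -(primZ _ _ c2').
apply: prim_eq => //; first last.
- move=> phi hphi; rewrite /dens1 /dens2 umid_swap; set u := umid al be phi.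
  have u01 : 0 < u < 1 := umid01 phi rp.
  have sp : (u - al) * (be - u) != 0.
    have : (u - al) * (be - u) = ((be - al) / 2 * sin phi) ^+ 2.
      by rewrite exprMn sin2cos2 /u /umid; field.
    by move=> ->; rewrite gt_eqF // exprn_gt0 // mulr_gt0 ?sin_gt0_pi //; lra.
  have E : Gpol a b y al be u = x * Gpol b a (y / x) (1 - be) (1 - al) (1 - u).
    apply: (mulfI sp); rewrite -(Gpol_factor u rp) -{1}(subKr 1 u) Qpol_swap // (Gpol_factor _ rp').
    by ring.
  by rewrite E sqrtrM ?(ltW x0) // invfM; ring.
- exact: pi_ge0.
- by move=> phi; apply: cvgM; [exact: cvg_cst|exact: c2'].
Qed.

End Swap.

Section JacobianSwap.
Context {R : realType}.
Variables (a b : nat).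
Hypotheses (a0 : (0 < a)%N) (b0 : (0 < b)%N).
Implicit Types (c y : R).

Lemma well_swap c y : c != 0 -> well a b c y -> well b a c^-1 (y / c ^+ 2).
Proof.
move=> c0 [_ pw]; have x0 : 0 < c ^+ 2 by rewrite exprn_even_gt0.
split; first by left; rewrite exprn_even_gt0 // invr_eq0.
by rewrite exprVn; exact: potential_well_swap.
Qed.

Lemma increment1_swap c y : c != 0 -> well a b c y -> increment1 a b c y = Num.sg c * increment2 b a c^-1 (y / c ^+ 2).
Proof.
move=> c0 [ax pw]; have x0 : 0 < c ^+ 2 by rewrite exprn_even_gt0.
rewrite /increment1 (phase1_swap a0 b0 x0 ax pw) /increment2 exprVn sqrtr_sqr mulrA; congr (_ * _).
by rewrite normrEsg invfM invr_sg.
Qed.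

Lemma increment2_swap c y : c != 0 -> well a b c y -> increment2 a b c y = Num.sg c * increment1 b a c^-1 (y / c ^+ 2).
Proof.
move=> c0 w; have [ax pw] := w; have [ax' pw'] := well_swap c0 w.
have x0 : 0 < c ^+ 2 by rewrite exprn_even_gt0.
have x0' : 0 < (c ^+ 2)^-1 by rewrite invr_gt0.
have s0 : Num.sqrt (c ^+ 2) != 0 by rewrite sqrtr_sqr normr_eq0.
rewrite /increment1 /increment2; rewrite exprVn in ax' pw' *.
rewrite (phase1_swap b0 a0 x0' ax' pw') invrK divfK ?gt_eqF // sqrtrV ?(ltW x0) // invrK mulrA.
by congr (_ * _); rewrite sqrtr_sqr -numEsg.
Qed.

Lemma well_near c y : well a b c y -> (\forall s \near c, well a b s y) /\ (\forall t \near y, well a b c t).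
Proof.
move=> w; have [r r0 H] := well_open a0 b0 w; split.
  apply/nbhs_ballP; exists r => // s; rewrite /ball /= distrC => hs.
  have -> : s = c + (s - c) by ring. have -> : y = y + 0 by ring.
  by apply: H; rewrite ?normr0 ltW.
apply/nbhs_ballP; exists r => // t; rewrite /ball /= distrC => ht.
have -> : t = y + (t - y) by ring. have -> : c = c + 0 by ring.
by apply: H; rewrite ?normr0 ltW.
Qed.

Lemma pd_swap (F G : R -> R -> R) c y : c != 0 -> well a b c y ->
  (forall s t, s != 0 -> well a b s t -> F s t = Num.sg s * G s^-1 (t / s ^+ 2)) ->
  analytic_near F c y -> analytic_near G c^-1 (y / c ^+ 2) ->
  pd1 F c y = Num.sg c * (- c^-1 ^+ 2 * pd1 G c^-1 (y / c ^+ 2) - 2 * y * c^-1 ^+ 3 * pd2 G c^-1 (y / c ^+ 2)) /\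
  pd2 F c y = Num.sg c * (c^-1 ^+ 2 * pd2 G c^-1 (y / c ^+ 2)).
Proof.
move=> c0 w FG aF aG; have [ws wt] := well_near w; split.
  apply: dv_unique (dv_pd1 aF) _.
  have sgc : \forall s \near c, (s != 0) && (Num.sg s == Num.sg c).
    apply/nbhs_ballP; exists `|c|; first by rewrite /= normr_gt0.
    move=> s; rewrite /ball /= ltr_norml => hs; case: (ltgtP 0 c) c0 hs => [h|h|<- /eqP]; last by [].
      rewrite gtr0_norm // => _ hs; have s0 : 0 < s by lra.
      by rewrite gt_eqF // !gtr0_sg //= eqxx.
    rewrite ltr0_norm // => _ hs; have s0 : s < 0 by lra.
    by rewrite lt_eqF // !ltr0_sg //= eqxx.
  have dV : dv (fun s => s^-1) c (- c^-1 ^+ 2) by apply: dv_eq (dvV c0 (dv_id c)) _; rewrite mulN1r exprVn.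
  have dY : dv (fun s => y / s ^+ 2) c (- 2 * y * c^-1 ^+ 3).
    have c2 : c ^+ 2 != 0 by rewrite expf_neq0.
    by apply: dv_eq (dvZ y (@dvV _ (fun s => s ^+ 2) c _ c2 (dvX 2 (dv_id c)))) _; field.
  have := dvZ (Num.sg c) (@dv_chain2 _ G (fun s => s^-1) (fun s => y / s ^+ 2) c _ _ aG dV dY).
  move=> d; have := dv_near _ d; move=> /(_ (fun s => F s y)) D.
  apply: dv_eq (D _) _; last by ring.
  near=> s; have /andP[s0 /eqP <-] : (s != 0) && (Num.sg s == Num.sg c) by near: s.
  by rewrite FG //; near: s.
apply: dv_unique (dv_pd2 aF) _.
have dY : dv (fun t => t / c ^+ 2) y (c^-1 ^+ 2).
  by apply: dv_eq (dvM (dv_id y) (dv_cst _ y)) _; rewrite mul1r mulr0 addr0 exprVn.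
have d := dvZ (Num.sg c) (@dv_comp _ (fun t => G c^-1 t) (fun t => t / c ^+ 2) y _ _ (dv_pd2 aG) dY).
apply: dv_eq (dv_near _ d) _; last by ring.
by near=> t; rewrite FG //; near: t.
Unshelve. all: by end_near. Qed.

(** The map (c, y) |-> (1 / c, y / c^2) has determinant - 1 / c^4, and exchanging
    the two phases changes the sign of the determinant again. *)
Lemma increment_jacobian_swap c y : c != 0 -> well a b c y -> increment_jacobian a b c y = increment_jacobian b a c^-1 (y / c ^+ 2) * c^-1 ^+ 4.
Proof.
move=> c0 w; have w' := well_swap c0 w.
have [E1 E2] := pd_swap c0 w increment1_swap (analytic_near_increment1 a0 b0 w) (analytic_near_increment2 b0 a0 w').
have [E3 E4] := pd_swap c0 w increment2_swap (analytic_near_increment2 a0 b0 w) (analytic_near_increment1 b0 a0 w').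
have s1 : Num.sg c ^+ 2 = 1 by rewrite sqr_sg c0.
rewrite /increment_jacobian E1 E2 E3 E4; set F1 := pd1 (increment1 b a) _ _; set F2 := pd2 (increment1 b a) _ _.
set G1 := pd1 (increment2 b a) _ _; set G2 := pd2 (increment2 b a) _ _; set v := c^-1.
transitivity (Num.sg c ^+ 2 * ((F1 * G2 - F2 * G1) * v ^+ 4)); first by ring.
by rewrite s1 mul1r.
Qed.

End JacobianSwap.

Section JacobianDense.
Context {R : realType}.
Implicit Types (c y d : R).

(** One of the exponents exceeds 1, and the exchange of the circles reduces the
    case b = 1 to [increment_jacobian_not_flat]. *)
Lemma increment_jacobian_dense a b c0 y0 d : (0 < a)%N -> (0 < b)%N -> (1 < a)%N || (1 < b)%N ->
  c0 != 0 -> well a b c0 y0 -> 0 < d ->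
  exists c y, [/\ `|c - c0| < d, `|y - y0| < d & increment_jacobian a b c y != 0].
Proof.
move=> a0 b0 ab1 c00 w d0; case: (ltnP 1 b) => [b1|b1]; first exact: increment_jacobian_not_flat.
have a1 : (1 < a)%N by move: ab1; rewrite (ltnNge 1 b) b1 orbF.
have [r r0 wr] := well_open a0 b0 w.
pose q := Num.min r d; have q0 : 0 < q by rewrite lt_min r0.
have qr : q <= r by rewrite ge_min lexx. have qd : q <= d by rewrite ge_min lexx orbT.
have i0 : c0^-1 != 0 by rewrite invr_eq0.
set u := c0^-1 in i0 *; set v := y0 / c0 ^+ 2.
have cI : (fun p : R * R => p.1^-1) @ (u, v) --> c0.
  suff : (fun p : R * R => p.1^-1) @ (u, v) --> u^-1 by rewrite invrK.
  by apply: cvgV => //; exact: cvg_fst.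
have cY : (fun p : R * R => p.2 * (p.1^-1 * p.1^-1)) @ (u, v) --> y0.
  suff : (fun p : R * R => p.2 * (p.1^-1 * p.1^-1)) @ (u, v) --> v * (c0 * c0).
    by rewrite /v expr2 divfK // mulf_neq0.
  by apply: cvgM; [exact: cvg_snd|apply: cvgM].
have /cvgrPdist_lt/(_ q q0) nI := cI; have /cvgrPdist_lt/(_ q q0) nY := cY.
pose S := [set p : R * R | `|c0 - p.1^-1| < q /\ `|y0 - p.2 * (p.1^-1 * p.1^-1)| < q].
have : nbhs (u, v) S by apply: filterS (filterI nI nY).
move=> /nbhs_ballP [e /= e0 He].
have m0 : 0 < Num.min e `|u| by rewrite lt_min e0 normr_gt0.
have [c' [y' [hc hy J]]] := increment_jacobian_not_flat b0 a1 (well_swap c00 w) m0.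
move: hc hy; rewrite !lt_min => /andP[hc hcu] /andP[hy _].
have c'0 : c' != 0.
  by apply/eqP => E; move: hcu; rewrite E sub0r normrN ltxx.
have [] : `|c0 - c'^-1| < q /\ `|y0 - y' * (c'^-1 * c'^-1)| < q.
  by have [] := He (c', y') _; [split; rewrite /ball /= distrC|].
rewrite !(distrC _ (_^-1)) (distrC y0) => h1 h2.
have w' : well a b c'^-1 (y' * (c'^-1 * c'^-1)).
  have := wr (c'^-1 - c0) (y' * (c'^-1 * c'^-1) - y0).
  by rewrite !(addrC _ (_ - _)) !subrK; apply; lra.
exists c'^-1, (y' * (c'^-1 * c'^-1)); split; [exact: lt_le_trans qd|exact: lt_le_trans qd|].
have ci0 : c'^-1 != 0 by rewrite invr_eq0.
have -> := increment_jacobian_swap a0 b0 ci0 w'.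
apply: mulf_neq0; last by apply: expf_neq0; rewrite invr_eq0.
have -> : y' * (c'^-1 * c'^-1) / c'^-1 ^+ 2 = y' by field; exact: c'0.
rewrite (invrK c').
exact: J.
Qed.

End JacobianDense.

(** * Maps of the plane *)

HB.instance Definition _ (R : realType) (m n : nat) := Complete.on 'M[R]_(m, n).

Section PlaneMaps.
Context {R : realType}.
Implicit Types (v w p q : 'rV[R]_2) (g : 'I_2 -> R -> R -> R).

Lemma I2P (i : 'I_2) : i = 0 \/ i = 1.
Proof. by case: i => [[|[|i]] Hi] //; [left|right]; apply/val_inj. Qed.

Lemma rV_coord_le v (j : 'I_2) : `|v 0 j| <= `|v|.
Proof.
rewrite [leRHS]/Num.Def.normr /= mx_normrE.
by apply: (@le_bigmax _ _ _ 0 (fun ij : 'I_1 * 'I_2 => `|v ij.1 ij.2|) (0, j)).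
Qed.

Lemma rV_norm_le v (c : R) : (forall j, `|v 0 j| <= c) -> `|v| <= c.
Proof.
move=> H; rewrite [leLHS]/Num.Def.normr /= mx_normrE; apply/bigmax_leP.
split=> [|[i j] _ /=]; first exact: le_trans (normr_ge0 _) (H 0).
by rewrite (ord1 i).
Qed.

Lemma rV_mul_le v (A : 'M[R]_2) (N : R) : (forall i j, `|A i j| <= N) -> `|v *m A| <= 2 * N * `|v|.
Proof.
move=> AN; apply: rV_norm_le => j; rewrite mxE !big_ord_recl big_ord0 addr0.
apply: le_trans (ler_normD _ _) _; rewrite !normrM.
have h0 := ler_pM (normr_ge0 _) (normr_ge0 _) (rV_coord_le v 0) (AN 0 j).
have h1 := ler_pM (normr_ge0 _) (normr_ge0 _) (rV_coord_le v (lift 0 0)) (AN (lift 0 0) j).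
by apply: le_trans (lerD h0 h1) _; lra.
Qed.

Definition plane_map g q : 'rV[R]_2 := \row_j g j (q 0 0) (q 0 1).
Definition jacobian_matrix g q : 'M[R]_2 :=
  \matrix_(i, j) (if i == 0 then pd1 (g j) else pd2 (g j)) (q 0 0) (q 0 1).

Lemma plane_map_taylor g p : (forall j, analytic_near (g j) (p 0 0) (p 0 1)) ->
  exists r K, [/\ 0 < r, 0 <= K & forall d v w, d <= r -> `|v| <= d -> `|w| <= d ->
    `|plane_map g (p + v) - plane_map g (p + w) - (v - w) *m jacobian_matrix g p| <= K * d * `|v - w|].
Proof.
move=> ag; have [r0 [K0 [r0p K0p H0]]] := analytic_near_taylor (ag 0).
have [r1 [K1 [r1p K1p H1]]] := analytic_near_taylor (ag 1).
exists (Num.min r0 r1), (2 * (K0 + K1)); split; [by rewrite lt_min r0p|by apply: mulr_ge0 => //; exact: addr_ge0|].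
move=> d v w dr vd wd; have d0 : 0 <= d := le_trans (normr_ge0 _) vd.
have dr0 : d <= r0 by apply: le_trans dr _; rewrite ge_min lexx.
have dr1 : d <= r1 by apply: le_trans dr _; rewrite ge_min lexx orbT.
have n0 := rV_coord_le (v - w) 0; have n1 := rV_coord_le (v - w) 1.
rewrite !mxE in n0 n1.
have cv j := le_trans (rV_coord_le v j) vd; have cw j := le_trans (rV_coord_le w j) wd.
have B K : 0 <= K -> K <= K0 + K1 ->
    K * d * (`|v 0 0 - w 0 0| + `|v 0 1 - w 0 1|) <= 2 * (K0 + K1) * d * `|v - w|.
  move=> Kp KK; have -> : 2 * (K0 + K1) * d * `|v - w| = ((K0 + K1) * d) * (`|v - w| + `|v - w|) by ring.
  by apply: ler_pM; rewrite ?mulr_ge0 ?addr_ge0 ?lerD // ler_wpM2r.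
apply: rV_norm_le => j; rewrite !mxE !big_ord_recl big_ord0 addr0 !mxE /=.
rewrite (_ : lift ord0 ord0 = 1 :> 'I_2); last exact/val_inj.
rewrite opprD addrA; case: (I2P j) => ->.
  by apply: le_trans (H0 d _ _ _ _ d0 dr0 (cv 0) (cv 1) (cw 0) (cw 1)) (B _ _ _) => //; rewrite lerDl.
by apply: le_trans (H1 d _ _ _ _ d0 dr1 (cv 0) (cv 1) (cw 0) (cw 1)) (B _ _ _) => //; rewrite lerDr.
Qed.

Lemma mx_entry_bound (A : 'M[R]_2) : exists2 N, 0 < N & forall i j, `|A i j| <= N.
Proof.
exists (`|A| + 1); first by rewrite ltr_wpDl.
move=> i j; apply: le_trans (_ : `|A| <= _); last by rewrite lerDl.
rewrite [leRHS]/Num.Def.normr /= mx_normrE.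
by apply: (@le_bigmax _ _ _ 0 (fun ij : 'I_2 * 'I_2 => `|A ij.1 ij.2|) (i, j)).
Qed.

Lemma mulmxr_continuous (A : 'M[R]_2) : continuous (mulmxr A : 'rV[R]_2 -> 'rV[R]_2).
Proof.
apply: bounded_linear_continuous; apply/linear_boundedP.
have [N N0 AN] := mx_entry_bound A.
exists (2 * N); split; first exact: num_real.
by move=> M NM v /=; apply: le_trans (rV_mul_le _ AN) _; rewrite ler_wpM2r // ltW.
Qed.

Lemma plane_map_differentiable g (f : 'rV[R]_2 -> 'rV[R]_2) p :
  (forall j, analytic_near (g j) (p 0 0) (p 0 1)) -> (\forall q \near p, f q = plane_map g q) ->
  'J f p = jacobian_matrix g p.
Proof.
move=> ag fg; have [r [K [r0 K0 H]]] := plane_map_taylor ag.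
have fp : f p = plane_map g p := nbhs_singleton fg.
pose A := jacobian_matrix g p.
have E : 'd f p = mulmxr A :> ('rV[R]_2 -> 'rV[R]_2).
  apply: diff_unique; first exact: mulmxr_continuous.
  apply/eqaddoP => e /= e0.
  have d0 : 0 < Num.min r (e / (K + 1)) by rewrite lt_min r0 divr_gt0 //; lra.
  have near0 : \forall v \near (0 : 'rV[R]_2), f (v + p) = plane_map g (v + p).
    have L : (fun v => v + p) @ nbhs (0 : 'rV[R]_2) --> p.
      suff : (fun v => v + p) @ nbhs (0 : 'rV[R]_2) --> 0 + p by rewrite add0r.
      by apply: cvgD; [exact: cvg_id|exact: cvg_cst].
    exact: L fg.
  have nd : nbhs (0 : 'rV[R]_2) [set v | `|v| < Num.min r (e / (K + 1))].
    by apply/nbhs_ballP; exists (Num.min r (e / (K + 1))) => // v; rewrite -ball_normE /= sub0r normrN.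
  near=> v; have vd : `|v| < Num.min r (e / (K + 1)).
    by near: v; exact: nd.
  move: vd; rewrite lt_min => /andP[vr ve].
  have := H `|v| v 0 (ltW vr) (lexx _); rewrite normr0 subr0 addr0 => /(_ (normr_ge0 _)) B.
  rewrite /= /cst !fctE fp (_ : f (v + p) = plane_map g (v + p)); last by near: v.
  rewrite opprD addrA (addrC v p); apply: le_trans B _.
  rewrite ler_wpM2r //; apply: le_trans (ler_wpM2l K0 (ltW ve)) _.
  by rewrite mulrCA ler_piMr ?(ltW e0) // ler_pdivrMr; lra.
apply/row_matrixP => i; rewrite !rowE mul_rV_lin1 E //.
Unshelve. all: by end_near. Qed.

(** Newton's iteration with the inverse of the Jacobian matrix at p contracts a
    small ball into itself. *)
Lemma plane_map_open g p (e : R) : (forall j, analytic_near (g j) (p 0 0) (p 0 1)) ->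
  jacobian_matrix g p \in unitmx -> 0 < e ->
  exists2 d, 0 < d & forall w, `|w - plane_map g p| < d -> exists2 q, `|q - p| < e & plane_map g q = w.
Proof.
move=> ag; set A := jacobian_matrix g p => uA e0; have [r [K [r0 K0 H]]] := plane_map_taylor ag.
pose B := invmx A.
have [N N0 BN] := mx_entry_bound B.
(* N bounds the entries of the inverse matrix and K comes from the Taylor
   estimate: on the ball of radius s the iteration is 1/2-Lipschitz *)
pose s := Num.min (Num.min r (e / 2)) (4 * N * (K + 1))^-1.
have s0 : 0 < s by rewrite !lt_min r0 invr_gt0 !mulr_gt0 //; lra.
have sr : s <= r by rewrite /s !ge_min lexx.
have se : s <= e / 2 by rewrite /s !ge_min lexx orbT.
have sN : 2 * N * (K * s) <= 1 / 2.
  have h : s <= (4 * N * (K + 1))^-1 by rewrite /s ge_min lexx orbT.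
  apply: le_trans (_ : 2 * N * (K * (4 * N * (K + 1))^-1) <= _).
    by rewrite ler_wpM2l ?mulr_ge0 ?(ltW N0) // ler_wpM2l.
  have -> : 2 * N * (K * (4 * N * (K + 1))^-1) = 1 / 2 * (K / (K + 1)) by field; apply/andP; split; lra.
  by rewrite ler_piMr // ?ler_pdivrMr; lra.
exists (s / (4 * N)); first by rewrite divr_gt0 ?mulr_gt0.
move=> w hw; pose T v : 'rV[R]_2 := v - (plane_map g (p + v) - w) *m B.
have TT v v' : `|v| <= s -> `|v'| <= s -> `|T v - T v'| <= 1 / 2 * `|v - v'|.
  move=> vs vs'; have h := H s v v' sr vs vs'.
  have -> : T v - T v' = - ((plane_map g (p + v) - plane_map g (p + v') - (v - v') *m A) *m B).
    rewrite [in RHS]mulmxBl mulmxK // /T.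
    have -> : plane_map g (p + v) - plane_map g (p + v') = (plane_map g (p + v) - w) - (plane_map g (p + v') - w).
      by rewrite opprB addrA subrK.
    rewrite [in RHS]mulmxBl; move: (_ *m B) (_ *m B) => X Y.
    by apply/rowP => j; rewrite !mxE; ring.
  rewrite normrN; apply: le_trans (rV_mul_le _ BN) _.
  apply: le_trans (ler_wpM2l _ h) _; first by rewrite mulr_ge0 ?ltW.
  by rewrite !mulrA ler_wpM2r // -!mulrA mulrA.
have T0 : `|T 0| <= s / 2.
  rewrite /T sub0r normrN addr0; apply: le_trans (rV_mul_le _ BN) _.
  rewrite distrC; apply: le_trans (ler_wpM2l _ (ltW hw)) _; first by rewrite mulr_ge0 ?ltW.
  by rewrite le_eqVlt; apply/orP; left; apply/eqP; field; lra.
pose U := [set v : 'rV[R]_2 | `|v| <= s].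
have n0 : `|0 : 'rV[R]_2| <= s by rewrite normr0 ltW.
have hT : {homo T : x / U x >-> U x}.
  move=> v vs; have := TT v 0 vs n0; rewrite subr0 => h.
  have -> : T v = (T v - T 0) + T 0 by rewrite subrK.
  apply: le_trans (ler_normD _ _) _; move: vs; rewrite /U /=; lra.
have cU : closed U.
  have -> : U = (fun v : 'rV[R]_2 => `|v|) @^-1` [set x | x <= s] by [].
  by apply: closed_comp; [move=> v _; exact: norm_continuous|exact: closed_le].
have [] := @banach_fixed_point R _ U (mkfun_fun hT) _ cU.
- have q0 : (0 : R) <= 1 / 2 by lra.
  exists (NngNum q0); split => /=; first lra.
  by move=> [x y] /= [xs ys]; exact: TT.
- by exists 0.
move=> v vs E; exists (p + v); first by rewrite addrC addKr; apply: le_lt_trans vs _; lra.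
have : (plane_map g (p + v) - w) *m B = 0.
  by move/eqP: E; rewrite /= /mkfun /T eq_sym subr_eq addrC -subr_eq subrr eq_sym => /eqP.
move=> /(congr1 (mulmx^~ A)); rewrite mulmxKV // mul0mx => /eqP; rewrite subr_eq0 => /eqP.
by [].
Qed.

End PlaneMaps.

(** * The phase map on the chambers *)

Section PhaseMap.
Context {R : realType}.
Variables (k1 k2 : nat) (eps : R).
Hypothesis e1 : eps ^+ 2 = 1.
Implicit Types (C q : 'rV[R]_2).

Let a0 : (0 < k1.+1)%N := isT.
Let b0 : (0 < k2.+1)%N := isT.

Let e0 : eps != 0.
Proof. by exact: sqr1_neq0 e1. Qed.

Definition phase_fun (j : 'I_2) (c y : R) : R :=
  eps / (2 * pi) * (if j == 0 then increment1 k1.+1 k2.+1 c y else increment2 k1.+1 k2.+1 c y).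

Lemma chambers_well C : chambers k1 k2 C -> well k1.+1 k2.+1 (C 0 0) (C 0 1).
Proof. by move=> [pw c0]; split => //; exact: admissible_sqr. Qed.

Lemma phase_map_plane C : chambers k1 k2 C -> phase_map k1 k2 eps C = plane_map phase_fun C.
Proof.
move=> hC; rewrite phase_mapE //; apply/rowP => j; rewrite !mxE /phase_fun.
by case: (I2P j) => ->; rewrite /= /increment1 /increment2; ring.
Qed.

Definition chamber (D : set 'rV[R]_2) := D = chamber_pos k1 k2 \/ D = chamber_neg k1 k2.

Lemma chamber_chambers D C : chamber D -> D C -> chambers k1 k2 C.
Proof. by move=> [->|->] DC; apply/chambersP; [left|right]. Qed.

Lemma chamber_sign D C q : chamber D -> D C -> chambers k1 k2 q -> `|q 0 0 - C 0 0| < `|C 0 0| -> D q.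
Proof.
move=> hD DC [pw q0]; have U : Uset k1 k2 q by apply/UsetP.
case: hD DC => -> [_ /= c0] d; split => //=; move: d.
  by rewrite (gtr0_norm c0) ltr_norml; lra.
by rewrite (ltr0_norm c0) ltr_norml; lra.
Qed.

Lemma chamber_open D C : chamber D -> D C -> exists2 r, 0 < r & forall q, `|q - C| < r -> D q.
Proof.
move=> hD DC; have hC := chamber_chambers hD DC; have [_ c0] := hC.
have [r r0 H] := well_open a0 b0 (chambers_well hC).
exists (Num.min r `|C 0 0|); first by rewrite lt_min r0 normr_gt0.
move=> q; rewrite lt_min => /andP[qr qc].
have h0 := rV_coord_le (q - C) 0; have h1 := rV_coord_le (q - C) 1; rewrite !mxE in h0 h1.
have q0 : `|q 0 0 - C 0 0| < `|C 0 0| by exact: le_lt_trans qc.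
apply: (chamber_sign hD DC _ q0).
have E j : q 0 j = C 0 j + (q 0 j - C 0 j) by ring.
split; last first.
  by apply/eqP => z; move: q0; rewrite z sub0r normrN ltxx.
have [||_ pw] := H (q 0 0 - C 0 0) (q 0 1 - C 0 1).
- by apply: le_trans h0 (ltW qr).
- by apply: le_trans h1 (ltW qr).
by rewrite -!E in pw.
Qed.

Lemma analytic_phase_fun C j : chambers k1 k2 C -> analytic_near (phase_fun j) (C 0 0) (C 0 1).
Proof.
move=> /chambers_well w; apply: analytic_near_scale.
by case: (I2P j) => ->; [exact: analytic_near_increment1|exact: analytic_near_increment2].
Qed.

Lemma nbhs_norm_lt C (r : R) : 0 < r -> nbhs C [set q | `|q - C| < r].
Proof. by move=> r0; apply/nbhs_ballP; exists r => // q; rewrite -ball_normE /= distrC. Qed.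

Lemma phase_map_near D C : chamber D -> D C -> \forall q \near C, phase_map k1 k2 eps q = plane_map phase_fun q.
Proof.
move=> hD DC; have [r r0 H] := chamber_open hD DC.
apply: filterS (nbhs_norm_lt C r0) => q /H Dq.
by apply: phase_map_plane; exact: chamber_chambers Dq.
Qed.

Lemma phase_map_analytic D : chamber D -> real_analytic_on D (phase_map k1 k2 eps).
Proof.
move=> hD C DC j; have hC := chamber_chambers hD DC.
have [r r0 [F [M pF] FE]] := analytic_phase_fun j hC.
have [c Hc] := pser_double_series r0 pF.
exists c; have nE := phase_map_near hD DC.
apply: filterS (filterI nE (nbhs_norm_lt C r0)) => q [/= -> qr].
have h0 := rV_coord_le (q - C) 0; have h1 := rV_coord_le (q - C) 1; rewrite !mxE in h0 h1.
have q0 := le_trans h0 (ltW qr); have q1 := le_trans h1 (ltW qr).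
rewrite [plane_map _ _ _ _]mxE.
have := FE 0 _ _ q0 q1; rewrite !(addrC (C _ _)) !subrK => ->.
exact: Hc.
Qed.

Lemma det2 (A : 'M[R]_2) : \det A = A 0 0 * A 1 1 - A 0 1 * A 1 0.
Proof.
rewrite (expand_det_row _ 0) !big_ord_recl big_ord0 addr0 /cofactor !det_mx11 !mxE /=.
have -> : lift ord0 ord0 = 1 :> 'I_2 by exact/val_inj.
have -> : lift 1 0 = 0 :> 'I_2 by exact/val_inj.
by rewrite expr0 expr1; ring.
Qed.

Lemma full_rankE D C : chamber D -> D C ->
  full_rank_locus k1 k2 eps C <-> increment_jacobian k1.+1 k2.+1 (C 0 0) (C 0 1) != 0.
Proof.
move=> hD DC; have hC := chamber_chambers hD DC; have w := chambers_well hC.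
rewrite /full_rank_locus /= (plane_map_differentiable (fun j => analytic_phase_fun j hC) (phase_map_near hD DC)).
set A := jacobian_matrix _ _.
have -> : \rank A = 2%N <-> A \in unitmx.
  rewrite -row_free_unit /row_free; split; [by move=> ->|by move/eqP].
rewrite unitmxE unitfE det2 !mxE /=.
have k0 : eps / (2 * pi) != 0 by rewrite mulf_neq0 // invr_neq0 // gt_eqF // mulr_gt0 ?pi_gt0.
have P (f : R -> R -> R) : analytic_near f (C 0 0) (C 0 1) ->
   pd1 (fun c y => eps / (2 * pi) * f c y) (C 0 0) (C 0 1) = eps / (2 * pi) * pd1 f (C 0 0) (C 0 1) /\
   pd2 (fun c y => eps / (2 * pi) * f c y) (C 0 0) (C 0 1) = eps / (2 * pi) * pd2 f (C 0 0) (C 0 1).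
  move=> af; have af' := analytic_near_scale (eps / (2 * pi)) af; split.
    exact: dv_unique (dv_pd1 af') (dvZ _ (dv_pd1 af)).
  exact: dv_unique (dv_pd2 af') (dvZ _ (dv_pd2 af)).
have [E1 E2] := P _ (analytic_near_increment1 a0 b0 w); have [E3 E4] := P _ (analytic_near_increment2 a0 b0 w).
have -> : phase_fun 0 = (fun c y => eps / (2 * pi) * increment1 k1.+1 k2.+1 c y) by [].
have -> : phase_fun 1 = (fun c y => eps / (2 * pi) * increment2 k1.+1 k2.+1 c y) by [].
rewrite E1 E2 E3 E4.
rewrite [X in X != 0](_ : _ = (eps / (2 * pi)) ^+ 2 * increment_jacobian k1.+1 k2.+1 (C 0 0) (C 0 1)); last by rewrite /increment_jacobian; ring.
by rewrite mulf_eq0 expf_eq0 /= (negbTE k0).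
Qed.

Lemma increment_jacobian_neq0_open D C : chamber D -> D C -> increment_jacobian k1.+1 k2.+1 (C 0 0) (C 0 1) != 0 ->
  nbhs C [set q : 'rV[R]_2 | increment_jacobian k1.+1 k2.+1 (q 0 0) (q 0 1) != 0].
Proof.
move=> hD DC; have w := chambers_well (chamber_chambers hD DC).
have [r [K [r0 K0 H]]] := analytic_near_lipschitz (analytic_near_increment_jacobian a0 b0 w).
set j0 := increment_jacobian _ _ (C 0 0) _ => j00; have j0p : 0 < `|j0| by rewrite normr_gt0.
have d0 : 0 < Num.min r (`|j0| / (2 * (K + 1))) by rewrite lt_min r0 divr_gt0 //; lra.
apply: filterS (nbhs_norm_lt C d0) => q /=; rewrite lt_min => /andP[qr qK]; apply/eqP => z.
have h0 := rV_coord_le (q - C) 0; have h1 := rV_coord_le (q - C) 1; rewrite !mxE in h0 h1.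
have n0 : `|0 : R| <= r by rewrite normr0 ltW.
have := H 0 0 _ _ n0 n0 (le_trans h0 (ltW qr)) (le_trans h1 (ltW qr)).
rewrite !addr0 !(addrC (C _ _)) !subrK z subr0 !sub0r !normrN -/j0; apply/negP; rewrite -ltNge.
move: qK; rewrite ltr_pdivlMr; last lra.
have := ler_wpM2l K0 (lerD h0 h1); nra.
Qed.

Lemma full_rank_open D : chamber D -> open (D `&` full_rank_locus k1 k2 eps).
Proof.
move=> hD; rewrite openE => C [DC FC]; have [r r0 H] := chamber_open hD DC.
apply: filterS (filterI (nbhs_norm_lt C r0) (increment_jacobian_neq0_open hD DC ((full_rankE hD DC).1 FC))) => q [/= /H Dq J].
split; [exact: Dq|exact: ((full_rankE hD Dq).2 J)].
Qed.

Lemma closure_norm (A : set 'rV[R]_2) C : (forall d, 0 < d -> exists2 q, A q & `|q - C| < d) -> closure A C.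
Proof.
move=> H B /nbhs_ballP [d /= d0 dB]; have [q Aq qd] := H d d0.
by exists q; split => //; apply: dB; rewrite -ball_normE /= distrC.
Qed.

Lemma full_rank_dense D C d : (0 < k1 + k2)%N -> chamber D -> D C -> 0 < d ->
  exists2 q, (D `&` full_rank_locus k1 k2 eps) q & `|q - C| < d.
Proof.
move=> kk hD DC d0; have hC := chamber_chambers hD DC; have [_ c0] := hC.
have [r r0 H] := chamber_open hD DC.
have m0 : 0 < Num.min r d / 2 by rewrite divr_gt0 // lt_min r0.
have kk' : (1 < k1.+1)%N || (1 < k2.+1)%N by lia.
have [c [y [hc hy J]]] := increment_jacobian_dense a0 b0 kk' c0 (chambers_well hC) m0.
pose q : 'rV[R]_2 := \row_j (if j == 0 then c else y).
have qC : `|q - C| < Num.min r d.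
  apply: le_lt_trans (_ : Num.min r d / 2 < _); last lra.
  by apply: rV_norm_le => j; rewrite !mxE; case: (I2P j) => -> /=; exact: ltW.
move: qC; rewrite lt_min => /andP[/H Dq qd]; exists q; last exact: qd.
split; first exact: Dq.
by apply: (full_rankE hD Dq).2; rewrite !mxE.
Qed.

(** Of two consecutive numerators around q x at least one is prime to q. *)
Lemma prime_fraction_near (x d : R) (q : nat) : prime q -> q%:R^-1 < d ->
  exists2 i : int, ~~ (q %| `|i|)%N & `|i%:~R / q%:R - x| < d.
Proof.
move=> pq qd; have q0 : 0 < q%:R :> R by rewrite ltr0n prime_gt0.
pose k := Num.floor (q%:R * x).
have /andP[k1' k2'] := Num.Theory.floor_itv (q%:R * x); rewrite -/k in k1' k2'.
have close (i : int) : `|i%:~R - q%:R * x| <= 1 -> `|i%:~R / q%:R - x| < d.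
  move=> h; apply: le_lt_trans qd.
  have -> : i%:~R / q%:R - x = (i%:~R - q%:R * x) / q%:R by field; rewrite gt_eqF.
  by rewrite normrM normfV (gtr0_norm q0) ler_pdivrMr // mulVf // gt_eqF.
case: (boolP (q %| `|k|)%N) => qk; last first.
  by exists k => //; apply: close; rewrite ler_norml; move: k2'; rewrite rmorphD /=; lra.
exists (k + 1); last by apply: close; rewrite ler_norml; move: k2'; rewrite rmorphD /=; lra.
have qk' : (q%:Z %| k)%Z by [].
have -> : (q %| `|(k + 1)%R|)%N = (q%:Z %| k + 1)%Z by [].
rewrite (rpredDl _ qk') dvdz1 /=; apply/eqP => E; by rewrite E in pq.
Qed.

Lemma fraction_closing_order C (q : nat) (i : 'I_2 -> int) : prime q -> ~~ (q %| `|i 0%R|)%N ->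
  (forall j, phase_map k1 k2 eps C 0 j = (i j)%:~R / q%:R) -> primitive_closing_order k1 k2 eps C q.
Proof.
move=> pq qi E; have q0 : q%:R != 0 :> R by rewrite pnatr_eq0 -lt0n prime_gt0.
split.
  by split; [exact: prime_gt0|move=> j; rewrite E mulrCA divff // mulr1 intr_int].
move=> m [m0 /(_ 0)]; rewrite E => /intrP [z Ez].
have Ez' : (m%:Z * i 0 = z * q%:Z)%R.
  apply: (@intr_inj R); rewrite !rmorphM /= -!pmulrn -Ez mulrA divfK //.
have : (q %| m * `|i 0%R|)%N.
  by have := congr1 absz Ez'; rewrite !abszM /= => ->; exact: dvdn_mull.
by rewrite Euclid_dvdM // (negbTE qi) orbF => /dvdn_leq; apply.
Qed.

(** Near a point of full rank the phase map is onto a neighbourhood of its value,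
    which contains fractions i / p with p any large prime; such a fraction has
    closing order p. *)
Lemma closed_dense D C d (M : nat) : (0 < k1 + k2)%N -> chamber D -> D C -> 0 < d ->
  exists2 q, (D `&` closed_parameters k1 k2 eps M) q & `|q - C| < d.
Proof.
move=> kk hD DC d0; have d2 : 0 < d / 2 by rewrite divr_gt0.
have [C1 [DC1 FC1] C1C] := full_rank_dense kk hD DC d2.
have [r r0 H] := chamber_open hD DC1; have hC1 := chamber_chambers hD DC1.
have an j := analytic_phase_fun j hC1.
have uA : jacobian_matrix phase_fun C1 \in unitmx.
  move: FC1; rewrite /full_rank_locus /= (plane_map_differentiable an (phase_map_near hD DC1)).
  by rewrite -row_free_unit /row_free => /eqP.
have m0 : 0 < Num.min r (d / 2) by rewrite lt_min r0.
have [e e0' He] := plane_map_open an uA m0.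
have [p Mp pp] := prime_above (maxn M (Num.bound e^-1)).
have pe : p%:R^-1 < e.
  have p0 : 0 < p%:R :> R by rewrite ltr0n prime_gt0.
  rewrite -[ltRHS]invrK ltf_pV2 ?posrE ?invr_gt0 //.
  apply: lt_le_trans (archi_boundP (ltW _)) _; first by rewrite invr_gt0.
  by rewrite ler_nat; apply: leq_trans (ltnW Mp); exact: leq_maxr.
have fr j := prime_fraction_near (plane_map phase_fun C1 0 j) pp pe.
have [i0 qi0 c0] := fr 0; have [i1 _ c1] := fr 1.
pose i (j : 'I_2) := if j == 0 then i0 else i1.
pose w : 'rV[R]_2 := \row_j ((i j)%:~R / p%:R).
have hw : `|w - plane_map phase_fun C1| < e.
  apply: le_lt_trans (_ : Num.max `|i0%:~R / p%:R - plane_map phase_fun C1 0 0| `|i1%:~R / p%:R - plane_map phase_fun C1 0 1| < _).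
    by apply: rV_norm_le => j; rewrite !mxE /i le_max; case: (I2P j) => ->; rewrite /= lexx ?orbT.
  by rewrite gt_max c0.
have [q qC1 qw] := He w hw; move: qC1; rewrite lt_min => /andP[/H Dq qd].
exists q; last first.
  have -> : q - C = (q - C1) + (C1 - C) by rewrite addrA subrK.
  by apply: le_lt_trans (ler_normD _ _) _; lra.
have hq := chamber_chambers hD Dq; split => //; split; first exact/locusP.
exists p; split; last by apply: leq_ltn_trans Mp; exact: leq_maxl.
apply: (@fraction_closing_order _ _ i) => // j.
by rewrite phase_map_plane // qw mxE.
Qed.

End PhaseMap.

Theorem theoremB (R : realType) (k1 k2 : nat) (eps : R)
    (heps : eps = 1 \/ eps = -1) :
  [/\ doubly_spiral_locus k1 k2 eps = chamber_pos k1 k2 `|` chamber_neg k1 k2,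
      chamber_pos k1 k2 `&` chamber_neg k1 k2 = set0 :> set 'rV[R]_2 &
      (0 < k1 + k2)%N ->
      forall D : set 'rV[R]_2, D = chamber_pos k1 k2 \/ D = chamber_neg k1 k2 ->
      [/\ real_analytic_on D (phase_map k1 k2 eps),
          open (D `&` full_rank_locus k1 k2 eps),
          D `<=` closure (D `&` full_rank_locus k1 k2 eps) &
          forall M : nat, D `<=` closure (D `&` closed_parameters k1 k2 eps M)]].
Proof.
have e1 : eps ^+ 2 = 1 by case: heps => ->; rewrite ?sqrrN expr1n.
split.
- apply/seteqP; split=> C.
    by move=> /(locusP _ _ _ e1) /chambersP.
  by move=> /chambersP /(locusP _ _ _ e1).
- by apply/seteqP; split=> C // [[_ /= h1] [_ /= h2]]; have := lt_trans h1 h2; rewrite ltxx.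
move=> kk D hD; split.
- exact: phase_map_analytic.
- exact: full_rank_open.
- by move=> C DC; apply: closure_norm => d d0; exact: full_rank_dense.
- by move=> M C DC; apply: closure_norm => d d0; exact: closed_dense.
Qed.
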